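(* Let $U,X$ be complex Hilbert spaces, let $S=\begin{bmatrix}A\&B\\ C\&D\end{bmatrix}$ be an impedance passive system node on $(U,X,U)$ whose transfer function satisfies $\mathrm{Re}\,P(\lambda)\ge c_\lambda I$ for some $\lambda,c_\lambda>0$. Let $\phi:U\to U$ be a continuous monotone function such that $\phi$ is locally Lipschitz continuous, $\phi(0)=0$, there exist constants $\alpha,\beta,\delta>0$ such that $$\mathrm{Re}\,\langle\phi(u),u\rangle\ge\alpha\|u\|^2\ \text{ when }\|u\|<\delta,\qquad\mathrm{Re}\,\langle\phi(u),u\rangle\ge\beta\ \text{ when }\|u\|\ge\delta,$$ and the operator $A_\phi$ is single-valued. Moreover, assume that the semigroup generated by $A^K$ is strongly stable. Then every generalised solution $x$ of $$(\ast)\qquad\dot x(t)=A_\phi(x(t)),\qquad t\ge0,$$ on $[0,\infty)$ satisfies $\|x(t)\|\to0$ as $t\to\infty$. If $x$ is a strong solution of $(\ast)$ on $[0,\infty)$, then the corresponding output $y$ satisfies $y,\phi(-y)\in L^2(0,\infty;U)\cap L^\infty(0,\infty;U)$. If $D(A_\phi)$ is dense in $X$, then the origin is a globally asymptotically stable equilibrium point of $(\ast)$, that is, for every initial state $x_0\in X$ the generalised solution $x$ on $[0,\infty)$ of $(\ast)$ satisfying $x(0)=x_0$ exists and satisfies $\|x(t)\|\to0$ as $t\to\infty$.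
   Context: $\mathrm{Re}\,T=\frac12(T+T^* )$. $\phi$ is monotone if $\mathrm{Re}\,\langle\phi(u_2)-\phi(u_1),u_2-u_1\rangle\ge0$ for all $u_1,u_2\in U$. A strongly continuous semigroup $\mathbb{T}$ on $X$ is strongly stable if $\mathbb{T}_tx_0\to0$ as $t\to\infty$ for all $x_0\in X$. For a generator $A$ of a strongly continuous semigroup on $X$, $X_{-1}$ is the completion of $X$ in the norm $\|(\lambda_0-A)^{-1}\cdot\|_X$ ($\lambda_0\in\rho(A)$ fixed), and $A$ also denotes its extension in $\mathcal{L}(X,X_{-1})$. A system node on $(U,X,Y)$ is a closed operator $S=\begin{bmatrix}A\&B\\ C\&D\end{bmatrix}:D(S)\subset X\times U\to X\times Y$ such that: (i) $Ax=A\&B\begin{bmatrix}x\\ 0\end{bmatrix}$, $D(A)=\{x\in X:(x,0)^\top\in D(S)\}$, generates a strongly continuous semigroup on $X$; (ii) $A\&B$ extends to $[A,\ B]\in\mathcal{L}(X\times U,X_{-1})$; (iii) $D(S)=\{(x,u)^\top\in X\times U:Ax+Bu\in X\}$. Its transfer function is $P(\lambda)u=C\&D\begin{bmatrix}(\lambda-A)^{-1}Bu\\ u\end{bmatrix}$, $\lambda\in\rho(A)$. $S$ is impedance passive if $Y=U$ and $\mathrm{Re}\,\langle A\&B\begin{bmatrix}x\\ u\end{bmatrix},x\rangle_X\le\mathrm{Re}\,\langle C\&D\begin{bmatrix}x\\ u\end{bmatrix},u\rangle_U$ for all $(x,u)^\top\in D(S)$. $D(A_\phi)$ is the set of $x\in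 X$ for which there exists $v\in U$ with $Ax+B\phi(-v)\in X$ and $v=C\&D\begin{bmatrix}x\\ \phi(-v)\end{bmatrix}$; $A_\phi x=Ax+B\phi(-v(x))$, where $v(x)$ denotes such an element $v$. $A_\phi$ being single-valued is equivalent to $v(x)$ being unique for every $x\in D(A_\phi)$. $D(A^K)$ is the set of $x\in X$ for which there exists $v\in U$ with $Ax-Bv\in X$ and $v=C\&D\begin{bmatrix}x\\ -v\end{bmatrix}$ (such $v=v(x)$ is unique), and $A^Kx=Ax-Bv(x)$; for an impedance passive $S$ it generates a contraction semigroup. A strong solution of $(\ast)$ is $x\in H^1_{\mathrm{loc}}(0,\infty;X)$ (i.e. in $H^1(0,\tau;X)$ for every $\tau>0$) with $x(t)\in D(A_\phi)$ for all $t\ge0$ and $(\ast)$ for a.e. $t\ge0$; its corresponding output is $y(t)=v(x(t))$, $t\ge0$. A generalised solution of $(\ast)$ on $[0,\infty)$ is $x\in C([0,\infty);X)$ for which there is a sequence $(x^k)$ of strong solutions with $\sup_{t\in[0,\tau]}\|x^k(t)-x(t)\|\to0$ as $k\to\infty$ for all $\tau>0$. *)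

(* Defs.v *)
From HB Require Import structures.
From mathcomp Require Import all_boot all_order all_algebra.
From mathcomp Require Import sesquilinear complex.
From mathcomp Require Import all_classical all_reals all_analysis.

Set Implicit Arguments.
Unset Strict Implicit.
Unset Printing Implicit Defensive.

Import Order.TTheory GRing.Theory Num.Theory.
Import numFieldNormedType.Exports.

Local Open Scope classical_set_scope.
Local Open Scope ring_scope.
Local Open Scope complex_scope.

(* The scalars are [R[i]]; [hdot] is linear in its first argument and
   conjugate-linear in its second one. *)
HB.mixin Record NormedModule_isHilbert (R : realType) H
    of CompleteNormedModule R[i] H := {
  hdot : {dot H for Num.conj} ;
  hdot_norm : forall x : H, hdot x x = `|x| ^+ 2
}.

#[short(type="hilbertType")]
HB.structure Definition Hilbert (R : realType) :=
  {H of NormedModule_isHilbert R H & CompleteNormedModule R[i] H}.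

(* Norms of vectors over [R[i]] are elements of [R[i]]; this is the same
   number seen in [R]. *)
Definition rnorm (R : realType) (V : normedModType R[i]) (x : V) : R :=
  complex.Re `|x|.

(* Bounded everywhere defined linear operators; for linear maps between normed
   spaces, bounded means continuous. *)
Definition bounded_operator (R : realType) (V W : normedModType R[i])
  (T : V -> W) := linear T /\ continuous T.

Definition is_adjoint (R : realType) (V W : hilbertType R)
    (T : V -> W) (T' : W -> V) :=
  forall (x : V) (y : W), hdot (T x) y = hdot x (T' y).

(* [Re T >= c I], where [Re T = (T + T^* ) / 2]; the order of [R[i]] forces both
   sides of the inequality to have the same imaginary part. *)
Definition re_ge (R : realType) (V : hilbertType R) (T : V -> V) (c : R) :=
  exists T' : V -> V, is_adjoint T T' /\
    forall x : V, hdot (c%:C *: x) x <= hdot (2%:R^-1 *: (T x + T' x)) x.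

(* A linear operator [D -> W] whose domain [D] is a subspace of [V]; the values
   of [lop] outside of [ldom] are irrelevant. *)
Record linop (R : realType) (V W : lmodType R[i]) := Linop {
  ldom : set V ;
  lop :> V -> W ;
  ldom0 : ldom 0 ;
  ldomP : forall (a : R[i]) (x y : V),
    ldom x -> ldom y -> ldom (a *: x + y) ;
  lopP : forall (a : R[i]) (x y : V),
    ldom x -> ldom y -> lop (a *: x + y) = a *: lop x + lop y
}.

Definition closed_op (R : realType) (V W : normedModType R[i])
  (S : linop V W) := closed [set p : V * W | ldom S p.1 /\ p.2 = S p.1].

(* Unbounded, possibly nonlinear or multi-valued operators on [V] are given by
   their graphs [G : V -> V -> Prop]. *)
Definition gdom (V : Type) (G : V -> V -> Prop) : set V :=
  [set x | exists w, G x w].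

Definition single_valued (V : Type) (G : V -> V -> Prop) :=
  forall x w1 w2, G x w1 -> G x w2 -> w1 = w2.

(* [Rl] is the bounded inverse of [lam - G]. *)
Definition is_resolvent (R : realType) (V : normedModType R[i])
    (G : V -> V -> Prop) (lam : R[i]) (Rl : V -> V) :=
  bounded_operator Rl /\
  forall x y, Rl x = y <-> exists2 w, G y w & lam *: y - w = x.

Definition resolvent_set (R : realType) (V : normedModType R[i])
    (G : V -> V -> Prop) : set R[i] :=
  [set lam | exists Rl, is_resolvent G lam Rl].

(* Only the values at times [t >= 0] are relevant. *)
Definition c0_semigroup (R : realType) (V : normedModType R[i])
    (T : R -> V -> V) :=
  [/\ forall t, 0 <= t -> bounded_operator (T t),
      forall x, T 0 x = x,
      forall s t x, 0 <= s -> 0 <= t -> T (s + t) x = T s (T t x) &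
      forall x, T t x @[t --> 0^'+] --> x].

Definition generator (R : realType) (V : normedModType R[i])
    (T : R -> V -> V) (x w : V) :=
  (t^-1)%:C *: (T t x - x) @[t --> 0^'+] --> w.

Definition generates (R : realType) (V : normedModType R[i])
    (G : V -> V -> Prop) (T : R -> V -> V) :=
  c0_semigroup T /\ forall x w, G x w <-> generator T x w.

Definition strongly_stable (R : realType) (V : normedModType R[i])
  (T : R -> V -> V) := forall x0, T t x0 @[t --> +oo] --> (0 : V).

(* The completion [X_{-1}] of [X] for the norm [x |-> `|(lam0 - A)^-1 x|], where
   [A] is the operator with graph [G]: a Banach space with a dense isometric
   linear embedding of [X]. It is unique up to an isometry which commutes with
   the embeddings. *)
Record extrapolation_space (R : realType) (X : normedModType R[i])
    (G : X -> X -> Prop) := ExtrapolationSpace {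
  ext_space :> completeNormedModType R[i] ;
  ext_lam : R[i] ;
  ext_res : X -> X ;
  ext_emb : X -> ext_space ;
  ext_resP : is_resolvent G ext_lam ext_res ;
  ext_emb_linear : linear ext_emb ;
  ext_emb_norm : forall x, `|ext_emb x| = `|ext_res x| ;
  ext_emb_dense : dense (range ext_emb)
}.

(* The graph of the main operator [A x = A&B (x, 0)] of [S]. *)
Definition main_graph (R : realType) (U X Y : lmodType R[i])
    (S : linop (X * U)%type (X * Y)%type) (x w : X) :=
  ldom S (x, 0) /\ w = (S (x, 0)).1.

(* [snode] is the operator [S], with [A&B] and [C&D] its two components. The
   space [X_{-1}], the extension [snA : X -> X_{-1}] of [A] and
   [snB : U -> X_{-1}] are determined by [S], up to the choice of the
   completion [X_{-1}]. *)
Record system_node (R : realType) (U X Y : hilbertType R) := SystemNode {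
  snode :> linop (X * U)%type (X * Y)%type ;
  sn_closed : closed_op snode ;
  sn_generates : exists T, generates (main_graph snode) T ;
  snX1 : extrapolation_space (main_graph snode) ;
  snA : X -> snX1 ;
  snB : U -> snX1 ;
  snA_bounded : bounded_operator snA ;
  snA_extends : forall x w, main_graph snode x w -> snA x = ext_emb snX1 w ;
  snB_bounded : bounded_operator snB ;
  snAB_extends : forall x u, ldom snode (x, u) ->
    ext_emb snX1 (snode (x, u)).1 = snA x + snB u ;
  sn_dom : forall x u,
    ldom snode (x, u) <-> exists w, snA x + snB u = ext_emb snX1 w
}.

Section SystemNodes.
Context {R : realType} {U X Y : hilbertType R}.

Definition snAB (S : system_node U X Y) (x : X) (u : U) : X := (S (x, u)).1.
Definition snCD (S : system_node U X Y) (x : X) (u : U) : Y := (S (x, u)).2.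

(* [(lam - A)^-1 B u], with the inverse of [lam - A : X -> X_{-1}]; only
   relevant when [lam] belongs to the resolvent set of [A]. *)
Definition resolventB (S : system_node U X Y) (lam : R[i]) (u : U) : X :=
  xget 0 [set x | lam *: ext_emb (snX1 S) x - snA S x = snB S u].

Definition transfer (S : system_node U X Y) (lam : R[i]) (u : U) : Y :=
  snCD S (resolventB S lam u) u.

End SystemNodes.

Definition impedance_passive (R : realType) (U X : hilbertType R)
    (S : system_node U X U) :=
  forall x u, ldom S (x, u) ->
    complex.Re (hdot (snAB S x u) x) <= complex.Re (hdot (snCD S x u) u).

Definition monotone_map (R : realType) (U : hilbertType R) (phi : U -> U) :=
  forall u1 u2 : U, 0 <= complex.Re (hdot (phi u2 - phi u1) (u2 - u1)).

Definition locally_lipschitz (R : realType) (V W : normedModType R[i])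
    (f : V -> W) :=
  forall x : V, exists2 A : set V, nbhs x A & [lipschitz f z | z in A].

Section Feedback.
Context {R : realType} {U X : hilbertType R}.
Variables (S : system_node U X U) (phi : U -> U).

(* [v] is an output of [S] at the state [x] under the feedback [u = phi (- v)],
   and [w = A x + B phi (- v)] belongs to [X]. *)
Definition feedback_at (x : X) (v : U) (w : X) :=
  snA S x + snB S (phi (- v)) = ext_emb (snX1 S) w /\
  v = snCD S x (phi (- v)).

Definition feedback_output (x : X) (v : U) := exists w, feedback_at x v w.

Definition feedback_graph (x w : X) := exists v, feedback_at x v w.

End Feedback.

(* [A^K], which is [A_phi] for the linear feedback [phi = id]. *)
Definition negative_feedback_graph (R : realType) (U X : hilbertType R)
  (S : system_node U X U) : X -> X -> Prop := feedback_graph S id.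

Section VectorFunctions.
Context {R : realType} {V : normedModType R[i]}.
Notation mu := (@lebesgue_measure R).

(* The list [(E_1, v_1), ..., (E_n, v_n)] stands for the simple function
   [\sum_k 1_{E_k} v_k]. *)
Definition simple_list (s : seq (set R * V)) :=
  forall p, p \in s -> measurable p.1 /\ (mu p.1 < +oo)%E.

Definition simple_eval (s : seq (set R * V)) (t : R) : V :=
  \sum_(p <- s) (\1_(p.1) t)%:C *: p.2.

Definition simple_integral (D : set R) (s : seq (set R * V)) : V :=
  \sum_(p <- s) (fine (mu (p.1 `&` D)))%:C *: p.2.

Definition strongly_measurable (D : set R) (f : R -> V) :=
  exists2 s : nat -> seq (set R * V), forall n, simple_list (s n) &
    {ae mu, forall t, D t -> simple_eval (s n) t @[n --> \oo] --> f t}.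

(* [v] is the Bochner integral of [f] over [D]. *)
Definition bochner_integral (D : set R) (f : R -> V) (v : V) :=
  strongly_measurable D f /\
  exists s : nat -> seq (set R * V),
    [/\ forall n, simple_list (s n),
        (\int[mu]_(t in D) (rnorm (f t - simple_eval (s n) t))%:E)%E
          @[n --> \oo] --> 0%E &
        simple_integral D (s n) @[n --> \oo] --> v].

Definition L2 (D : set R) (f : R -> V) :=
  strongly_measurable D f /\
  (\int[mu]_(t in D) (rnorm (f t) ^+ 2)%:E < +oo)%E.

Definition Linfty (D : set R) (f : R -> V) :=
  strongly_measurable D f /\
  exists M : R, {ae mu, forall t, D t -> rnorm (f t) <= M}.

(* [H^1(0, tau; V)]: the primitives of the functions in [L^2(0, tau; V)].
   Elements are identified with their continuous representatives, defined on
   [[0, tau]]. *)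
Definition H1 (tau : R) (f : R -> V) :=
  exists2 g : R -> V, L2 `]0, tau[ g &
    forall t, t \in `[0, tau] -> bochner_integral `]0, t[ g (f t - f 0).

Definition H1loc (f : R -> V) := forall tau : R, 0 < tau -> H1 tau f.

(* The derivative of [f] at [t] exists and is [w]; the library's [is_derive]
   needs the time and [V] to have the same scalars. *)
Definition has_derivative (f : R -> V) (t : R) (w : V) :=
  (h^-1)%:C *: (f (t + h) - f t) @[h --> 0^'] --> w.

End VectorFunctions.

Section Solutions.
Context {R : realType} {X : normedModType R[i]}.
Variable G : X -> X -> Prop.

(* [x'(t)] is meant for a.e. [t > 0]. When [G] is multi-valued this reads as
   the inclusion [x'(t) \in G (x t)]. *)
Definition strong_solution (x : R -> X) :=
  [/\ H1loc x,
      forall t, 0 <= t -> gdom G (x t) &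
      {ae lebesgue_measure, forall t : R, 0 < t ->
        exists2 w, G (x t) w & has_derivative x t w}].

Definition generalised_solution (x : R -> X) :=
  {within `[0, +oo[, continuous x} /\
  exists2 xk : nat -> R -> X, forall k, strong_solution (xk k) &
    forall tau : R, 0 < tau ->
      ereal_sup [set (rnorm (xk k t - x t))%:E | t in `[0, tau]]
        @[k --> \oo] --> 0%E.

End Solutions.

(* Main.v *)
Require Import Defs.
From mathcomp Require Import all_boot all_order all_algebra.
From mathcomp Require Import sesquilinear complex.
From mathcomp Require Import all_classical all_reals all_analysis.
From mathcomp Require Import measurable_realfun.
From mathcomp Require Import ring lra.

Set Implicit Arguments.
Unset Strict Implicit.
Unset Printing Implicit Defensive.

Import Order.TTheory GRing.Theory Num.Theory.
Import numFieldNormedType.Exports.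

Local Open Scope classical_set_scope.
Local Open Scope ring_scope.
Local Open Scope complex_scope.

(** Why the theorem is true. Write [G] for the graph of [A_phi].

    Passivity and monotonicity make [G] dissipative: the difference of two states
    moves against itself. At the given [lam] the node can be solved for the state
    and the output in terms of [r = lam x - A&B (x, u)] and [u], and the output is
    [C r + P u], with [C] and [P] bounded by the closed graph theorem and
    [Re P >= c]. Under the feedback [u = phi (- v)] this has two consequences.
    The output and the input are Lipschitz functions of [r]
    ([feedback_lipschitz]); and the equation for [v] can be solved for every [r],
    because it is strongly monotone once [P] has been inverted
    ([feedback_range]). So [G] is maximal dissipative ([feedback_yosida]).

    For a single-valued maximal dissipative [G] the implicit Euler scheme
    converges from every point of the domain. Its limit is Lipschitz, and has the
    value of [G] as right derivative at every time ([trajectory_exists]). The speed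
    of this trajectory decreases and is continuous from the right, hence the
    trajectory is differentiable off a countable set, and it is a strong solution
    ([trajectory_strong_solution]). Two strong solutions approach each other: the
    derivative of their squared distance is nonpositive almost everywhere, and
    the distance is absolutely continuous ([strong_solution_contraction]). So
    every strong solution is the trajectory from its initial state.

    Along a trajectory [x] the output [y] is continuous from the right and bounded,
    and the energy [rnorm x ^+ 2] decreases at least at the rate [2 p], where
    [p = Re <phi (- y), - y>]. As [y] is bounded, coercivity and the Lipschitz bound
    at [0] yield [rnorm y ^+ 2 <= K p] and [rnorm (phi (- y)) ^+ 2 <= K p]. Integration
    gives the statement on [L2] and [Linfty] ([output_L2_Linfty]).

    For stability the trajectory is compared with the linear flow [z] of [A^K],
    started at time [s] in its domain, which is dense ([negative_feedback_dense]).
    By passivity [rnorm (x - z) ^+ 2] grows at most at the rate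
    [rnorm (y + phi (- y)) ^+ 2 / 2 <= 2 K p], so that
    [rnorm (x - z) ^+ 2 + K rnorm x ^+ 2] decreases ([linear_comparison]). The
    energy of [x] has a limit; if [s] is so late that little energy remains to be
    lost, and [z s] is close to [x s], then [x - z] stays small, while [z] tends to
    [0] ([trajectory_stable]).

    Generalised solutions inherit everything from strong solutions by
    contraction, which makes pointwise convergence uniform over all times; in the
    same way trajectories from a dense set of initial states converge to
    generalised solutions from all initial states
    ([generalised_solution_exists]). *)

(** * Norms, real inner products and convergence *)

Section RealNorm.
Context {R : realType} {V : normedModType R[i]}.
Implicit Types (x y z : V) (r : R).

Lemma rnormE x : `|x| = (rnorm x)%:C.
Proof.
by rewrite /rnorm; case: `|x| (normr_ge0 x) => a b; rewrite lecE /= => /andP[/eqP-> _].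
Qed.

Lemma rnorm_ge0 x : 0 <= rnorm x.
Proof. by have := normr_ge0 x; rewrite rnormE lecR. Qed.

Lemma rnorm_eq0 x : rnorm x = 0 -> x = 0.
Proof. by move=> x0; apply/eqP; rewrite -normr_eq0 rnormE x0. Qed.

Lemma rnorm0 : rnorm (0 : V) = 0.
Proof. by rewrite /rnorm normr0. Qed.

Lemma rnormN x : rnorm (- x) = rnorm x.
Proof. by rewrite /rnorm normrN. Qed.

Lemma rnormB x y : rnorm (x - y) = rnorm (y - x).
Proof. by rewrite -rnormN opprB. Qed.

Lemma rnormD_le x y : rnorm (x + y) <= rnorm x + rnorm y.
Proof. by have := ler_normD x y; rewrite !rnormE -rmorphD lecR. Qed.

Lemma rnormB_le x y : rnorm (x - y) <= rnorm x + rnorm y.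
Proof. by rewrite (le_trans (rnormD_le _ _)) // rnormN. Qed.

Lemma rnorm_tri z x y : rnorm (x - y) <= rnorm (x - z) + rnorm (z - y).
Proof. by rewrite -[x - y](subrKA z); exact: rnormD_le. Qed.

Lemma rnorm_dist x y : `|rnorm x - rnorm y| <= rnorm (x - y).
Proof.
rewrite ler_norml; apply/andP; split.
  by rewrite lerNl opprB lerBlDr rnormB -{1}[y](subrK x) rnormD_le.
by rewrite lerBlDr -{1}[x](subrK y) rnormD_le.
Qed.

Lemma rnormZ (a : R[i]) x : rnorm (a *: x) = rnorm (a : R[i]^o) * rnorm x.
Proof. by rewrite {1}/rnorm normrZ !rnormE -rmorphM. Qed.

Lemma rnorm_real r : rnorm (r%:C : R[i]^o) = `|r|.
Proof. by rewrite /rnorm normc_def /= expr0n addr0 sqrtr_sqr. Qed.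

Lemma rnormZr r x : rnorm (r%:C *: x) = `|r| * rnorm x.
Proof. by rewrite rnormZ rnorm_real. Qed.

Lemma near_rnormP (T : Type) (F : set_system T) {FF : Filter F} (f : T -> V)
    (l : V) :
  f @ F --> l <-> forall e : R, 0 < e -> \forall x \near F, rnorm (f x - l) < e.
Proof.
split.
  move=> /cvgrPdist_lt H e e0.
  have e0' : 0 < e%:C by rewrite ltcR.
  by have := H _ e0'; apply: filterS => x; rewrite distrC rnormE ltcR.
move=> H; apply/cvgrPdist_lt => e e0.
have eE : e = (complex.Re e)%:C.
  by rewrite RRe_real // gtr0_real.
have : 0 < complex.Re e by rewrite -ltcR -eE.
by move=> /H; apply: filterS => x; rewrite distrC rnormE {2}eE ltcR.
Qed.

Lemma cvg_rnormP (T : Type) (F : set_system T) {FF : Filter F} (f : T -> V)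
    (l : V) :
  f @ F --> l <-> rnorm (f x - l) @[x --> F] --> (0 : R).
Proof.
rewrite near_rnormP; split.
  move=> H; apply/cvgrPdist_lt => e /H; apply: filterS => x.
  by rewrite sub0r normrN ger0_norm // rnorm_ge0.
move=> /cvgrPdist_lt H e /H; apply: filterS => x.
by rewrite sub0r normrN ger0_norm // rnorm_ge0.
Qed.

Lemma cvg_rnorm (T : Type) (F : set_system T) {FF : Filter F} (f : T -> V)
    (l : V) : f @ F --> l -> rnorm (f x) @[x --> F] --> rnorm l.
Proof.
move=> /near_rnormP H; apply/cvgrPdist_lt => e /H; apply: filterS => x.
by move=> fe; rewrite (le_lt_trans (rnorm_dist _ _)) // rnormB.
Qed.

Lemma rnorm_cvg_unique (T : Type) (F : set_system T) {FF : ProperFilter F}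
    (f : T -> V) (l l' : V) : f @ F --> l -> f @ F --> l' -> l = l'.
Proof. by move=> fl fl'; apply: (cvg_unique (@norm_hausdorff _ V) fl fl'). Qed.

Lemma nbhs_rnormP (x : V) (A : set V) :
  nbhs x A <-> exists2 e : R, 0 < e & forall y, rnorm (y - x) < e -> A y.
Proof.
split.
  move=> /nbhs_normP[e e0 H].
  have eE : e = (complex.Re e)%:C by rewrite RRe_real // gtr0_real.
  exists (complex.Re e); first by rewrite -ltcR -eE.
  by move=> y ye; apply: H; rewrite /= distrC rnormE eE ltcR.
move=> [e e0 H]; apply/nbhs_normP; exists e%:C => /=; first by rewrite ltcR.
by move=> y /=; rewrite distrC rnormE ltcR; exact: H.
Qed.

End RealNorm.

Lemma cauchy_rnorm_cvg (R : realType) (V : completeNormedModType R[i])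
    (u : nat -> V) :
  (forall e : R, 0 < e -> exists N, forall m n, (N <= m)%N -> (N <= n)%N ->
     rnorm (u m - u n) <= e) -> cvgn u.
Proof.
move=> H; apply/cauchy_cvgP/cauchy_exP => e e0.
have eE : e = (complex.Re e)%:C by rewrite RRe_real // gtr0_real.
have re0 : 0 < complex.Re e by rewrite -ltcR -eE.
have e0' : 0 < complex.Re e / 2 by rewrite divr_gt0.
have [N HN] := H _ e0'.
exists (u N); exists N => // n /= Nn; rewrite -ball_normE /= rnormE eE ltcR.
by rewrite (le_lt_trans (HN _ _ _ Nn)) // ltr_pdivrMr // ltr_pMr // ltr1n.
Qed.

(** The error estimate comes from summing the geometric tail; it is what turns
    successive approximations into quantitative existence results. *)
Lemma geometric_cvg (R : realType) (V : completeNormedModType R[i])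
    (s : nat -> V) (C q : R) : 0 <= q -> q < 1 ->
  (forall n, rnorm (s n.+1 - s n) <= C * q ^+ n) ->
  exists2 l, s n @[n --> \oo] --> l &
    forall n, rnorm (l - s n) <= C / (1 - q) * q ^+ n.
Proof.
move=> q0 q1 Hs.
have q1' : 0 < 1 - q by rewrite subr_gt0.
have C0 : 0 <= C.
  by have := Hs 0%N; rewrite expr0 mulr1; apply: le_trans; exact: rnorm_ge0.
pose D := C / (1 - q).
have CD : C = D * (1 - q) by rewrite /D divfK // gt_eqF.
have D0 : 0 <= D by rewrite divr_ge0 // ltW.
have s_dist n k : rnorm (s (n + k)%N - s n) <= D * (q ^+ n - q ^+ (n + k)).
  elim: k => [|k IH]; first by rewrite addn0 !subrr rnorm0 mulr0.
  have := rnorm_tri (s (n + k)%N) (s (n + k.+1)%N) (s n).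
  have := Hs (n + k)%N; rewrite addnS (exprS q (n + k)) CD; move: IH; lra.
have s_le n m : (n <= m)%N -> rnorm (s m - s n) <= D * q ^+ n.
  move=> /subnKC <-; rewrite (le_trans (s_dist _ _)) // ler_wpM2l //.
  by rewrite gerBl exprn_ge0.
have q_cvg : D * q ^+ n @[n --> \oo] --> D * 0.
  by apply: cvgMr; apply: cvg_expr; rewrite ger0_norm.
rewrite mulr0 in q_cvg.
have /cvg_ex[l sl] : cvgn s.
  apply: cauchy_rnorm_cvg => e e0.
  have e20 : 0 < e / 2 by rewrite divr_gt0.
  have /cvgrPdist_lt/(_ _ e20)[N _ HN] := q_cvg.
  exists N => m n Nm Nn.
  have := HN N (leqnn N); rewrite sub0r normrN (ger0_norm (mulr_ge0 D0 (exprn_ge0 _ q0))).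
  have := s_le _ _ Nm; have := s_le _ _ Nn.
  by have := rnorm_tri (s N) (s m) (s n); rewrite (rnormB (s N)); lra.
exists l => // n.
have h : rnorm (s m - s n) @[m --> \oo] --> rnorm (l - s n).
  by apply: cvg_rnorm; apply: cvgB => //; exact: cvg_cst.
by apply: (ler_cvg_to h (cvg_cst _)); exists n => // m /=; exact: s_le.
Qed.

Lemma cvg_half_expn (R : realType) : (2^-1 : R) ^+ n @[n --> \oo] --> (0 : R).
Proof. by apply: cvg_expr; rewrite ger0_norm // invf_lt1 // ltr1n. Qed.

Section RealInnerProduct.
Context {R : realType} {H : hilbertType R}.
Implicit Types (x y z : H) (r : R).

(** The real part of the inner product makes [H] a real Hilbert space, which is
    all that monotonicity and energy arguments see. *)
Definition ip x y : R := complex.Re (hdot x y).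

Lemma ipDl x y z : ip (x + y) z = ip x z + ip y z.
Proof. by rewrite /ip linearDl raddfD. Qed.

Lemma ipNl x z : ip (- x) z = - ip x z.
Proof. by rewrite /ip linearNl raddfN. Qed.

Lemma ipC x y : ip x y = ip y x.
Proof.
rewrite /ip hermC expr0 mul1r -[LHS]/(complex.Re (conjc (hdot y x))).
by case: (hdot y x).
Qed.

Lemma ipZl r x z : ip (r%:C *: x) z = r * ip x z.
Proof.
rewrite /ip linearZl_LR /=; case: (hdot x z) => a b /=.
by rewrite mul0r subr0.
Qed.

Lemma ip0l z : ip 0 z = 0.
Proof. by rewrite /ip linear0l. Qed.

Lemma ipDr x y z : ip z (x + y) = ip z x + ip z y.
Proof. by rewrite ipC ipDl !(ipC z). Qed.

Lemma ipNr x z : ip z (- x) = - ip z x.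
Proof. by rewrite ipC ipNl (ipC z). Qed.

Lemma ipZr r x z : ip z (r%:C *: x) = r * ip z x.
Proof. by rewrite ipC ipZl (ipC z). Qed.

Lemma ip0r z : ip z 0 = 0.
Proof. by rewrite ipC ip0l. Qed.

Definition ipE := (ipDl, ipNl, ipZl, ipDr, ipNr, ipZr, ip0l, ip0r).

Lemma ipxx x : ip x x = rnorm x ^+ 2.
Proof. by rewrite /ip hdot_norm rnormE -rmorphXn. Qed.

Lemma sqr_rnormBZ r x y : rnorm (x - r%:C *: y) ^+ 2 =
  rnorm x ^+ 2 - 2 * r * ip y x + r ^+ 2 * rnorm y ^+ 2.
Proof. by rewrite -!ipxx !ipE (ipC x y); ring. Qed.

Lemma sqr_rnormD x y :
  rnorm (x + y) ^+ 2 = rnorm x ^+ 2 + 2 * ip x y + rnorm y ^+ 2.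
Proof. by rewrite -!ipxx !ipE (ipC y x); ring. Qed.

Lemma sqr_rnormB x y :
  rnorm (x - y) ^+ 2 = rnorm x ^+ 2 - 2 * ip x y + rnorm y ^+ 2.
Proof. by rewrite -!ipxx !ipE (ipC y x); ring. Qed.

(** Identities between real linear combinations reduce to identities between
    real numbers. *)
Lemma ip_ext x y : (forall e, ip x e = ip y e) -> x = y.
Proof.
move=> xy; apply/eqP; rewrite -subr_eq0; apply/eqP/rnorm_eq0/eqP.
by rewrite -sqrf_eq0 -ipxx ipDl ipNl xy subrr.
Qed.

Lemma ip_le x y : ip x y <= rnorm x * rnorm y.
Proof.
have x0 := rnorm_ge0 x; have y0 := rnorm_ge0 y.
have [y_0|y_n0] := eqVneq (rnorm y) 0.
  by rewrite (rnorm_eq0 y_0) ip0r rnorm0 mulr0.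
have [xy0|xy0] := leP (ip x y) 0; first by rewrite (le_trans xy0) // mulr_ge0.
have := ipxx ((rnorm y ^+ 2)%:C *: x - (ip x y)%:C *: y).
rewrite !ipE (ipC y x) !ipxx => h.
have : 0 <= rnorm y ^+ 2 * ((rnorm x * rnorm y) ^+ 2 - ip x y ^+ 2).
  have := sqr_ge0 (rnorm ((rnorm y ^+ 2)%:C *: x - (ip x y)%:C *: y)).
  by rewrite -h => h1; nra.
rewrite pmulr_rge0; last by rewrite exprn_gt0 // lt_def y_n0.
by rewrite subr_ge0 ler_sqr // nnegrE ?mulr_ge0 // ltW.
Qed.

Lemma ip_norm_le x y : `|ip x y| <= rnorm x * rnorm y.
Proof.
by rewrite ler_norml ip_le lerNl -ipNl (le_trans (ip_le _ _)) // rnormN.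
Qed.

Lemma cvg_ip (T : Type) (F : set_system T) {FF : Filter F} (f g : T -> H) x y :
  f @ F --> x -> g @ F --> y -> ip (f t) (g t) @[t --> F] --> ip x y.
Proof.
move=> fx gy.
have /cvg_rnormP fx0 := fx; have /cvg_rnormP gy0 := gy.
have g1 : rnorm (g t) @[t --> F] --> rnorm y by exact: cvg_rnorm.
apply/cvgrPdist_lt => e e0.
have : rnorm (f t - x) * rnorm (g t) + rnorm x * rnorm (g t - y) @[t --> F]
    --> (0 * rnorm y + rnorm x * 0 : R).
  by apply: cvgD; [apply: cvgM | apply: cvgMr].
rewrite mul0r mulr0 addr0 => /cvgrPdist_lt/(_ _ e0); apply: filterS => t.
rewrite sub0r normrN ger0_norm; last by rewrite addr_ge0 // mulr_ge0 // rnorm_ge0.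
apply: le_lt_trans.
have -> : ip x y - ip (f t) (g t) = - (ip (f t - x) (g t) + ip x (g t - y)).
  by rewrite !ipE; ring.
by rewrite normrN (le_trans (ler_normD _ _)) // lerD // ip_norm_le.
Qed.

End RealInnerProduct.

(** * Boundedness of linear operators *)

Section LinearMaps.
Context {R : realType} {V W : lmodType R[i]} (T : V -> W) (Tlin : linear T).

Lemma linB x y : T (x - y) = T x - T y.
Proof. by rewrite addrC -scaleN1r Tlin scaleN1r addrC. Qed.

Lemma lin0 : T 0 = 0.
Proof. by rewrite -(subrr 0) linB subrr. Qed.

Lemma linZ a x : T (a *: x) = a *: T x.
Proof. by rewrite -[a *: x]addr0 Tlin lin0 addr0. Qed.

End LinearMaps.

Lemma linear_ball_le (R : realType) (V W : normedModType R[i]) (T : V -> W)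
    (r C : R) : linear T -> 0 < r -> (forall y, rnorm y < r -> rnorm (T y) <= C) ->
  forall x, rnorm (T x) <= C * (2 / r) * rnorm x.
Proof.
move=> Tlin r0 H x; have [x0|x_neq0] := eqVneq (rnorm x) 0.
  by rewrite (rnorm_eq0 x0) (lin0 Tlin) !rnorm0 mulr0.
have x0 : 0 < rnorm x by rewrite lt_def x_neq0 rnorm_ge0.
pose t := r / (2 * rnorm x).
have t0 : 0 < t by rewrite divr_gt0 // mulr_gt0.
have := H (t%:C *: x); rewrite (linZ Tlin) !rnormZr gtr0_norm //.
have -> : t * rnorm x = r / 2 by rewrite /t; field; rewrite ?x_neq0.
have -> : r / 2 < r by rewrite ltr_pdivrMr // ltr_pMr // ltr1n.
move=> /(_ isT); rewrite -ler_pdivlMl // => /le_trans; apply.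
by rewrite le_eqVlt; apply/orP; left; apply/eqP; rewrite /t; field; rewrite ?x_neq0 ?gt_eqF.
Qed.

Lemma bounded_operator_le (R : realType) (V W : normedModType R[i])
    (T : V -> W) : bounded_operator T ->
  exists2 K : R, 0 < K & forall x, rnorm (T x) <= K * rnorm x.
Proof.
case=> Tlin Tcont.
have /near_rnormP/(_ 1 ltr01) := Tcont 0.
rewrite (lin0 Tlin) => /nbhs_rnormP[e e0 He].
exists (1 * (2 / e)); first by rewrite mul1r divr_gt0.
apply: (linear_ball_le Tlin e0) => y ye; rewrite ltW //.
by have := He y; rewrite !subr0; apply.
Qed.

Lemma bounded_operatorI (R : realType) (V W : normedModType R[i])
    (T : V -> W) (K : R) : linear T ->
  (forall x, rnorm (T x) <= K * rnorm x) -> bounded_operator T.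
Proof.
move=> Tlin TK; split => // x; apply/cvg_rnormP.
have : K * rnorm (y - x) @[y --> x] --> K * 0.
  by apply: cvgMr; apply/cvg_rnormP; exact: cvg_id.
rewrite mulr0; apply: squeeze_cvgr; last exact: cvg_cst.
by apply: nearW => y; rewrite rnorm_ge0 -(linB Tlin) TK.
Qed.

(** Baire's theorem. If no [F n] were dense in a ball, every ball would contain a
    smaller closed ball that misses [F n]; the limit of the centres of such a
    nested sequence would lie in no [F n]. *)
Lemma baire_cover (R : realType) (V : completeNormedModType R[i])
    (F : nat -> set V) : (forall x, exists n, F n x) ->
  exists n (x : V) (r : R), 0 < r /\ forall y, rnorm (y - x) < r ->
    forall e : R, 0 < e -> exists2 z, F n z & rnorm (z - y) < e.
Proof.
move=> cover; apply: contrapT => noball.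
have step (p : nat * (V * R)) : exists q : V * R, 0 < p.2.2 ->
    [/\ 0 < q.2, q.2 <= p.2.2 / 2, rnorm (q.1 - p.2.1) + q.2 <= p.2.2 &
        forall z, rnorm (z - q.1) <= q.2 -> ~ F p.1 z].
  case: p => n [x r] /=; have [r0|] := ltP 0 r; last by exists (x, r).
  have [y yx [e e0 He]] : exists2 y, rnorm (y - x) < r &
      exists2 e : R, 0 < e & forall z, F n z -> e <= rnorm (z - y).
    apply: contrapT => no; apply: noball; exists n, x, r; split => // y yx e e0.
    apply: contrapT => noz; apply: no; exists y => //; exists e => // z Fz.
    by rewrite leNgt; apply/negP => ze; apply: noz; exists z.
  pose s := Num.min (e / 2) (Num.min (r - rnorm (y - x)) (r / 2)).
  exists (y, s) => _ /=; split.
  - by rewrite !lt_min subr_gt0 yx !divr_gt0.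
  - by rewrite !ge_min lexx !orbT.
  - by rewrite -lerBrDl /s !ge_min lexx !orbT.
  - move=> z zy /He; apply/negP; rewrite -ltNge (le_lt_trans zy) // /s !gt_min.
    by rewrite ltr_pdivrMr // ltr_pMr // ltr1n.
have [f Hf] := choice step.
pose a := fix a n := if n is m.+1 then f (m, a m) else (0, 1).
have a_gt0 n : 0 < (a n).2.
  by elim: n => [|n IH] //=; have [] := Hf (n, a n) IH.
have a_le n : (a n).2 <= 2^-1 ^+ n.
  elim: n => [|n IH] //=; have [_ h _ _] := Hf (n, a n) (a_gt0 n).
  by rewrite (le_trans h) // exprSr ler_pM2r.
have a_near m n : (m <= n)%N -> rnorm ((a n).1 - (a m).1) + (a n).2 <= (a m).2.
  elim: n => [|n IH]; first by rewrite leqn0 => /eqP->; rewrite subrr rnorm0 add0r.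
  rewrite leq_eqVlt => /orP[/eqP->|/IH]; first by rewrite subrr rnorm0 add0r.
  have [_ _ h _] := Hf (n, a n) (a_gt0 n); move: h => /=.
  have := rnorm_tri (a n).1 (a n.+1).1 (a m).1 => /=; lra.
have /cvg_ex[l al] : cvgn (fun n => (a n).1).
  apply: cauchy_rnorm_cvg => e e0.
  have e20 : 0 < e / 2 by rewrite divr_gt0.
  have /cvgrPdist_lt/(_ _ e20)[N _ HN] := @cvg_half_expn R.
  exists N => m n Nm Nn.
  have := HN N (leqnn N); rewrite sub0r normrN ger0_norm ?exprn_ge0 // => hN.
  have := a_near _ _ Nm; have := a_near _ _ Nn.
  have := a_le N; have := a_gt0 m; have := a_gt0 n.
  have := rnorm_tri (a N).1 (a m).1 (a n).1; rewrite (rnormB (a N).1); lra.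
have al_near m : rnorm (l - (a m).1) <= (a m).2.
  have al1 : rnorm ((a n).1 - (a m).1) @[n --> \oo] --> rnorm (l - (a m).1).
    by apply: cvg_rnorm; apply: cvgB => //; exact: cvg_cst.
  apply: (ler_cvg_to al1 (cvg_cst _)); exists m => // n /= mn.
  by have := a_near _ _ mn; have := a_gt0 n; lra.
have [n Fnl] := cover l.
by have [_ _ _ /(_ l (al_near n.+1))] := Hf (n, a n) (a_gt0 n).
Qed.

Section ClosedGraph.
Context {R : realType} {V : completeNormedModType R[i]}.

(** Linearity recentres the ball given by Baire's theorem at the origin. *)
Lemma baire_linear (W : normedModType R[i]) (T : V -> W) : linear T ->
  exists r M : R, [/\ 0 < r, 0 <= M & forall y, rnorm y < r ->
    forall e : R, 0 < e -> exists2 z, rnorm (T z) <= M & rnorm (z - y) < e].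
Proof.
move=> Tlin.
have [|n [x [r [r0 H]]]] := @baire_cover R V (fun n => [set x | rnorm (T x) <= n%:R]).
  move=> x; exists (Num.truncn (rnorm (T x))).+1 => /=.
  by rewrite ltW // truncnS_gt.
exists r, (n%:R + n%:R); split=> // y yr e e0.
have e20 : 0 < e / 2 by rewrite divr_gt0.
have [|z1 /= Tz1 z1e] := H (x + y) _ _ e20; first by rewrite addrAC subrr add0r.
have [|z2 /= Tz2 z2e] := H x _ _ e20; first by rewrite subrr rnorm0.
exists (z1 - z2); first by rewrite (linB Tlin) (le_trans (rnormB_le _ _)) // lerD.
have -> : z1 - z2 - y = (z1 - (x + y)) - (z2 - x).
  by rewrite opprD opprB (addrA z1) [RHS]addrAC subrKA.
by rewrite (le_lt_trans (rnormB_le _ _)) // [ltRHS]splitr ltrD.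
Qed.

(** The closed graph theorem. By Baire's theorem a vector of a small ball is
    the sum of a series whose terms and whose images both decay geometrically;
    as the graph is closed, the sum of the images is the image of the vector. *)
Lemma closed_graph_bounded (W : completeNormedModType R[i]) (T : V -> W) :
  linear T ->
  (forall (u : nat -> V) x y, u n @[n --> \oo] --> x ->
     T (u n) @[n --> \oo] --> y -> T x = y) ->
  exists2 K : R, 0 < K & forall x, rnorm (T x) <= K * rnorm x.
Proof.
move=> Tlin Tclosed.
have [r [M [r0 M0 H]]] := baire_linear Tlin.
pose q n : R := 2^-1 ^+ n.
have q0 n : 0 < q n by rewrite exprn_gt0.
have qS n : q n.+1 = q n / 2 by rewrite /q exprSr.
(* by homogeneity the same approximation holds at every scale *)
have Hq n y : exists z, rnorm y < r * q n ->
    rnorm (T z) <= M * q n /\ rnorm (z - y) < r * q n.+1.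
  have [yr|] := ltP (rnorm y) (r * q n); last by exists 0.
  have [||z Tz zy] := H ((q n)^-1%:C *: y) _ (r / 2); rewrite ?divr_gt0 //.
    by rewrite rnormZr gtr0_norm ?invr_gt0 // mulrC ltr_pdivrMr.
  exists ((q n)%:C *: z) => _; rewrite (linZ Tlin) rnormZr gtr0_norm //.
  rewrite mulrC ler_pM2r //; split => //.
  have -> : (q n)%:C *: z - y = (q n)%:C *: (z - (q n)^-1%:C *: y).
    by rewrite scalerBr scalerA -rmorphM /= divff ?gt_eqF // scale1r.
  by rewrite rnormZr gtr0_norm // qS mulrCA ltr_pM2l.
have [f Hf] := choice (fun p : nat * V => Hq p.1 p.2).
have bound y : rnorm y < r -> rnorm (T y) <= M * 2.
  move=> yr.
  pose s := fix s n := if n is m.+1 then s m + f (m, y - s m) else 0.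
  have s_near n : rnorm (y - s n) < r * q n.
    elim: n => [|n IH]; first by rewrite /= subr0 /q expr0 mulr1.
    have [_ h] := Hf (n, y - s n) IH.
    by rewrite -[s n.+1]/(s n + f (n, y - s n)) opprD addrA rnormB; exact: h.
  have Ts n : rnorm (T (s n.+1) - T (s n)) <= M * q n.
    have [h _] := Hf (n, y - s n) (s_near n).
    by rewrite -(linB Tlin) /= addrAC subrr add0r.
  have s_cvg : s n @[n --> \oo] --> y.
    apply/near_rnormP => e e0.
    have er0 : 0 < e / r by rewrite divr_gt0.
    have /cvgrPdist_lt/(_ _ er0) := @cvg_half_expn R; apply: filterS => n.
    rewrite sub0r normrN gtr0_norm // ltr_pdivlMr // mulrC => h.
    by rewrite rnormB (lt_trans (s_near n)).
  have half_ge0 : 0 <= (2^-1 : R) by rewrite invr_ge0.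
  have half_lt1 : (2^-1 : R) < 1 by rewrite invf_lt1 // ltr1n.
  have [w Tw] := geometric_cvg half_ge0 half_lt1 Ts.
  rewrite (Tclosed _ _ _ s_cvg Tw) => /(_ 0%N).
  rewrite /= (lin0 Tlin) subr0 expr0 mulr1.
  by have -> : M / (1 - 2^-1) = M * 2 by field.
exists (M * 2 * (2 / r) + 1).
  by rewrite ltr_wpDl // !mulr_ge0 // invr_ge0 ltW.
move=> x; rewrite mulrDl mul1r ler_wpDr ?rnorm_ge0 //.
exact: linear_ball_le.
Qed.

(** The uniform boundedness principle. By Baire's theorem the vectors at which
    all the operators are bounded by some [m] are dense in a ball, hence fill it
    by continuity. *)
Lemma uniform_boundedness (W : normedModType R[i]) (T : nat -> V -> W) :
  (forall n, bounded_operator (T n)) ->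
  (forall x, exists C : R, forall n, rnorm (T n x) <= C) ->
  exists2 K : R, 0 < K & forall n x, rnorm (T n x) <= K * rnorm x.
Proof.
move=> Tb Tp.
have [|m [x0 [r [r0 H]]]] :=
    @baire_cover R V (fun m => [set x | forall n, rnorm (T n x) <= m%:R]).
  move=> x; have [C HC] := Tp x; exists (Num.truncn C).+1 => n /=.
  by rewrite (le_trans (HC n)) // ltW // truncnS_gt.
have Tlin n := (Tb n).1.
have inball y n : rnorm (y - x0) < r -> rnorm (T n y) <= m%:R.
  move=> yr; apply/ler_addgt0Pr => e e0.
  have [K K0 HK] := bounded_operator_le (Tb n).
  have [|z /= Tz zy] := H y yr (e / K); first by rewrite divr_gt0.
  rewrite -[T n y](subrK (T n z)) addrC (le_trans (rnormD_le _ _)) // lerD //.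
  rewrite -(linB (Tlin n)) (le_trans (HK _)) // rnormB mulrC -ler_pdivlMr //.
  exact: ltW.
have bound y n : rnorm y < r -> rnorm (T n y) <= m%:R + m%:R.
  move=> yr; rewrite -[y](addrK x0) (linB (Tlin n)) (le_trans (rnormB_le _ _)) //.
  by rewrite lerD // inball // ?addrK // subrr rnorm0.
exists ((m%:R + m%:R) * (2 / r) + 1).
  by rewrite ltr_wpDl // !mulr_ge0 // ?addr_ge0 // invr_ge0 ltW.
move=> n x; rewrite mulrDl mul1r ler_wpDr ?rnorm_ge0 //.
by apply: linear_ball_le => // y; exact: bound.
Qed.

End ClosedGraph.

(** * Continuity arguments on real intervals *)

Section RealInduction.
Context {R : realType}.

Lemma near_right0P (P : R -> Prop) :
  (\forall h \near 0^'+, P h) <->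
  exists2 d : R, 0 < d & forall h, 0 < h < d -> P h.
Proof.
split.
  move=> /nbhs_normP[d /= d0 H]; exists d => // h /andP[h0 hd].
  by apply: H => //=; rewrite sub0r normrN gtr0_norm.
move=> [d d0 H]; apply/nbhs_normP; exists d => //= h.
by rewrite /= sub0r normrN => hd h0; apply: H; rewrite h0 -(gtr0_norm h0).
Qed.

(** Otherwise the supremum of the points of [[a, b]] where [P] holds would be
    one of them by the first closure property, and could then be exceeded by
    the second one. *)
Lemma interval_induction (P : R -> Prop) (a b : R) : a <= b -> P a ->
  (forall c, a < c -> c <= b ->
     (forall e, 0 < e -> exists s, [/\ a <= s, s < c, c - e < s & P s]) -> P c) ->
  (forall c, a <= c -> c < b -> P c -> exists t, [/\ c < t, t <= b & P t]) ->
  P b.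
Proof.
move=> ab Pa Pleft Pright.
pose E := [set s | [/\ a <= s, s <= b & P s]].
have Ea : E a by [].
have supE : has_sup E by split; [exists a | exists b => s []].
have Eub s : E s -> s <= sup E by exact: sup_upper_bound.
have supa : a <= sup E by exact: Eub.
have supb : sup E <= b by apply: ge_sup; [exists a | move=> s []].
have Psup : P (sup E).
  have [<-//|asup] := eqVneq a (sup E).
  apply: contrapT => noP; apply: (noP); apply: Pleft => //.
    by rewrite lt_neqAle asup.
  move=> e e0; have [s Es ses] := sup_adherent e0 supE.
  have [as_ _ Ps] := Es; exists s; split => //.
  rewrite lt_neqAle Eub // andbT; apply/eqP => s_sup.
  by apply: noP; rewrite -s_sup.
have [->//|supnb] := eqVneq b (sup E).
have [|t [supt tb Pt]] := Pright _ supa _ Psup.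
  by rewrite lt_neqAle eq_sym supnb.
have : E t by split => //; rewrite (le_trans supa) // ltW.
by move=> /Eub; rewrite leNgt supt.
Qed.

(** For each [e] the bound [f s <= f a + e (s - a)] propagates along the interval
    by induction: the Dini condition carries it beyond [s], and the condition to
    the left carries it to limits, where [f] may jump down. *)
Lemma dini_nonincreasing (f : R -> R) (a b : R) : a <= b ->
  (forall t, a < t -> t <= b -> forall e, 0 < e ->
     \forall h \near 0^'+, f t <= f (t - h) + e) ->
  (forall t, a <= t -> t < b -> forall e, 0 < e ->
     \forall h \near 0^'+, f (t + h) <= f t + e * h) ->
  f b <= f a.
Proof.
move=> ab fleft fright; apply/ler_addgt0Pr => e0 e00.
pose e := e0 / (b - a + 1).
have ba0 : 0 < b - a + 1 by rewrite ltr_wpDl // subr_ge0.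
have e_gt0 : 0 < e by rewrite divr_gt0.
suff : forall s, a <= s -> s <= b -> f s <= f a + e * (s - a).
  move=> /(_ b ab (lexx _)) /le_trans; apply; rewrite lerD2l.
  by rewrite /e mulrAC ler_pdivrMr // ler_pM2l // lerDl.
suff : forall s, a <= s -> s <= b -> f s <= f a + e * (s - a) by [].
apply: (@interval_induction
  (fun t => forall s, a <= s -> s <= t -> f s <= f a + e * (s - a)) a b ab).
- move=> s as_ sa; have -> : s = a by apply/eqP; rewrite eq_le as_ sa.
  by rewrite subrr mulr0 addr0.
- move=> c ac cb Hc s as_; rewrite le_eqVlt => /orP[/eqP->|sc]; last first.
    have [|t [_ tc ts Pt]] := Hc (c - s); first by rewrite subr_gt0.
    by apply: Pt => //; rewrite ltW //; move: ts; rewrite opprB addrC subrK.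
  apply/ler_addgt0Pr => r r0.
  have ca0 : 0 < c - a by rewrite subr_gt0.
  near (0 : R)^'+ => h.
  have h0 : 0 < h by [].
  have hca : h < c - a by [].
  have fc : f c <= f (c - h) + r by near: h; exact: fleft.
  have [t [at_ tc cht Pt]] := Hc _ h0.
  have : f (c - h) <= f a + e * (c - h - a).
    by apply: Pt; rewrite ?(ltW cht) //; lra.
  by move: fc; nra.
- move=> c ac cb Pc.
  have bc0 : 0 < b - c by rewrite subr_gt0.
  have /near_right0P[d d0 Hd] := fright c ac cb e e_gt0.
  exists (c + Num.min (d / 2) (b - c)).
  have m0 : 0 < Num.min (d / 2) (b - c) by rewrite lt_min divr_gt0.
  split; first by rewrite ltrDl.
    by rewrite -lerBrDl ge_min lexx orbT.
  move=> s as_ sc; have [|cs] := leP s c; first exact: Pc.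
  have -> : s = c + (s - c) by rewrite addrC subrK.
  have /Hd/le_trans : 0 < s - c < d.
    rewrite subr_gt0 cs /= (@le_lt_trans _ _ (d / 2)) //.
      by rewrite lerBlDl (le_trans sc) // lerD2l ge_min lexx.
    by rewrite ltr_pdivrMr // ltr_pMr // ltr1n.
  by apply; have := Pc c ac (lexx _); lra.
Unshelve. all: by end_near. Qed.

End RealInduction.

(** * Strongly monotone equations *)

(** Banach's fixed point theorem for a map that contracts a ball only, as
    perturbations by locally Lipschitz maps do; the last hypothesis keeps the
    iterates in the ball. *)
Lemma banach_ball (R : realType) (V : completeNormedModType R[i]) (T : V -> V)
    (x0 : V) (rho q : R) : 0 <= rho -> 0 <= q -> q < 1 ->
  (forall x y, rnorm (x - x0) <= rho -> rnorm (y - x0) <= rho ->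
     rnorm (T x - T y) <= q * rnorm (x - y)) ->
  rnorm (T x0 - x0) <= (1 - q) * rho ->
  exists2 x, rnorm (x - x0) <= rho & T x = x.
Proof.
move=> rho0 q0 q1 Tq Tx0.
pose s n := iter n T x0.
have ball_step x : rnorm (x - x0) <= rho -> rnorm (T x - x0) <= rho.
  move=> xr; have := rnorm_tri (T x0) (T x) x0.
  have := Tq x x0 xr; rewrite subrr rnorm0 => /(_ rho0); nra.
have s_ball n : rnorm (s n - x0) <= rho.
  by elim: n => [|n IH]; [rewrite subrr rnorm0 | exact: ball_step].
have s_step n : rnorm (s n.+1 - s n) <= q ^+ n * ((1 - q) * rho).
  elim: n => [|n IH]; first by rewrite expr0 mul1r.
  rewrite (le_trans (Tq _ _ (s_ball n.+1) (s_ball n))) // exprS -mulrA.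
  by rewrite ler_wpM2l.
have [l sl _] : exists2 l, s n @[n --> \oo] --> l & forall n,
    rnorm (l - s n) <= (1 - q) * rho / (1 - q) * q ^+ n.
  by apply: geometric_cvg => // n; rewrite mulrC.
have l_ball : rnorm (l - x0) <= rho.
  have h : rnorm (s n - x0) @[n --> \oo] --> rnorm (l - x0).
    by apply: cvg_rnorm; apply: cvgB => //; exact: cvg_cst.
  by apply: (ler_cvg_to h (cvg_cst _)); apply: nearW.
exists l => //.
have sl' : s n.+1 @[n --> \oo] --> l by rewrite (cvg_shiftS s).
apply: (rnorm_cvg_unique _ sl'); apply/cvg_rnormP.
have h : q * rnorm (s n - l) @[n --> \oo] --> q * 0.
  by apply: cvgMr; apply/cvg_rnormP.
rewrite mulr0 in h; apply: (squeeze_cvgr _ (cvg_cst 0) h); apply: nearW => n.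
by rewrite rnorm_ge0 Tq.
Qed.

Definition locally_rlipschitz (R : realType) (V W : normedModType R[i])
    (f : V -> W) := forall x : V, exists r K : R, [/\ 0 < r, 0 < K &
  forall y z, rnorm (y - x) <= r -> rnorm (z - x) <= r ->
    rnorm (f y - f z) <= K * rnorm (y - z)].

Lemma locally_lipschitz_r (R : realType) (V W : normedModType R[i])
    (f : V -> W) : locally_lipschitz f -> locally_rlipschitz f.
Proof.
move=> flip x; have [A /nbhs_rnormP[r r0 Hr]] := flip x.
move=> [M [Mreal HM]].
have [K MK] : exists K : R, M = K%:C.
  by exists (complex.Re M); rewrite RRe_real.
exists (r / 2), (`|K| + 1); split; rewrite ?divr_gt0 ?ltr_wpDl //.
have r2 : r / 2 < r by rewrite ltr_pdivrMr // ltr_pMr // ltr1n.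
move=> y z yx zx; have := HM (`|K| + 1)%:C.
rewrite MK ltcR ltr_pwDr ?ler_norm // => /(_ isT) H.
have := H (y, z); rewrite /= !rnormE -rmorphM lecR; apply.
by split; apply: Hr; apply: le_lt_trans r2.
Qed.

Section StronglyMonotone.
Context {R : realType} {U : hilbertType R}.
Variables (F : U -> U) (m : R).
Hypothesis m0 : 0 < m.
Hypothesis Flip : locally_rlipschitz F.
Hypothesis Fmono : forall x y, m * rnorm (x - y) ^+ 2 <= ip (F x - F y) (x - y).

Lemma strongly_monotone_inj_le x y : rnorm (x - y) <= m^-1 * rnorm (F x - F y).
Proof.
rewrite mulrC ler_pdivlMr // mulrC.
have [->|xy0] := eqVneq (rnorm (x - y)) 0; first by rewrite mulr0 rnorm_ge0.
have xy : 0 < rnorm (x - y) by rewrite lt_def xy0 rnorm_ge0.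
rewrite -(ler_pM2r xy) (le_trans _ (ip_le _ _)) // (le_trans _ (Fmono _ _)) //.
by rewrite -mulrA -expr2.
Qed.

(** Close to a point of the range, [z - tau (F z - g)] is a contraction of a
    small ball. *)
Lemma strongly_monotone_open z0 : exists2 e : R, 0 < e &
  forall g, rnorm (g - F z0) <= e -> exists z, F z = g.
Proof.
have [r [K [r0 K0 HK]]] := Flip z0.
pose L := K + m.
have L0 : 0 < L by rewrite addr_gt0.
have mL : m < L by rewrite ltrDr.
pose tau := m / L ^+ 2.
have tau0 : 0 < tau by rewrite divr_gt0 // exprn_gt0.
have sq1 : 0 <= 1 - (m / L) ^+ 2.
  rewrite subr_ge0 expr_le1 ?divr_ge0 ?(ltW m0) ?(ltW L0) //.
  by rewrite ler_pdivrMr // mul1r ltW.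
pose q := Num.sqrt (1 - (m / L) ^+ 2).
have q0 : 0 <= q by exact: sqrtr_ge0.
have qq : q ^+ 2 = 1 - (m / L) ^+ 2 by rewrite sqr_sqrtr.
have q1 : q < 1.
  rewrite -(@ltr_sqr _ q 1) ?nnegrE // qq expr1n ltrBlDr ltrDl exprn_gt0 //.
  by rewrite divr_gt0.
exists ((1 - q) * r / tau).
  by rewrite !mulr_gt0 ?invr_gt0 // subr_gt0.
move=> g gz0.
have [||z _ zE] := @banach_ball R U (fun z => z - tau%:C *: (F z - g)) z0 r q
    (ltW r0) q0 q1.
- move=> x y xr yr; rewrite -(@ler_sqr _) ?nnegrE ?mulr_ge0 ?rnorm_ge0 //.
  have -> : x - tau%:C *: (F x - g) - (y - tau%:C *: (F y - g)) =
      (x - y) - tau%:C *: (F x - F y).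
    by apply: ip_ext => e; rewrite !ipE; ring.
  rewrite exprMn qq sqr_rnormBZ; set d := x - y; set f := F x - F y.
  have fK : rnorm f ^+ 2 <= L ^+ 2 * rnorm d ^+ 2.
    rewrite -exprMn ler_sqr ?nnegrE ?mulr_ge0 ?rnorm_ge0 ?(ltW L0) //.
    apply: (le_trans (HK _ _ xr yr)); rewrite ler_wpM2r ?rnorm_ge0 //.
    by rewrite lerDl ltW.
  have fm := Fmono x y; rewrite -/d -/f in fm.
  have -> : (m / L) ^+ 2 = 2 * tau * m - tau ^+ 2 * L ^+ 2.
    by rewrite /tau; field; rewrite gt_eqF.
  have t2 : 0 < tau ^+ 2 by rewrite exprn_gt0.
  have h1 : tau * (m * rnorm d ^+ 2) <= tau * ip f d by rewrite ler_pM2l.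
  have h2 : tau ^+ 2 * rnorm f ^+ 2 <= tau ^+ 2 * (L ^+ 2 * rnorm d ^+ 2).
    by rewrite ler_pM2l.
  lra.
- rewrite addrAC subrr add0r rnormN rnormZr gtr0_norm // rnormB mulrC.
  by rewrite -ler_pdivlMr.
exists z; apply/eqP; rewrite -subr_eq0; apply/eqP/rnorm_eq0.
have : rnorm (tau%:C *: (F z - g)) = 0.
  by rewrite -[_ *: _](subKr z) zE subrr rnorm0.
by rewrite rnormZr => /eqP; rewrite mulf_eq0 normr_eq0 gt_eqF //= => /eqP.
Qed.

(** The range of [F] is open, and closed because the inverse of [F] is
    Lipschitz; so it contains every segment that it meets. *)
Lemma strongly_monotone_surj g : exists z, F z = g.
Proof.
pose p (s : R) := F 0 + s%:C *: (g - F 0).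
have pB s t : p s - p t = (s - t)%:C *: (g - F 0).
  by apply: ip_ext => e; rewrite !ipE; ring.
have pD s t : rnorm (p s - p t) = `|s - t| * rnorm (g - F 0).
  by rewrite pB rnormZr.
suff [z zE] : exists z, F z = p 1.
  by exists z; rewrite zE /p scale1r addrC subrK.
pose D := rnorm (g - F 0) + 1.
have D0 : 0 < D by rewrite ltr_wpDl // rnorm_ge0.
apply: (@interval_induction R (fun s => exists z, F z = p s) 0 1) => //.
- by exists 0; rewrite /p scale0r addr0.
- move=> c c0 c1 Hc.
  have near_c n : exists z, rnorm (F z - p c) <= 2^-1 ^+ n * D.
    have [|s [_ sc cs [z zE]]] := Hc (2^-1 ^+ n); first by rewrite exprn_gt0.
    exists z; rewrite zE pD ler_pM ?rnorm_ge0 ?lerDl //.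
    by rewrite ltr0_norm ?subr_lt0 // opprB lerBlDr -lerBlDl ltW.
  have [z zE] := choice near_c.
  have Fz : F (z n) @[n --> \oo] --> p c.
    apply/cvg_rnormP.
    have h : 2^-1 ^+ n * D @[n --> \oo] --> 0 * D by apply: cvgMl; exact: cvg_half_expn.
    rewrite mul0r in h; apply: (squeeze_cvgr _ (cvg_cst 0) h); apply: nearW => n.
    by rewrite rnorm_ge0 zE.
  have /cvg_ex[l zl] : cvgn z.
    apply: cauchy_rnorm_cvg => e e0.
    have e20 : 0 < m * e / 2 by rewrite divr_gt0 // mulr_gt0.
    have /near_rnormP/(_ _ e20)[N _ HN] := Fz.
    exists N => i j /HN /= hi /HN /= hj.
    rewrite (le_trans (strongly_monotone_inj_le _ _)) // mulrC ler_pdivrMr //.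
    have := rnorm_tri (p c) (F (z i)) (F (z j)).
    by rewrite (rnormB (p c)); lra.
  exists l; apply: (rnorm_cvg_unique _ Fz).
  have [r [K [r0 K0 HK]]] := Flip l.
  apply/near_rnormP => e e0.
  have e1 : 0 < Num.min r (e / K) by rewrite lt_min r0 divr_gt0.
  have /near_rnormP/(_ _ e1) := zl; apply: filterS => n.
  rewrite lt_min => /andP[zr ze].
  rewrite (le_lt_trans (HK _ _ (ltW zr) _)) ?subrr ?rnorm0 ?(ltW r0) //.
  by rewrite mulrC -ltr_pdivlMr.
- move=> c c0 c1 [z zE].
  have [e e0 He] := strongly_monotone_open z.
  pose t := Num.min 1 (c + e / D).
  have ct : c < t by rewrite lt_min c1 ltrDl divr_gt0.
  exists t; split => //; first by rewrite ge_min lexx.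
  apply: He; rewrite zE pD gtr0_norm ?subr_gt0 //.
  have : t - c <= e / D by rewrite lerBlDl ge_min lexx orbT.
  rewrite ler_pdivlMr // => /(le_trans _); apply.
  by rewrite ler_pM2l ?subr_gt0 // lerDl.
Qed.

End StronglyMonotone.

(** * Maximal dissipative operators *)

(** The increment of [rnorm F ^+ 2] is [2 h ip q (F t) + h ^+ 2 rnorm q ^+ 2],
    where [q] is the difference quotient, which tends to [D]. *)
Lemma dini_sqr_rnorm (R : realType) (X : hilbertType R) (F : R -> X) (D : X)
    (t c e : R) : (h^-1)%:C *: (F (t + h) - F t) @[h --> 0^'+] --> D ->
  2 * ip D (F t) <= c -> 0 < e ->
  \forall h \near 0^'+, rnorm (F (t + h)) ^+ 2 <= rnorm (F t) ^+ 2 + (c + e) * h.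
Proof.
move=> FD Dc e0.
have h0 : h%:C *: ((h^-1)%:C *: (F (t + h) - F t)) @[h --> 0^'+] --> (0 : X).
  apply/cvg_rnormP.
  have H : h * rnorm ((h^-1)%:C *: (F (t + h) - F t)) @[h --> 0^'+] --> 0 * rnorm D.
    by apply: cvgM; [exact: cvg_at_right_filter cvg_id | exact: cvg_rnorm].
  rewrite mul0r in H; apply: (squeeze_cvgr _ (cvg_cst 0) H).
  by near=> h; rewrite rnorm_ge0 subr0 rnormZr gtr0_norm // lexx.
have H : 2 * ip ((h^-1)%:C *: (F (t + h) - F t)) (F t) +
    ip ((h^-1)%:C *: (F (t + h) - F t))
       (h%:C *: ((h^-1)%:C *: (F (t + h) - F t))) @[h --> 0^'+] -->
    2 * ip D (F t) + ip D 0.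
  apply: cvgD; last exact: cvg_ip.
  by apply: cvgMr; apply: cvg_ip => //; exact: cvg_cst.
rewrite ip0r addr0 in H.
have /cvgrPdist_lt/(_ _ e0) := H; apply: filterS2 (nbhs_right_gt 0) => h hgt.
move=> /ltr_distlCDr; set v := _ *: _ => hv.
have -> : F (t + h) = F t + h%:C *: v.
  by rewrite /v scalerA -rmorphM /= divff ?gt_eqF // scale1r [RHS]addrC subrK.
have {}hv := ltW hv; clearbody v; move: hv.
rewrite -(ler_pM2r hgt) sqr_rnormD -(ipxx (_ *: v)) !ipE (ipC (F t)).
have : 2 * ip D (F t) * h <= c * h by rewrite ler_pM2r.
lra.
Unshelve. all: by end_near. Qed.

Section Dissipative.
Context {R : realType} {X : hilbertType R}.
Variable G : X -> X -> Prop.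

Definition dissipative := forall x1 w1 x2 w2, G x1 w1 -> G x2 w2 ->
  ip (w1 - w2) (x1 - x2) <= 0.

(** [Y h f] is the Yosida approximation of [G] at [f]; the resolvent is
    [f + h Y h f]. *)
Definition is_yosida (Y : R -> X -> X) := forall h f, 0 < h ->
  G (f + h%:C *: Y h f) (Y h f).

Lemma yosida_exists : (forall h f, 0 < h -> exists x w, G x w /\ x - h%:C *: w = f) ->
  exists Y, is_yosida Y.
Proof.
move=> H.
have H' (p : R * X) : exists w, 0 < p.1 -> G (p.2 + p.1%:C *: w) w.
  have [h0|] := ltP 0 p.1; last by exists 0.
  by have [x [w [Gxw <-]]] := H p.1 p.2 h0; exists w => _; rewrite subrK.
have [Y HY] := choice H'.
by exists (fun h f => Y (h, f)) => h f h0; exact: (HY (h, f)).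
Qed.

Hypothesis Gdiss : dissipative.
Variables (Y : R -> X -> X).
Hypothesis HY : is_yosida Y.

Lemma yosida_le h f w : 0 < h -> G f w -> rnorm (Y h f) <= rnorm w.
Proof.
move=> h0 Gfw; have := Gdiss (HY f h0) Gfw.
rewrite [_ + _ - f]addrC addKr ipZr pmulr_rle0 // ipDl ipNl ipxx subr_le0 => H.
have [->|Y0] := eqVneq (rnorm (Y h f)) 0; first exact: rnorm_ge0.
rewrite -(@ler_pM2r _ (rnorm (Y h f))); last by rewrite lt_def Y0 rnorm_ge0.
by rewrite -expr2 (le_trans H) // ip_le.
Qed.

(** The norm of the Yosida approximation is monotone in the parameter, and the
    gain in norm controls the distance. *)
Lemma yosida_dist h k f : 0 < k -> k <= h ->
  rnorm (Y h f - Y k f) ^+ 2 <= rnorm (Y k f) ^+ 2 - rnorm (Y h f) ^+ 2.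
Proof.
move=> k0 kh; have h0 : 0 < h by exact: lt_le_trans kh.
have := Gdiss (HY f h0) (HY f k0).
have -> : f + h%:C *: Y h f - (f + k%:C *: Y k f) =
    h%:C *: Y h f - k%:C *: Y k f by apply: ip_ext => e; rewrite !ipE; ring.
rewrite !ipE !ipxx (ipC (Y k f) (Y h f)) sqr_rnormB => H.
have := sqr_ge0 (rnorm (Y h f - Y k f)); rewrite sqr_rnormB => H1.
have H2 : (h + k) * (rnorm (Y h f) ^+ 2 - 2 * ip (Y h f) (Y k f) + rnorm (Y k f) ^+ 2)
   <= (h - k) * (rnorm (Y k f) ^+ 2 - rnorm (Y h f) ^+ 2) by lra.
have hk : 0 < h + k by rewrite addr_gt0.
have H3 : 0 <= (h - k) * (rnorm (Y k f) ^+ 2 - rnorm (Y h f) ^+ 2).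
  by rewrite (le_trans _ H2) // mulr_ge0 // ltW.
move: kh; rewrite le_eqVlt => /orP[/eqP khE|kh].
  move: H2 H1; rewrite khE subrr mul0r => H2 H1; nra.
rewrite pmulr_rge0 ?subr_gt0 // in H3.
rewrite -(ler_pM2l hk) (le_trans H2) // ler_wpM2r //.
by rewrite lerBlDr -addrA lerDl addr_ge0 // ltW.
Qed.

(** The limit [(x, w)] is compared with the point [(x', w')] of the graph such that
    [x' - w' = x - w]: dissipativity makes the two equal. *)
Lemma dissipative_closed (x w : X) (xn wn : nat -> X) :
  (forall n, G (xn n) (wn n)) -> xn n @[n --> \oo] --> x ->
  wn n @[n --> \oo] --> w -> G x w.
Proof.
move=> Gn xnx wnw.
have GY := HY (x - w) (@ltr01 R); set p := Y 1 (x - w) in GY.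
have H : ip (wn n - p) (xn n - (x - w + 1%:C *: p)) @[n --> \oo] -->
    ip (w - p) (x - (x - w + 1%:C *: p)).
  by apply: cvg_ip; apply: cvgB => //; exact: cvg_cst.
have : ip (w - p) (x - (x - w + 1%:C *: p)) <= 0.
  by apply: (ler_cvg_to H (cvg_cst 0)); apply: nearW => n; exact: Gdiss.
have -> : x - (x - w + 1%:C *: p) = w - p.
  by apply: ip_ext => e; rewrite !ipE; ring.
rewrite ipxx => wp.
have /eqP : rnorm (w - p) ^+ 2 = 0 by apply/eqP; rewrite eq_le wp sqr_ge0.
rewrite sqrf_eq0 => /eqP/rnorm_eq0/eqP; rewrite subr_eq0 => /eqP wpE.
by move: GY; rewrite -wpE scale1r subrK.
Qed.

(** Bounded Yosida approximations converge as [h] decreases, since their norms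
    increase; their limit is a value of [G] because [G] is closed. *)
Lemma yosida_bounded f M : (forall h, 0 < h -> rnorm (Y h f) <= M) ->
  exists w, [/\ G f w, rnorm w <= M &
    forall e : R, 0 < e -> exists2 h, 0 < h & rnorm (Y h f - w) < e].
Proof.
move=> HM.
pose q n : R := 2^-1 ^+ n.
have q0 n : 0 < q n by rewrite exprn_gt0.
have qle m n : (m <= n)%N -> q n <= q m.
  by move=> mn; rewrite ler_wiXn2l // ?invr_ge0 // invf_le1 // ler1n.
pose a n := rnorm (Y (q n) f) ^+ 2.
have a_dist m n : (m <= n)%N -> rnorm (Y (q m) f - Y (q n) f) ^+ 2 <= a n - a m.
  by move=> mn; apply: yosida_dist => //; exact: qle.
have a_incr : nondecreasing_seq a.
  by move=> m n /a_dist h; rewrite -subr_ge0 (le_trans _ h) // sqr_ge0.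
have a_ub : has_ubound (range a).
  exists (M ^+ 2) => _ [n _ <-]; rewrite ler_sqr ?nnegrE ?rnorm_ge0 ?HM //.
  by rewrite (le_trans _ (HM 1 ltr01)) // rnorm_ge0.
have a_cvg := nondecreasing_is_cvgn a_incr a_ub.
have a_sup n : a n <= limn a by exact: nondecreasing_cvgn_le.
have /cvg_ex[w Yw] : cvgn (fun n => Y (q n) f).
  apply: cauchy_rnorm_cvg => e e0.
  have e20 : 0 < (e / 2) ^+ 2 by rewrite exprn_gt0 // divr_gt0.
  have /cvgrPdist_lt/(_ _ e20)[N _ HN] := a_cvg.
  have near_N m : (N <= m)%N -> rnorm (Y (q N) f - Y (q m) f) <= e / 2.
    move=> Nm; rewrite -(@ler_sqr _) ?nnegrE ?rnorm_ge0 ?divr_ge0 ?(ltW e0) //.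
    rewrite (le_trans (a_dist _ _ Nm)) //.
    have := HN N (leqnn N); rewrite ger0_norm ?subr_ge0 //.
    by have := a_sup m; lra.
  exists N => m n /near_N Nm /near_N Nn.
  have := rnorm_tri (Y (q N) f) (Y (q m) f) (Y (q n) f).
  by rewrite (rnormB _ (Y (q N) f)); lra.
exists w; split.
- apply: (dissipative_closed (fun n => HY f (q0 n)) _ Yw).
  have : f + (q n)%:C *: Y (q n) f @[n --> \oo] --> f + 0.
    apply: cvgD; first exact: cvg_cst.
    apply/cvg_rnormP.
    have H : q n * rnorm (Y (q n) f) @[n --> \oo] --> 0 * rnorm w.
      by apply: cvgM; [exact: cvg_half_expn | exact: cvg_rnorm].
    rewrite mul0r in H; apply: (squeeze_cvgr _ (cvg_cst 0) H); apply: nearW => n.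
    by rewrite rnorm_ge0 subr0 rnormZr gtr0_norm // lexx.
  by rewrite addr0.
- by apply: (ler_cvg_to (cvg_rnorm Yw) (cvg_cst M)); apply: nearW => n; exact: HM.
- move=> e e0; have /near_rnormP/(_ _ e0)[N _ HN] := Yw.
  by exists (q N) => //; exact: (HN N (leqnn N)).
Qed.

Hypothesis Gsv : single_valued G.

Lemma yosida_near f w e : G f w -> 0 < e -> exists2 h, 0 < h & rnorm (Y h f - w) < e.
Proof.
move=> Gfw e0.
have [w' [Gfw' _ H]] := yosida_bounded (fun h h0 => yosida_le h0 Gfw).
by rewrite (Gsv Gfw Gfw'); exact: H.
Qed.

(** Weak convergence to [w], tested on the Yosida approximations of [w] only,
    and convergence of the norms give convergence. *)
Lemma cvg_to_value (T : Type) (F : set_system T) {FF : ProperFilter F}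
    (d : T -> X) (x w : X) : G x w ->
  (forall e, 0 < e -> \forall t \near F, rnorm (d t) <= rnorm w + e) ->
  (forall h e, 0 < h -> 0 < e -> \forall t \near F,
     rnorm (Y h x) ^+ 2 - e <= ip (d t) (Y h x)) ->
  d @ F --> w.
Proof.
move=> Gxw dw dY; apply/near_rnormP => e e0.
pose W := rnorm w; have W0 : 0 <= W by exact: rnorm_ge0.
pose K := 8 * W + 5; have K0 : 0 < K by rewrite ltr_wpDl // mulr_ge0.
pose n := Num.min 1 (e ^+ 2 / (2 * K)).
have n0 : 0 < n by rewrite lt_min ltr01 divr_gt0 ?exprn_gt0 // mulr_gt0.
have n1 : n <= 1 by rewrite ge_min lexx.
have nK : n * K < e ^+ 2.
  rewrite (@le_lt_trans _ _ (e ^+ 2 / (2 * K) * K)) //.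
    by rewrite ler_pM2r // ge_min lexx orbT.
  have -> : e ^+ 2 / (2 * K) * K = e ^+ 2 / 2 by field; rewrite gt_eqF.
  by rewrite ltr_pdivrMr // ltr_pMr ?exprn_gt0 // ltr1n.
have [h h0 hw] := yosida_near Gxw n0.
apply: filterS2 (dw _ n0) (dY h n h0 n0) => t dtw dtY.
rewrite -(@ltr_sqr _) ?nnegrE ?rnorm_ge0 ?(ltW e0) // sqr_rnormB.
have pW : W - n <= rnorm (Y h x).
  have := rnormD_le (Y h x) (w - Y h x); rewrite addrC subrK rnormB -/W; lra.
have p0 := rnorm_ge0 (Y h x).
have p2 : W ^+ 2 - 2 * W * n <= rnorm (Y h x) ^+ 2.
  have [Wn|Wn] := leP n W; last by nra.
  have : (W - n) ^+ 2 <= rnorm (Y h x) ^+ 2 by rewrite ler_sqr ?nnegrE ?subr_ge0.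
  by rewrite sqrrB -mulr_natl; have := sqr_ge0 n; lra.
have dw1 : ip (d t) (Y h x) - ip (d t) w <= (W + n) * n.
  have -> : ip (d t) (Y h x) - ip (d t) w = ip (d t) (Y h x - w) by rewrite !ipE.
  rewrite (le_trans (ip_le _ _)) // ler_pM ?rnorm_ge0 //; exact: ltW.
have d2 : rnorm (d t) ^+ 2 <= (W + n) ^+ 2.
  by rewrite ler_sqr ?nnegrE ?rnorm_ge0 ?addr_ge0 // ltW.
rewrite -/W (le_lt_trans _ nK) // /K.
nra.
Qed.

(** Demiclosedness: along a convergent sequence of points, values of norm at most
    that of the limit value converge. *)
Lemma value_continuous (T : Type) (F : set_system T) {FF : ProperFilter F}
    (u v : T -> X) (x w : X) : G x w -> (\forall t \near F, G (u t) (v t)) ->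
  u @ F --> x ->
  (forall e, 0 < e -> \forall t \near F, rnorm (v t) <= rnorm w + e) ->
  v @ F --> w.
Proof.
move=> Gxw Guv ux vw; apply: (cvg_to_value Gxw vw) => h e h0 e0.
set p := Y h x.
pose K := rnorm w + 1 + rnorm p.
have K0 : 0 < K by rewrite ltr_wpDr ?rnorm_ge0 // ltr_wpDl // rnorm_ge0.
have r0 : 0 < e * h / K by rewrite divr_gt0 // mulr_gt0.
move/near_rnormP: ux => /(_ _ r0) ux.
apply: filterS3 Guv ux (vw 1 ltr01) => t Gt ut vt.
have := Gdiss Gt (HY x h0); rewrite -/p.
have -> : u t - (x + h%:C *: p) = (u t - x) - h%:C *: p.
  by apply: ip_ext => z; rewrite !ipE; ring.
rewrite ipDr ipNr ipZr => H.
have H1 : - (K * rnorm (u t - x)) <= ip (v t - p) (u t - x).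
  rewrite lerNl -ipNl (le_trans (ip_le _ _)) // rnormN.
  by rewrite ler_wpM2r ?rnorm_ge0 // (le_trans (rnormB_le _ _)) // lerD2r.
move: ut; rewrite ltr_pdivlMr // => ut.
rewrite -ipxx -lerBrDr opprK -subr_ge0 -(pmulr_rge0 _ h0).
have : ip (v t - p) p = ip (v t) p - ip p p by rewrite !ipE.
nra.
Qed.

End Dissipative.

(** * The implicit Euler scheme *)

Section Euler.
Context {R : realType} {X : hilbertType R}.
Variables (G : X -> X -> Prop) (Y : R -> X -> X).
Hypotheses (Gdiss : dissipative G) (HY : is_yosida G Y).
Variables (x0 w0 : X).
Hypothesis Gx0 : G x0 w0.

Local Notation M := (rnorm w0).

Definition euler (h : R) (k : nat) : X := iter k (fun x => x + h%:C *: Y h x) x0.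

Lemma eulerS h k : euler h k.+1 = euler h k + h%:C *: Y h (euler h k).
Proof. by []. Qed.

Lemma euler_value h k : 0 < h -> exists2 w, G (euler h k) w & rnorm w <= M.
Proof.
move=> h0; elim: k => [|k [w Gw wM]]; first by exists w0.
exists (Y h (euler h k)); first exact: HY.
by rewrite (le_trans (yosida_le Gdiss HY h0 Gw)).
Qed.

Lemma euler_yosida h k : 0 < h -> rnorm (Y h (euler h k)) <= M.
Proof.
move=> h0; have [w Gw wM] := euler_value k h0.
by rewrite (le_trans (yosida_le Gdiss HY h0 Gw)).
Qed.

Lemma euler_dist h k j : 0 < h ->
  rnorm (euler h (k + j) - euler h k) <= M * (h * j%:R).
Proof.
move=> h0; elim: j => [|j IH]; first by rewrite addn0 subrr rnorm0 !mulr0.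
rewrite addnS eulerS addrAC (le_trans (rnormD_le _ _)) //.
rewrite rnormZr gtr0_norm // -natr1.
have : h * rnorm (Y h (euler h (k + j))) <= h * M by rewrite ler_pM2l // euler_yosida.
by move: IH; lra.
Qed.

Lemma euler_dist_abs h k j : 0 < h ->
  rnorm (euler h j - euler h k) <= M * (h * `|j%:R - k%:R|).
Proof.
move=> h0; wlog kj : k j / (k <= j)%N.
  by move=> H; case: (leqP k j) => [|/ltnW] /H //; rewrite rnormB distrC.
rewrite ger0_norm ?subr_ge0 ?ler_nat // -natrB // -{1}(subnKC kj).
exact: euler_dist.
Qed.

(** One step of size [h] against two steps of size [h / 2]: by dissipativity
    the squared distance grows by [O(h^2)] only, so that it is [O(h)] after
    [O(1 / h)] steps. *)
Lemma euler_half h k : 0 < h ->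
  rnorm (euler h k - euler (h / 2) k.*2) ^+ 2 <= k%:R * h ^+ 2 * M ^+ 2.
Proof.
move=> h0; have h20 : 0 < h / 2 by rewrite divr_gt0.
elim: k => [|k IH]; first by rewrite subrr rnorm0 !mul0r expr0n.
rewrite doubleS !eulerS -natr1.
move: IH; set a := euler h k; set b := euler (h / 2) k.*2.
have AM := euler_yosida k h0; have B1M := euler_yosida k.*2 h20.
have B2M := euler_yosida k.*2.+1 h20.
move: AM B1M B2M; rewrite !eulerS -/a -/b.
have := HY a h0; have := HY b h20; have := HY (b + (h / 2)%:C *: Y (h / 2) b) h20.
set A := Y h a; set B1 := Y (h / 2) b; set b1 := b + _; set B2 := Y (h / 2) b1.
set a' := a + _; set b2 := b1 + _ => GB2 GB1 GA AM B1M B2M IH.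
have H1 := Gdiss GA GB1; have H2 := Gdiss GA GB2.
have abE : a - b = (a' - b2) - h%:C *: (A - (2^-1)%:C *: (B1 + B2)).
  by apply: ip_ext => z; rewrite /a' /b2 /b1 !ipE; field.
rewrite abE sqr_rnormBZ in IH.
have b21 : a' - b2 = (a' - b1) - (h / 2)%:C *: B2.
  by apply: ip_ext => z; rewrite /b2 !ipE; ring.
have H3 : ip (A - (2^-1)%:C *: (B1 + B2)) (a' - b2) <= h * M ^+ 2 / 2.
  have -> : ip (A - (2^-1)%:C *: (B1 + B2)) (a' - b2) =
      2^-1 * (ip (A - B1) (a' - b1) + ip (A - B2) (a' - b2)
              - (h / 2) * ip (A - B1) B2).
    rewrite {2}b21; clearbody a' b1 b2 B1 B2 A; rewrite b21.
    by rewrite !ipE; field.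
  have : - ip (A - B1) B2 <= 2 * M ^+ 2.
    rewrite -ipNl (le_trans (ip_le _ _)) // rnormN.
    have := rnormB_le A B1; have := rnorm_ge0 B2; have := rnorm_ge0 (A - B1).
    nra.
  by move: h0 => /ltW; nra.
have : 0 <= h ^+ 2 * rnorm (A - (2^-1)%:C *: (B1 + B2)) ^+ 2.
  by rewrite mulr_ge0 // sqr_ge0.
have : 2 * h * ip (A - (2^-1)%:C *: (B1 + B2)) (a' - b2) <= 2 * h * (h * M ^+ 2 / 2).
  by rewrite ler_pM2l // mulr_gt0.
by move: IH; lra.
Qed.

(** Every value [z] at [y] bounds the growth of the distance to [y]. *)
Lemma euler_growth h k j y z : 0 < h -> G y z ->
  rnorm (euler h (k + j) - y) ^+ 2 - rnorm (euler h k - y) ^+ 2 <=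
  2 * (h * j%:R) * (ip z (euler h k - y) + rnorm z * M * (h * j%:R)).
Proof.
move=> h0 Gyz.
suff H N : (N <= j)%N ->
    rnorm (euler h (k + N) - y) ^+ 2 - rnorm (euler h k - y) ^+ 2 <=
    2 * (h * N%:R) * (ip z (euler h k - y) + rnorm z * M * (h * j%:R)).
  exact: H.
elim: N => [|N IH] Nj; first by rewrite addn0 subrr mulr0 mulr0 mul0r.
have {IH} := IH (ltnW Nj); rewrite addnS.
set c := ip z _ + _; set e := euler h (k + N); set e' := euler h (k + N).+1.
set p := Y h e => IH.
have eE : e - y = (e' - y) - h%:C *: p.
  by apply: ip_ext => v; rewrite /e' eulerS !ipE -/e -/p; ring.
have Gp : G e' p by exact: HY.
have H1 := Gdiss Gp Gyz; rewrite ipDl ipNl in H1.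
have H2 : ip z (e' - y) <= c.
  have -> : e' - y = (euler h k - y) + (e' - euler h k).
    by apply: ip_ext => v; rewrite !ipE; ring.
  rewrite ipDr lerD2l (le_trans (ip_le _ _)) // -mulrA ler_wpM2l ?rnorm_ge0 //.
  rewrite /e' -addnS (le_trans (euler_dist _ _ h0)) // ler_wpM2l ?rnorm_ge0 //.
  by rewrite ler_pM2l // ler_nat.
move: IH; rewrite eE sqr_rnormBZ -natr1.
have : 0 <= h ^+ 2 * rnorm p ^+ 2 by rewrite mulr_ge0 // sqr_ge0.
have : 2 * h * ip p (e' - y) <= 2 * h * c by rewrite ler_pM2l ?mulr_gt0 //; lra.
lra.
Qed.

End Euler.

Section DyadicGrid.
Context {R : realType}.
Implicit Types t : R.

Local Notation q n := ((2^-1 : R) ^+ n).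

Definition dyadic_index n t := Num.truncn (t / q n).

Lemma dyadic_gt0 n : 0 < q n.
Proof. by rewrite exprn_gt0. Qed.

Lemma dyadic_index_itv n t : 0 <= t ->
  q n * (dyadic_index n t)%:R <= t < q n * (dyadic_index n t)%:R + q n.
Proof.
move=> t0; have q0 := dyadic_gt0 n.
have /truncn_itv/andP[h1 h2] : 0 <= t / q n by rewrite divr_ge0 // ltW.
move: h1 h2; rewrite ler_pdivlMr // ltr_pdivrMr //.
rewrite -[(Num.truncn _).+1]addn1 natrD mulrDl mul1r.
by rewrite !(mulrC (q n)) => -> ->.
Qed.

Lemma dyadic_index_le n s t : s <= t -> (dyadic_index n s <= dyadic_index n t)%N.
Proof.
move=> st; apply: le_truncn; rewrite ler_pM2r // invr_gt0; exact: dyadic_gt0.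
Qed.

Lemma dyadic_indexS n t : 0 <= t ->
  ((dyadic_index n t).*2 <= dyadic_index n.+1 t <= (dyadic_index n t).*2.+1)%N.
Proof.
move=> t0; have q0 := dyadic_gt0 n.
have /andP[h1 h2] := dyadic_index_itv n t0.
have E : t / q n.+1 = 2 * (t / q n) by rewrite exprSr; field; rewrite gt_eqF.
have tq : 0 <= t / q n by rewrite divr_ge0 // ltW.
have /truncn_itv/andP[h3 h4] := tq.
rewrite /dyadic_index E truncn_ge_nat ?mulr_ge0 // truncn_le_nat.
rewrite -doubleS -!mul2n !natrM ler_pM2l // h3 /=.
by rewrite ltr_pM2l.
Qed.

Lemma cvg_dyadic_index t : 0 <= t ->
  q n * (dyadic_index n t)%:R @[n --> \oo] --> t.
Proof.
move=> t0.
have h : t - q n @[n --> \oo] --> t - 0.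
  by apply: cvgB; [exact: cvg_cst | exact: cvg_half_expn].
rewrite subr0 in h.
apply: (squeeze_cvgr _ h (cvg_cst t)); apply: nearW => n.
have /andP[h1 h2] := dyadic_index_itv n t0.
by rewrite h1 andbT lerBlDr ltW.
Qed.

End DyadicGrid.

Section EulerLimit.
Context {R : realType} {X : hilbertType R}.
Variables (G : X -> X -> Prop) (Y : R -> X -> X).
Hypotheses (Gdiss : dissipative G) (HY : is_yosida G Y).
Variables (x0 w0 : X).
Hypothesis Gx0 : G x0 w0.

Local Notation M := (rnorm w0).
Local Notation q n := ((2^-1 : R) ^+ n).
Local Notation U n t := (euler Y x0 (q n) (dyadic_index n t)).

Let euler_geometric t n : 0 <= t ->
  rnorm (U n.+1 t - U n t) <= M * (t + 2) * Num.sqrt 2^-1 ^+ n.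
Proof.
move=> t0; set r := Num.sqrt 2^-1; have q0 := @dyadic_gt0 R n.
have rr : r ^+ n ^+ 2 = q n by rewrite -exprM mulnC exprM sqr_sqrtr.
have r0 : 0 < r ^+ n by rewrite exprn_gt0 // sqrtr_gt0 invr_gt0.
have r1 : r ^+ n <= 1.
  rewrite -(@ler_sqr _) ?nnegrE ?(ltW r0) // rr expr1n exprn_ile1 //.
  by rewrite invf_le1 // ler1n.
have qr : q n <= r ^+ n by rewrite -rr; nra.
set k := dyadic_index n t.
have /andP[k1 k2] := dyadic_indexS n t0; rewrite -/k in k1 k2.
have qS : q n.+1 = q n / 2 by rewrite exprSr.
have M0 : 0 <= M by exact: rnorm_ge0.
have h1 : rnorm (U n.+1 t - euler Y x0 (q n / 2) k.*2) <= M * r ^+ n.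
  rewrite qS (le_trans (euler_dist_abs Gdiss HY Gx0 _ _ _)) ?divr_gt0 //.
  rewrite ler_wpM2l // (le_trans _ qr) // ger0_norm ?subr_ge0 ?ler_nat //.
  rewrite -natrB //; have : (dyadic_index n.+1 t - k.*2 <= 1)%N.
    by rewrite leq_subLR addn1.
  rewrite -(ler_nat R) => j1.
  by rewrite (le_trans (ler_wpM2l _ j1)) // ?mulr1 ?ler_pdivrMr ?ler_peMr ?ler1n ?divr_ge0 // ltW.
have h2 : rnorm (euler Y x0 (q n) k - euler Y x0 (q n / 2) k.*2) <= M * (t + 1) * r ^+ n.
  rewrite -(@ler_sqr _) ?nnegrE ?mulr_ge0 ?rnorm_ge0 ?addr_ge0 ?(ltW r0) //.
  rewrite (le_trans (euler_half Gdiss HY Gx0 _ q0)) // !exprMn rr.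
  have /andP[kt _] := dyadic_index_itv n t0; rewrite -/k in kt.
  have : q n * k%:R * (q n * M ^+ 2) <= t * (q n * M ^+ 2).
    by rewrite ler_wpM2r // mulr_ge0 ?sqr_ge0 // ltW.
  have : t * (q n * M ^+ 2) <= (t + 1) ^+ 2 * (q n * M ^+ 2).
    by rewrite ler_wpM2r // ?mulr_ge0 ?sqr_ge0 ?(ltW q0) //; nra.
  lra.
have := rnorm_tri (euler Y x0 (q n / 2) k.*2) (U n.+1 t) (U n t).
rewrite -/k; rewrite rnormB in h2; lra.
Qed.

(** The Euler polygons for the steps [2 ^- n] converge pointwise. Of the limit
    only two properties are kept: its Lipschitz constant and, for each point
    [(y, z)] of the graph, the integrated form of the inequality that says that
    [u' - z] and [u - y] make an obtuse angle. *)
Lemma euler_limit : exists u : R -> X, [/\ u 0 = x0,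
  forall s t : R, 0 <= s -> s <= t -> rnorm (u t - u s) <= M * (t - s) &
  forall y z (s t : R), G y z -> 0 <= s -> s <= t ->
    rnorm (u t - y) ^+ 2 - rnorm (u s - y) ^+ 2 <=
    2 * (t - s) * (ip z (u s - y) + rnorm z * M * (t - s))].
Proof.
have r0 : 0 <= Num.sqrt (2^-1 : R) by exact: sqrtr_ge0.
have r1 : Num.sqrt (2^-1 : R) < 1.
  by rewrite -[ltRHS]sqrtr1 ltr_sqrt ?ltr01 // invf_lt1 // ltr1n.
have lim_ex (t : R) : exists l : X, 0 <= t -> U n t @[n --> \oo] --> l.
  have [t0|] := leP 0 t; last by exists 0.
  have [l Ul _] := geometric_cvg r0 r1 (fun n => euler_geometric n t0).
  by exists l.
have [u Uu] := choice lim_ex.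
have dU (s t : R) : 0 <= s -> s <= t ->
    q n * (dyadic_index n t - dyadic_index n s)%N%:R @[n --> \oo] --> t - s.
  move=> s0 st; have t0 := le_trans s0 st.
  rewrite (_ : (fun n => _) = fun n =>
    q n * (dyadic_index n t)%:R - q n * (dyadic_index n s)%:R).
    by apply: cvgB; exact: cvg_dyadic_index.
  by apply/funext => n; rewrite natrB ?dyadic_index_le // mulrBr.
have nU (s t : R) n : 0 <= s -> s <= t ->
    U n t = euler Y x0 (q n) (dyadic_index n s + (dyadic_index n t - dyadic_index n s)).
  by move=> s0 st; rewrite subnKC // dyadic_index_le.
exists u; split.
- apply: (rnorm_cvg_unique (Uu 0 (lexx _))).
  rewrite (_ : (fun n => _) = cst x0); first exact: cvg_cst.
  by apply/funext => n; rewrite /dyadic_index mul0r truncn0.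
- move=> s t s0 st; have t0 := le_trans s0 st.
  have h1 : rnorm (U n t - U n s) @[n --> \oo] --> rnorm (u t - u s).
    by apply: cvg_rnorm; apply: cvgB; exact: Uu.
  have h2 : M * (q n * (dyadic_index n t - dyadic_index n s)%N%:R) @[n --> \oo]
      --> M * (t - s) by apply: cvgMr; exact: dU.
  apply: (ler_cvg_to h1 h2); apply: nearW => n /=.
  by rewrite (nU s t) //; exact: (euler_dist Gdiss HY Gx0 _ _ (dyadic_gt0 n)).
- move=> y z s t Gyz s0 st; have t0 := le_trans s0 st.
  have sq (v : R) : 0 <= v -> rnorm (U n v - y) ^+ 2 @[n --> \oo] --> rnorm (u v - y) ^+ 2.
    move=> v0; rewrite (_ : (fun n => _) = fun n => rnorm (U n v - y) * rnorm (U n v - y)) //.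
    by rewrite expr2; apply: cvgM; apply: cvg_rnorm; apply: cvgB;
       [exact: Uu | exact: cvg_cst | exact: Uu | exact: cvg_cst].
  have h1 : rnorm (U n t - y) ^+ 2 - rnorm (U n s - y) ^+ 2 @[n --> \oo] -->
      rnorm (u t - y) ^+ 2 - rnorm (u s - y) ^+ 2 by apply: cvgB; exact: sq.
  have h3 : ip z (U n s - y) + rnorm z * M *
      (q n * (dyadic_index n t - dyadic_index n s)%N%:R) @[n --> \oo] -->
      ip z (u s - y) + rnorm z * M * (t - s).
    apply: cvgD; last by apply: cvgMr; exact: dU.
    by apply: cvg_ip; [exact: cvg_cst | apply: cvgB; [exact: Uu | exact: cvg_cst]].
  have h2 : 2 * (q n * (dyadic_index n t - dyadic_index n s)%N%:R) *
      (ip z (U n s - y) + rnorm z * M *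
      (q n * (dyadic_index n t - dyadic_index n s)%N%:R)) @[n --> \oo] -->
      2 * (t - s) * (ip z (u s - y) + rnorm z * M * (t - s)).
    by apply: cvgM => //; apply: cvgMr; exact: dU.
  apply: (ler_cvg_to h1 h2); apply: nearW => n /=.
  rewrite (nU s t) //.
  exact: (euler_growth Gdiss HY Gx0 _ _ (dyadic_gt0 n)).
Qed.

End EulerLimit.

(** * Trajectories with a right derivative everywhere *)

Definition right_derivative (R : realType) (X : normedModType R[i]) (F : R -> X)
  (t : R) (D : X) := (h^-1)%:C *: (F (t + h) - F t) @[h --> 0^'+] --> D.

Lemma right_derivativeB (R : realType) (X : normedModType R[i]) (F1 F2 : R -> X)
    (t : R) (D1 D2 : X) : right_derivative F1 t D1 -> right_derivative F2 t D2 ->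
  right_derivative (fun t => F1 t - F2 t) t (D1 - D2).
Proof.
move=> H1 H2; rewrite /right_derivative.
rewrite (_ : (fun h : R => _) = fun h => (h^-1)%:C *: (F1 (t + h) - F1 t)
    - (h^-1)%:C *: (F2 (t + h) - F2 t)); first exact: cvgB.
apply/funext => h; rewrite -scalerBr; congr (_ *: _).
by rewrite !opprD !opprK !addrA; congr (_ + _); rewrite addrAC.
Qed.

Section Energy.
Context {R : realType}.

(** Two trajectories may dissipate a weighted sum of their energies even if
    neither energy decreases. *)
Lemma energy_nonincreasing (X1 X2 : hilbertType R) (F1 D1 : R -> X1)
    (F2 D2 : R -> X2) (k a b : R) : 0 <= k -> a <= b ->
  (forall t, a < t -> t <= b -> F1 (t - h) @[h --> 0^'+] --> F1 t) ->
  (forall t, a < t -> t <= b -> F2 (t - h) @[h --> 0^'+] --> F2 t) ->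
  (forall t, a <= t -> t < b -> right_derivative F1 t (D1 t)) ->
  (forall t, a <= t -> t < b -> right_derivative F2 t (D2 t)) ->
  (forall t, a <= t -> t < b -> ip (D1 t) (F1 t) + k * ip (D2 t) (F2 t) <= 0) ->
  rnorm (F1 b) ^+ 2 + k * rnorm (F2 b) ^+ 2 <=
  rnorm (F1 a) ^+ 2 + k * rnorm (F2 a) ^+ 2.
Proof.
move=> k0 ab c1 c2 d1 d2 D0.
apply: (@dini_nonincreasing R
  (fun t => rnorm (F1 t) ^+ 2 + k * rnorm (F2 t) ^+ 2) a b ab).
- move=> t at_ tb e e0.
  have sq (X : hilbertType R) (F : R -> X) : F (t - h) @[h --> 0^'+] --> F t ->
      rnorm (F (t - h)) ^+ 2 @[h --> 0^'+] --> rnorm (F t) ^+ 2.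
    move=> H; rewrite expr2; under eq_fun do rewrite expr2.
    by apply: cvgM; exact: cvg_rnorm.
  have H : rnorm (F1 (t - h)) ^+ 2 + k * rnorm (F2 (t - h)) ^+ 2 @[h --> 0^'+] -->
      rnorm (F1 t) ^+ 2 + k * rnorm (F2 t) ^+ 2.
    by apply: cvgD; [apply: sq; exact: c1 | apply: cvgMr; apply: sq; exact: c2].
  have /cvgrPdist_lt/(_ _ e0) := H; apply: filterS => h.
  by rewrite ltr_distl => /andP[_ /ltW].
- move=> t at_ tb e e0.
  have e1 : 0 < e / (1 + k) by rewrite divr_gt0 // ltr_wpDr.
  have := dini_sqr_rnorm (d1 t at_ tb) (lexx _) e1.
  have := dini_sqr_rnorm (d2 t at_ tb) (lexx _) e1.
  apply: filterS3 (nbhs_right_gt 0) => h h0 h2 h1.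
  have h2' := ler_wpM2l k0 h2.
  have D0' : (ip (D1 t) (F1 t) + k * ip (D2 t) (F2 t)) * h <= 0.
    by rewrite pmulr_lle0 // D0.
  have -> : e * h = (e / (1 + k)) * h + k * (e / (1 + k)) * h.
    by field; rewrite gt_eqF // ltr_wpDr.
  lra.
Qed.

Lemma rnorm_nonincreasing (X : hilbertType R) (F D : R -> X) (a b : R) : a <= b ->
  (forall t, a < t -> t <= b -> F (t - h) @[h --> 0^'+] --> F t) ->
  (forall t, a <= t -> t < b -> right_derivative F t (D t)) ->
  (forall t, a <= t -> t < b -> ip (D t) (F t) <= 0) ->
  rnorm (F b) <= rnorm (F a).
Proof.
move=> ab c d D0; rewrite -(@ler_sqr _) ?nnegrE ?rnorm_ge0 //.
have := @energy_nonincreasing X X F D F D 0 a b (lexx _) ab c c d d.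
rewrite !mul0r !addr0; apply => t at_ tb.
by rewrite mul0r addr0 D0.
Qed.

Lemma rnorm_mean_value (X : normedModType R[i]) (F D : R -> X) (a b C : R) : a <= b ->
  (forall t, a < t -> t <= b -> F (t - h) @[h --> 0^'+] --> F t) ->
  (forall t, a <= t -> t < b -> right_derivative F t (D t)) ->
  (forall t, a <= t -> t < b -> rnorm (D t) <= C) ->
  rnorm (F b - F a) <= C * (b - a).
Proof.
move=> ab c d DC.
suff : rnorm (F b - F a) - C * b <= rnorm (F a - F a) - C * a.
  by rewrite subrr rnorm0; lra.
apply: (@dini_nonincreasing R (fun t => rnorm (F t - F a) - C * t) a b ab).
- move=> t at_ tb e e0.
  have H : rnorm (F (t - h) - F a) - C * (t - h) @[h --> 0^'+] -->
      rnorm (F t - F a) - C * (t - 0).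
    apply: cvgB; first by apply: cvg_rnorm; apply: cvgB; [exact: c | exact: cvg_cst].
    apply: cvgMr; apply: cvgB; first exact: cvg_cst.
    exact: cvg_at_right_filter cvg_id.
  rewrite subr0 in H.
  have /cvgrPdist_lt/(_ _ e0) := H; apply: filterS => h.
  by rewrite ltr_distl => /andP[_ /ltW].
- move=> t at_ tb e e0.
  have /cvg_rnorm/cvgrPdist_lt/(_ _ e0) := d t at_ tb.
  apply: filterS2 (nbhs_right_gt 0) => h h0.
  rewrite rnormZr [`|h^-1|]gtr0_norm ?invr_gt0 // ltr_distlC => /andP[_ h1].
  have := rnorm_tri (F t) (F (t + h)) (F a).
  have : h^-1 * rnorm (F (t + h) - F t) <= C + e.
    by rewrite (le_trans (ltW h1)) // lerD2r DC.
  by rewrite ler_pdivrMl //; lra.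
Qed.

End Energy.

Section Trajectory.
Context {R : realType} {X : hilbertType R}.
Variables (G : X -> X -> Prop) (Y : R -> X -> X).
Hypotheses (Gdiss : dissipative G) (HY : is_yosida G Y) (Gsv : single_valued G).
Variables (u : R -> X) (M : R).
Hypothesis M0 : 0 <= M.
Hypothesis uLip : forall s t : R, 0 <= s -> s <= t -> rnorm (u t - u s) <= M * (t - s).
Hypothesis ugrow : forall y z (s t : R), G y z -> 0 <= s -> s <= t ->
  rnorm (u t - y) ^+ 2 - rnorm (u s - y) ^+ 2 <=
  2 * (t - s) * (ip z (u s - y) + rnorm z * M * (t - s)).

(** The growth condition at the point of the graph that the resolvent of [u s]
    provides. *)
Let quotient_yosida (s d h : R) : 0 <= s -> 0 < d -> 0 < h ->
  rnorm (Y h (u s)) ^+ 2 <= ip ((d^-1)%:C *: (u (s + d) - u s)) (Y h (u s)) +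
    rnorm (Y h (u s)) * M / h * d.
Proof.
move=> s0 d0 h0; set p := Y h (u s).
have st : s <= s + d by rewrite lerDl ltW.
have := ugrow (HY (u s) h0) s0 st; rewrite -/p.
set v := u (s + d) - u s.
have E1 : u (s + d) - (u s + h%:C *: p) = v - h%:C *: p.
  by apply: ip_ext => z; rewrite !ipE; ring.
have E2 : u s - (u s + h%:C *: p) = - (h%:C *: p).
  by apply: ip_ext => z; rewrite !ipE; ring.
have E3 : s + d - s = d by rewrite addrAC subrr add0r.
rewrite E1 E2 E3 rnormN sqr_rnormBZ rnormZr exprMn real_normK ?num_real //.
rewrite ipNr !ipZr ipZl ipxx (ipC p v) => H.
have v2 := sqr_ge0 (rnorm v).
rewrite -(ler_pM2l (mulr_gt0 d0 h0)).
have -> : d * h * (d^-1 * ip v p + rnorm p * M / h * d) =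
    h * ip v p + rnorm p * M * d ^+ 2.
  by field; rewrite !gt_eqF.
by move: H v2; lra.
Qed.

(** Difference quotients of [u] have norm at most [M], so the Yosida
    approximations at [u s] are bounded by [M]. *)
Let limit_value (s : R) : 0 <= s -> exists2 w, G (u s) w & rnorm w <= M.
Proof.
move=> s0.
suff H h : 0 < h -> rnorm (Y h (u s)) <= M.
  by have [w [Gw wM _]] := yosida_bounded Gdiss HY H; exists w.
move=> h0; set p := Y h (u s).
have [->//|p_neq0] := eqVneq (rnorm p) 0.
have p0 : 0 < rnorm p by rewrite lt_def p_neq0 rnorm_ge0.
apply/ler_addgt0Pr => e e0.
pose d := e * h / (M + 1).
have M1 : 0 < M + 1 by rewrite ltr_wpDl.
have d0 : 0 < d by rewrite divr_gt0 // mulr_gt0.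
have H0 := quotient_yosida s0 d0 h0; rewrite -/p in H0.
have H1 : ip ((d^-1)%:C *: (u (s + d) - u s)) p <= M * rnorm p.
  rewrite (le_trans (ip_le _ _)) // ler_pM2r // rnormZr gtr0_norm ?invr_gt0 //.
  rewrite ler_pdivrMl // mulrC (le_trans (uLip s0 _)) ?lerDl ?(ltW d0) //.
  by rewrite addrAC subrr add0r.
have H2 : M / h * d <= e.
  rewrite /d; have -> : M / h * (e * h / (M + 1)) = e * (M / (M + 1)).
    by field; rewrite !gt_eqF.
  by rewrite ger_pMr // ler_pdivrMr // mul1r lerDl.
rewrite -(ler_pM2r p0) -expr2 (le_trans H0) //.
by have := ler_wpM2r (ltW p0) H2; lra.
Qed.

(** The value of [G] at a point bounds the speed from there on; [sqrt (f^2 + e^2)]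
    regularises the distance [f] to the starting point at its zero. *)
Let speed_le (s t : R) z : G (u s) z -> 0 <= s -> s <= t ->
  rnorm (u t - u s) <= rnorm z * (t - s).
Proof.
move=> Gz s0 st; apply/ler_addgt0Pr => e e0.
pose f v := Num.sqrt (rnorm (u v - u s) ^+ 2 + e ^+ 2).
have f2 v : f v ^+ 2 = rnorm (u v - u s) ^+ 2 + e ^+ 2.
  by rewrite sqr_sqrtr // addr_ge0 // sqr_ge0.
have f0 v : 0 <= f v by exact: sqrtr_ge0.
have fu v : rnorm (u v - u s) <= f v.
  by rewrite -(@ler_sqr _) ?nnegrE ?rnorm_ge0 // f2 lerDl sqr_ge0.
have fe v : e <= f v.
  by rewrite -(@ler_sqr _) ?nnegrE ?(ltW e0) // f2 lerDr sqr_ge0.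
set Z := rnorm z; have Z0 : 0 <= Z by exact: rnorm_ge0.
pose c := Z * M / e; have c0 : 0 <= c by rewrite !mulr_ge0 // invr_ge0 ltW.
have fstep a b : s <= a -> a <= b -> f b <= f a + Z * (b - a) + c * (b - a) ^+ 2.
  move=> sa ab; have a0 := le_trans s0 sa.
  have d0 : 0 <= b - a by rewrite subr_ge0.
  have H := ugrow Gz a0 ab; rewrite -/Z in H.
  have H1 : ip z (u a - u s) <= Z * f a.
    by rewrite (le_trans (ip_le _ _)) // ler_wpM2l.
  have ce : Z * M <= c * f a.
    have -> : Z * M = c * e by rewrite /c divfK // gt_eqF.
    by rewrite ler_wpM2l.
  have h1 : (b - a) * ip z (u a - u s) <= (b - a) * (Z * f a) by rewrite ler_wpM2l.
  have h2 : (b - a) ^+ 2 * (Z * M) <= (b - a) ^+ 2 * (c * f a).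
    by rewrite ler_wpM2l ?sqr_ge0.
  have k0 : 0 <= Z * (b - a) + c * (b - a) ^+ 2.
    by rewrite addr_ge0 // mulr_ge0 ?sqr_ge0.
  rewrite -addrA -(@ler_sqr _) ?nnegrE ?f0 ?(addr_ge0 (f0 a) k0) //.
  rewrite f2 [leRHS]sqrrD f2 -mulr_natl.
  have := sqr_ge0 (Z * (b - a) + c * (b - a) ^+ 2).
  by move: H h1 h2; lra.
suff : f t - Z * t <= f s - Z * s.
  have -> : f s = e by rewrite /f subrr rnorm0 expr0n add0r sqrtr_sqr gtr0_norm.
  by have := fu t; lra.
have small (r : R) : 0 < r -> \forall h \near 0^'+, c * h <= r /\ c * h ^+ 2 <= r.
  move=> r0; have c1 : 0 < c + 1 by rewrite ltr_wpDl.
  have m0 : 0 < Num.min 1 (r / (c + 1)) by rewrite lt_min ltr01 divr_gt0.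
  apply/near_right0P; exists (Num.min 1 (r / (c + 1))) => // h /andP[h0].
  rewrite lt_min => /andP[h1]; rewrite ltr_pdivlMr // => hr.
  by split; nra.
apply: (@dini_nonincreasing R (fun t => f t - Z * t) s t st).
- move=> v sv vt r r0.
  have sv0 : 0 < v - s by rewrite subr_gt0.
  apply: filterS3 (nbhs_right_gt 0) (nbhs_right_lt sv0) (small _ r0) => h h0 hv [_ hr].
  have := @fstep (v - h) v; rewrite subKr => H.
  have h1 : s <= v - h by lra.
  have h2 : v - h <= v by lra.
  by have := H h1 h2; lra.
- move=> v sv vt r r0.
  apply: filterS2 (nbhs_right_gt 0) (small _ r0) => h h0 [hr _].
  have := @fstep v (v + h) sv; rewrite [v + h - v]addrAC subrr add0r => H.
  have h1 : v <= v + h by lra.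
  by have := H h1; have := ler_wpM2r (ltW h0) hr; lra.
Qed.

(** The difference quotients have norm at most [rnorm w], and their components
    along the Yosida approximations of [w] are large enough. *)
Let value_right_derivative (s : R) w : G (u s) w -> 0 <= s -> right_derivative u s w.
Proof.
move=> Gw s0; apply: (cvg_to_value Gdiss HY Gsv Gw).
- move=> e e0; near=> d.
  have d0 : 0 < d by [].
  rewrite rnormZr gtr0_norm ?invr_gt0 // ler_pdivrMl //.
  have sd : s <= s + d by rewrite lerDl ltW.
  have := speed_le Gw s0 sd; rewrite addrAC subrr add0r => /le_trans; apply.
  by rewrite mulrC ler_pM2l // lerDl ltW.
- move=> h e h0 e0; set p := Y h (u s).
  pose c := rnorm p * M / h + 1.
  have c0 : 0 < c by rewrite ltr_wpDl // !mulr_ge0 ?rnorm_ge0 // invr_ge0 ltW.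
  have ec0 : 0 < e / c by rewrite divr_gt0.
  apply: filterS2 (nbhs_right_gt 0) (nbhs_right_lt ec0) => d d0.
  rewrite ltr_pdivlMr // => dc.
  by have := quotient_yosida s0 d0 h0; rewrite -/p; move: dc; rewrite /c; lra.
Unshelve. all: by end_near. Qed.

Lemma trajectory_values : exists w : R -> X, forall t, 0 <= t ->
  [/\ G (u t) (w t), rnorm (w t) <= M & right_derivative u t (w t)].
Proof.
have H t : exists w, 0 <= t -> G (u t) w /\ rnorm w <= M.
  have [t0|] := leP 0 t; last by exists 0.
  by have [w Gw wM] := limit_value t0; exists w.
have [w Hw] := choice H; exists w => t t0.
have [Gw wM] := Hw t t0; split => //.
exact: value_right_derivative.
Qed.

End Trajectory.

(** The regularity that the limit of the Euler scheme enjoys. In contrast with a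
    strong solution, the equation holds at every time, with right derivatives,
    so that energies can be differentiated without measure theory. *)
Definition trajectory (R : realType) (X : normedModType R[i]) (G : X -> X -> Prop)
    (M : R) (u w : R -> X) :=
  [/\ forall t, 0 <= t -> G (u t) (w t),
      forall t, 0 <= t -> rnorm (w t) <= M,
      forall s t, 0 <= s -> s <= t -> rnorm (u t - u s) <= M * (t - s) &
      forall t, 0 <= t -> right_derivative u t (w t)].

Lemma trajectory_exists (R : realType) (X : hilbertType R) (G : X -> X -> Prop)
    (Y : R -> X -> X) (x0 w0 : X) :
  dissipative G -> is_yosida G Y -> single_valued G -> G x0 w0 ->
  exists u w, u 0 = x0 /\ trajectory G (rnorm w0) u w.
Proof.
move=> Gdiss HY Gsv Gx0.
have [u [u0 uL ug]] := euler_limit Gdiss HY Gx0.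
have [w Hw] := trajectory_values Gdiss HY Gsv (rnorm_ge0 w0) uL ug.
by exists u, w; split => //; split => // t /Hw[].
Qed.

Lemma near_dnbhs0 (R : realType) (P : R -> Prop) :
  (\forall h \near 0^'+, P h) -> (\forall h \near 0^'+, P (- h)) ->
  \forall h \near 0^', P h.
Proof.
move=> /near_right0P[d1 d10 H1] /near_right0P[d2 d20 H2].
apply/nbhs_normP; exists (Num.min d1 d2) => /=; first by rewrite lt_min d10.
move=> h; rewrite /= sub0r normrN lt_min => /andP[h1 h2] h_neq0.
have [h0|h0] := ltP 0 h; first by apply: H1; rewrite h0 -(gtr0_norm h0).
have hlt0 : h < 0 by rewrite lt_neqAle h0 andbT.
by rewrite -[h]opprK; apply: H2; rewrite oppr_gt0 hlt0 -(ltr0_norm hlt0).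
Qed.

Section TrajectoryRegularity.
Context {R : realType} {X : hilbertType R}.

Lemma lipschitz_left_continuous (u : R -> X) M t :
  (forall s t : R, 0 <= s -> s <= t -> rnorm (u t - u s) <= M * (t - s)) ->
  0 < t -> u (t - h) @[h --> 0^'+] --> u t.
Proof.
move=> uL t0; apply/cvg_rnormP.
have H : M * h @[h --> 0^'+] --> M * (0 : R).
  by apply: cvgMr; exact: cvg_at_right_filter cvg_id.
rewrite mulr0 in H; apply: (squeeze_cvgr _ (cvg_cst 0) H).
near=> h.
have h0 : 0 < h by [].
have ht : h < t by [].
rewrite rnorm_ge0 /= rnormB (le_trans (uL _ _ _ _)) ?subr_ge0 ?(ltW ht) ?gerBl ?(ltW h0) //.
by rewrite subKr.
Unshelve. all: by end_near. Qed.

Lemma lipschitz_right_continuous (u : R -> X) M t :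
  (forall s t : R, 0 <= s -> s <= t -> rnorm (u t - u s) <= M * (t - s)) ->
  0 <= t -> u (t + h) @[h --> 0^'+] --> u t.
Proof.
move=> uL t0; apply/cvg_rnormP.
have H : M * h @[h --> 0^'+] --> M * (0 : R).
  by apply: cvgMr; exact: cvg_at_right_filter cvg_id.
rewrite mulr0 in H; apply: (squeeze_cvgr _ (cvg_cst 0) H).
near=> h.
have h0 : 0 < h by [].
rewrite rnorm_ge0 /= (le_trans (uL _ _ _ _)) ?lerDl ?(ltW h0) //.
by rewrite addrAC subrr add0r.
Unshelve. all: by end_near. Qed.

Variables (G : X -> X -> Prop) (Y : R -> X -> X).
Hypotheses (Gdiss : dissipative G) (HY : is_yosida G Y) (Gsv : single_valued G).

Lemma trajectory_contraction M1 M2 (u1 w1 u2 w2 : R -> X) (s t : R) :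
  trajectory G M1 u1 w1 -> trajectory G M2 u2 w2 -> 0 <= s -> s <= t ->
  rnorm (u1 t - u2 t) <= rnorm (u1 s - u2 s).
Proof.
move=> [G1 _ L1 d1] [G2 _ L2 d2] s0 st.
apply: (@rnorm_nonincreasing R X (fun t => u1 t - u2 t) (fun t => w1 t - w2 t)) => //.
- move=> v sv vt; have v0 : 0 < v by exact: le_lt_trans sv.
  by apply: cvgB; [exact: lipschitz_left_continuous L1 v0 |
    exact: lipschitz_left_continuous L2 v0].
- move=> v sv vt; have v0 := le_trans s0 sv.
  by apply: right_derivativeB; [exact: d1 | exact: d2].
- by move=> v sv vt; have v0 := le_trans s0 sv; apply: Gdiss; [exact: G1 | exact: G2].
Qed.

Lemma trajectory_shift M (u w : R -> X) (r : R) : 0 <= r -> trajectory G M u w ->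
  trajectory G M (fun t => u (t + r)) (fun t => w (t + r)).
Proof.
move=> r0 [Gu wM uL du]; split.
- by move=> t t0; apply: Gu; rewrite addr_ge0.
- by move=> t t0; apply: wM; rewrite addr_ge0.
- move=> s t s0 st; rewrite (le_trans (uL _ _ _ _)) ?addr_ge0 ?lerD2r //.
  by rewrite opprD addrACA subrr addr0.
- move=> t t0; rewrite /right_derivative.
  under eq_fun do rewrite addrAC.
  by apply: du; rewrite addr_ge0.
Qed.

Variables (M : R) (u w : R -> X).
Hypothesis traj : trajectory G M u w.

(** [u] and its translates are trajectories, which come closer to each other;
    so the difference quotients of [u] decrease in norm. *)
Lemma trajectory_speed_nonincreasing s t : 0 <= s -> s <= t -> rnorm (w t) <= rnorm (w s).
Proof.
move=> s0 st; have t0 := le_trans s0 st.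
have [Gu wM uL du] := traj.
apply: (ler_cvg_to (cvg_rnorm (du t t0)) (cvg_rnorm (du s s0))).
near=> h; have h0 : 0 < h by [].
rewrite !rnormZr ler_pM2l ?gtr0_norm ?invr_gt0 //.
have := trajectory_contraction (trajectory_shift (ltW h0) traj) traj s0 st.
by [].
Unshelve. all: by end_near. Qed.

(** Demiclosedness applies since the speed does not exceed its value at [t]. *)
Lemma trajectory_speed_right_continuous t : 0 <= t -> w (t + h) @[h --> 0^'+] --> w t.
Proof.
move=> t0; have [Gu wM uL du] := traj.
apply: (value_continuous Gdiss HY Gsv (Gu t t0)).
- near=> h; have h0 : 0 < h by [].
  by apply: Gu; rewrite addr_ge0 // ltW.
- exact: lipschitz_right_continuous uL t0.
- move=> e e0; near=> h; have h0 : 0 < h by [].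
  rewrite (le_trans (trajectory_speed_nonincreasing t0 _)) ?lerDl ?(ltW h0) ?(ltW e0) //.
Unshelve. all: by end_near. Qed.

(** The discontinuities from the left of the nonincreasing function [rnorm \o w]. *)
Let jump t := 0 < t /\ exists2 e : R, 0 < e &
  forall s, 0 <= s -> s < t -> rnorm (w t) + e <= rnorm (w s).

(** Where the speed has no jump, [w] is continuous from the left, and the mean
    value inequality gives the left derivative. *)
Let derivative_off_jump t : 0 < t -> ~ jump t -> has_derivative u t (w t).
Proof.
move=> t0 nojump; have [Gu wM uL du] := traj.
have w_left e : 0 < e -> \forall h \near 0^'+, rnorm (w (t - h)) <= rnorm (w t) + e.
  move=> e0; apply: contrapT => H; apply: nojump; split => //; exists e => // s s0 st.
  rewrite leNgt; apply/negP => ws; apply: H.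
  have ts0 : 0 < t - s by rewrite subr_gt0.
  apply: filterS2 (nbhs_right_gt 0) (nbhs_right_lt ts0) => h h0 hts.
  by rewrite (le_trans _ (ltW ws)) // trajectory_speed_nonincreasing //; lra.
have w_cvg : w (t - h) @[h --> 0^'+] --> w t.
  apply: (value_continuous Gdiss HY Gsv (Gu t (ltW t0)) _ _ w_left).
    near=> h; apply: Gu; rewrite subr_ge0.
    by have : h < t by []; exact: ltW.
  exact: lipschitz_left_continuous uL t0.
have left_quot : ((- h)^-1)%:C *: (u (t - h) - u t) @[h --> 0^'+] --> w t.
  apply/near_rnormP => e e0.
  have e20 : 0 < e / 2 by rewrite divr_gt0.
  have /near_rnormP/(_ _ e20)/near_right0P[d d0 Hd] := w_cvg.
  have d10 : 0 < Num.min d t by rewrite lt_min d0.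
  apply: filterS2 (nbhs_right_gt 0) (nbhs_right_lt d10) => h h0.
  rewrite lt_min => /andP[hd ht].
  have th : t - h <= t by rewrite gerBl ltW.
  have th0 : 0 <= t - h by rewrite subr_ge0 ltW.
  pose F v := u v - v%:C *: w t.
  have FD v : 0 <= v -> right_derivative F v (w v - w t).
    move=> v0; apply: right_derivativeB; first exact: du.
    rewrite /right_derivative.
    have H : (fun h : R => (h^-1)%:C *: ((v + h)%:C *: w t - v%:C *: w t))
        @ 0^'+ --> w t.
      apply/near_rnormP => r r0; near=> k; have k0 : 0 < k by [].
      have -> : (k^-1)%:C *: ((v + k)%:C *: w t - v%:C *: w t) = w t.
        by apply: ip_ext => z; rewrite !ipE; field; rewrite gt_eqF.
      by rewrite subrr rnorm0.
    exact: H.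
  have := @rnorm_mean_value R X F (fun v => w v - w t) (t - h) t (e / 2) th.
  rewrite subKr => H.
  have {H} : rnorm (F t - F (t - h)) <= e / 2 * h.
    apply: H.
    - move=> v v1 v2; have v0 : 0 < v by exact: le_lt_trans v1.
      apply: cvgB; first exact: lipschitz_left_continuous uL v0.
      apply/cvg_rnormP.
      have H : k * rnorm (w t) @[k --> 0^'+] --> (0 : R) * rnorm (w t).
        by apply: cvgMl; exact: cvg_at_right_filter cvg_id.
      rewrite mul0r in H; apply: (squeeze_cvgr _ (cvg_cst 0) H).
      near=> k; have k0 : 0 < k by [].
      have -> : (v - k)%:C *: w t - v%:C *: w t = - (k%:C *: w t).
        by apply: ip_ext => z; rewrite !ipE; ring.
      by rewrite rnorm_ge0 rnormN rnormZr gtr0_norm //=.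
    - by move=> v v1 v2; apply: FD; exact: le_trans v1.
    - move=> v v1 v2; rewrite ltW //.
      have := Hd (t - v); rewrite subKr; apply; lra.
  have -> : ((- h)^-1)%:C *: (u (t - h) - u t) - w t =
      (h^-1)%:C *: (F t - F (t - h)).
    by apply: ip_ext => z; rewrite /F !ipE; field; rewrite gt_eqF.
  rewrite rnormZr gtr0_norm ?invr_gt0 // => H.
  rewrite (@le_lt_trans _ _ (e / 2)) //; last by rewrite ltr_pdivrMr // ltr_pMr // ltr1n.
  by rewrite ler_pdivrMl // mulrC.
apply/near_rnormP => e e0; apply: near_dnbhs0.
  by move: (du t (ltW t0)) => /near_rnormP; apply.
by move: left_quot => /near_rnormP; apply.
Unshelve. all: by end_near. Qed.

(** Each jump contains a rational number, and distinct jumps are disjoint. *)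
Let jump_countable : countable jump.
Proof.
have jump_rat t : exists q : rat, jump t -> rnorm (w t) < ratr q /\
    forall s, 0 <= s -> s < t -> ratr q < rnorm (w s).
  have [[t0 [e e0 H]]|] := pselect (jump t); last by exists 0.
  have : rnorm (w t) < rnorm (w t) + e by rewrite ltrDl.
  move=> /rat_in_itvoo[q]; rewrite in_itv /= => /andP[q1 q2]; exists q => _.
  by split => // s s0 st; rewrite (lt_le_trans q2) // H.
have [f Hf] := choice jump_rat.
have jump_neq s t : jump s -> jump t -> s < t -> f s != f t.
  move=> js jt st; apply/eqP => fst.
  have [h1 _] := Hf s js; have [_ h2] := Hf t jt.
  have := h2 s (ltW js.1) st.
  by rewrite -fst ltNge (ltW h1).
apply/countable_injP; exists (pickle \o f) => s t /set_mem js /set_mem jt /=.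
move=> /(pcan_inj pickleK) fst; apply/eqP; rewrite eq_le !leNgt.
by apply/andP; split; apply/negP => st;
  [move: (jump_neq t s jt js st) | move: (jump_neq s t js jt st)]; rewrite fst eqxx.
Qed.

(** The speed [rnorm \o w] decreases, hence has countably many jumps, and [u]
    is differentiable wherever it does not jump. *)
Lemma trajectory_ae_derivative :
  {ae lebesgue_measure, forall t : R, 0 < t -> has_derivative u t (w t)}.
Proof.
exists jump; split.
- exact: countable_measurable.
- exact: countable_lebesgue_measure0.
- move=> t /=; apply: contra_notP => /derivative_off_jump H t0; exact: H.
Qed.

End TrajectoryRegularity.

(** * Simple functions with vector values *)

Section IntegralMonotone.
Local Open Scope ereal_scope.
Context d (T : measurableType d) (R : realType).
Variable mu : {measure set T -> \bar R}.

(** The integral of a nonnegative function is a supremum over the simple functions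
    below it, so that it is monotone even for functions that are not measurable. *)
Lemma integral_le_nonmeasurable (A D : set T) (f g : T -> \bar R) :
  A `<=` D -> (forall x, A x -> 0 <= f x) -> (forall x, D x -> 0 <= g x) ->
  (forall x, A x -> f x <= g x) ->
  \int[mu]_(x in A) f x <= \int[mu]_(x in D) g x.
Proof.
move=> AD f0 g0 fg; rewrite !ge0_integralE //.
apply: le_ereal_sup => _ [h /= hf <-]; exists h => //= x.
rewrite (le_trans (hf x)) // !patchE; case: ifPn => [/set_mem Ax|xA].
  by rewrite mem_set ?fg //; exact: AD.
by case: ifPn => // /set_mem; exact: g0.
Qed.

End IntegralMonotone.

Section SimpleLists.
Context {R : realType} {V : normedModType R[i]}.
Local Notation mu := (@lebesgue_measure R).
Implicit Types (s : seq (set R * V)) (D : set R).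

Lemma simple_eval_nil t : @simple_eval R V [::] t = 0.
Proof. by rewrite /simple_eval big_nil. Qed.

Lemma simple_eval_cons (p : set R * V) s t :
  simple_eval (p :: s) t = (\1_(p.1) t)%:C *: p.2 + simple_eval s t.
Proof. by rewrite /simple_eval big_cons. Qed.

Lemma simple_eval_cat s1 s2 t :
  simple_eval (s1 ++ s2) t = simple_eval s1 t + simple_eval s2 t.
Proof. by rewrite /simple_eval big_cat. Qed.

Lemma simple_list_cat s1 s2 :
  simple_list s1 -> simple_list s2 -> simple_list (s1 ++ s2).
Proof. by move=> h1 h2 p; rewrite mem_cat => /orP[/h1|/h2]. Qed.

Lemma simple_list_cons (p : set R * V) s :
  simple_list (p :: s) -> [/\ measurable p.1, (mu p.1 < +oo)%E & simple_list s].
Proof.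
move=> H; have [] := H p (mem_head _ _); split => // q qs.
by apply: H; rewrite in_cons qs orbT.
Qed.

Definition simple_opp s : seq (set R * V) := [seq (p.1, - p.2) | p <- s].

Lemma simple_list_opp s : simple_list s -> simple_list (simple_opp s).
Proof. by move=> H p /mapP[q qs ->]; exact: H qs. Qed.

Lemma simple_eval_opp s t : simple_eval (simple_opp s) t = - simple_eval s t.
Proof.
elim: s => [|p s IH]; first by rewrite simple_eval_nil oppr0.
by rewrite /= !simple_eval_cons IH opprD scalerN.
Qed.

Lemma simple_integral_cat D s1 s2 :
  simple_integral D (s1 ++ s2) = simple_integral D s1 + simple_integral D s2.
Proof. by rewrite /simple_integral big_cat. Qed.

Lemma simple_integral_opp D s : simple_integral D (simple_opp s) = - simple_integral D s.
Proof.
rewrite /simple_integral big_map -sumrN; apply: eq_bigr => p _.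
by rewrite scalerN.
Qed.

Lemma measurable_rnorm_simple (c : V) s : simple_list s ->
  measurable_fun setT (fun t => rnorm (c + simple_eval s t)).
Proof.
elim: s c => [|p s IH] c.
  move=> _; rewrite (_ : (fun t => _) = cst (rnorm c)); first exact: measurable_cst.
  by apply/funext => t; rewrite simple_eval_nil addr0.
move=> /simple_list_cons[mp _ hs].
rewrite (_ : (fun t => _) = fun t => \1_(p.1) t * rnorm (c + p.2 + simple_eval s t) +
    (1 - \1_(p.1) t) * rnorm (c + simple_eval s t)).
  apply: measurable_funD; apply: measurable_funM.
  - exact: measurable_indic.
  - exact: IH.
  - by apply: measurable_funB => //; exact: measurable_indic.
  - exact: IH.
apply/funext => t; rewrite simple_eval_cons indicE.
case: (t \in p.1); rewrite ?subrr ?subr0 ?mul0r ?mul1r ?addr0 ?add0r.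
  by rewrite scale1r addrA.
by rewrite scale0r add0r.
Qed.

Lemma mu_fin_num (E D : set R) : measurable E -> measurable D ->
  (mu D < +oo)%E -> mu (E `&` D) \is a fin_num.
Proof.
move=> mE mD D1; rewrite ge0_fin_numE //; apply: le_lt_trans D1.
by apply: le_measure => //; rewrite inE //; exact: measurableI.
Qed.

(** The triangle inequality, by splitting [D] along each set of the list; the
    constant [c] collects the vectors of the sets already met. *)
Lemma rnorm_simple_integral_le (c : V) s D : simple_list s -> measurable D ->
  (mu D < +oo)%E ->
  ((rnorm ((fine (mu D))%:C *: c + simple_integral D s))%:E <=
   \int[mu]_(t in D) (rnorm (c + simple_eval s t))%:E)%E.
Proof.
elim: s c D => [|p s IH] c D.
  move=> _ mD Dfin; rewrite /simple_integral big_nil addr0 rnormZr.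
  under eq_integral do rewrite simple_eval_nil addr0.
  rewrite integral_cst // ger0_norm ?fine_ge0 // mulrC EFinM fineK //.
  by rewrite ge0_fin_numE.
move=> Hps mD Dfin.
have [mp _ hs] := simple_list_cons Hps.
pose D1 := D `&` p.1; pose D2 := D `\` p.1.
have mD1 : measurable D1 by exact: measurableI.
have mD2 : measurable D2 by exact: measurableD.
have D1fin : (mu D1 < +oo)%E.
  by apply: le_lt_trans Dfin; apply: le_measure; rewrite ?inE //; exact: subIsetl.
have D2fin : (mu D2 < +oo)%E.
  by apply: le_lt_trans Dfin; apply: le_measure; rewrite ?inE //; exact: subDsetl.
have D12 : D = D1 `|` D2 by rewrite /D1 /D2 setUIDK.
have D120 : D1 `&` D2 = set0.
  by rewrite /D1 /D2; apply/seteqP; split => // t [[_ h] [_ h']].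
have fin_split E : measurable E -> fine (mu (E `&` D)) =
    fine (mu (E `&` D1)) + fine (mu (E `&` D2)).
  move=> mE; rewrite -fineD ?mu_fin_num //; congr fine.
  rewrite {1}D12 setIUr measureU //; [exact: measurableI|exact: measurableI|].
  by rewrite setIACA setIid D120 setI0.
have SI_split : simple_integral D s = simple_integral D1 s + simple_integral D2 s.
  rewrite /simple_integral -big_split /=; apply: eq_big_seq => q qs.
  have [mq _] := hs q qs.
  by rewrite fin_split // rmorphD scalerDl.
have -> : (fine (mu D))%:C *: c + simple_integral D (p :: s) =
    ((fine (mu D1))%:C *: (c + p.2) + simple_integral D1 s) +
    ((fine (mu D2))%:C *: c + simple_integral D2 s).
  rewrite {1}/simple_integral big_cons -/(simple_integral D s) SI_split.
  have -> : p.1 `&` D = D1 by rewrite setIC.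
  have -> : fine (mu D) = fine (mu D1) + fine (mu D2).
    by have := fin_split setT measurableT; rewrite !setTI.
  rewrite rmorphD /= scalerDl scalerDr !addrA; congr (_ + _).
  by do 2 rewrite (addrAC _ ((fine (mu D2))%:C *: c)).
rewrite [in leRHS]D12 ge0_integral_setU //; first last.
- by rewrite disj_set2E D120.
- by move=> t _; rewrite lee_fin rnorm_ge0.
- by apply/measurable_EFinP; apply: measurable_funTS; exact: measurable_rnorm_simple.
apply: (@le_trans _ _ ((rnorm ((fine (mu D1))%:C *: (c + p.2) + simple_integral D1 s))%:E +
  (rnorm ((fine (mu D2))%:C *: c + simple_integral D2 s))%:E)%E).
  by rewrite -EFinD lee_fin rnormD_le.
apply: leeD.
  apply: (le_trans (IH (c + p.2) D1 hs mD1 D1fin)).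
  rewrite le_eqVlt; apply/orP; left; apply/eqP; apply: eq_integral => t.
  rewrite inE => -[_ pt]; rewrite simple_eval_cons indicE mem_set //.
  by rewrite scale1r addrA.
apply: (le_trans (IH c D2 hs mD2 D2fin)).
rewrite le_eqVlt; apply/orP; left; apply/eqP; apply: eq_integral => t.
rewrite inE => -[_ pt]; rewrite simple_eval_cons indicE memNset //.
by rewrite scale0r add0r.
Qed.

End SimpleLists.

Section BochnerIncrement.
Context {R : realType} {V : normedModType R[i]}.
Local Notation mu := (@lebesgue_measure R).
Implicit Types (s : seq (set R * V)) (D : set R).

Lemma strongly_measurable_off_null D (f : R -> V) : strongly_measurable D f ->
  exists N (s : nat -> seq (set R * V)), [/\ measurable N, mu N = 0,
    forall n, simple_list (s n) &
    forall t, (D `\` N) t -> simple_eval (s n) t @[n --> \oo] --> f t].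
Proof.
move=> [s Hs [N [mN N0 HN]]]; exists N, s; split => // t [Dt Nt].
by apply: contrapT => H; apply: Nt; apply: HN => /(_ Dt).
Qed.

Lemma measurable_rnorm_simple_sub D (f : R -> V) (s : nat -> seq (set R * V)) s' :
  (forall n, simple_list (s n)) -> simple_list s' ->
  (forall t, D t -> simple_eval (s n) t @[n --> \oo] --> f t) ->
  measurable_fun D (fun t => rnorm (f t - simple_eval s' t)).
Proof.
move=> Hs Hs' sf.
apply: (@measurable_fun_cvg _ _ _ D
    (fun n t => rnorm (0 + simple_eval (s n ++ simple_opp s') t))).
  move=> n; apply: measurable_funTS; apply: measurable_rnorm_simple.
  by apply: simple_list_cat => //; exact: simple_list_opp.
move=> t Dt; under eq_fun do rewrite add0r simple_eval_cat simple_eval_opp.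
by apply: cvg_rnorm; apply: cvgB; [exact: sf | exact: cvg_cst].
Qed.

Lemma measurable_rnorm_lim D (f : R -> V) (s : nat -> seq (set R * V)) :
  (forall n, simple_list (s n)) ->
  (forall t, D t -> simple_eval (s n) t @[n --> \oo] --> f t) ->
  measurable_fun D (fun t => rnorm (f t)).
Proof.
move=> Hs sf; have := @measurable_rnorm_simple_sub D f s [::] Hs _ sf.
by under eq_fun do rewrite simple_eval_nil subr0; apply.
Qed.

Let cvg0_near (I : (\bar R)^nat) (e : R) : I n @[n --> \oo] --> 0%E -> 0 < e ->
  \forall n \near \oo, (I n <= e%:E)%E.
Proof.
move=> I0 e0; have e0' : (0 < e%:E)%E by rewrite lte_fin.
have [n0 _ H] := I0 _ (open_ereal_lt' e0').
by exists n0 => // n /H /= /ltW.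
Qed.

Let simple_integral_split D1 D2 s : simple_list s -> measurable D1 -> measurable D2 ->
  (mu D1 < +oo)%E -> D2 `<=` D1 ->
  simple_integral D1 s = simple_integral D2 s + simple_integral (D1 `\` D2) s.
Proof.
move=> Hs m1 m2 fin1 D21; rewrite /simple_integral -big_split /=.
apply: eq_big_seq => p ps; have [mp _] := Hs p ps.
have m12 : measurable (D1 `\` D2) by exact: measurableD.
have fin2 : (mu D2 < +oo)%E.
  by apply: le_lt_trans fin1; apply: le_measure; rewrite ?inE.
have fin12 : (mu (D1 `\` D2) < +oo)%E.
  by apply: le_lt_trans fin1; apply: le_measure; rewrite ?inE //; exact: subDsetl.
rewrite -scalerDl -rmorphD /= -fineD ?mu_fin_num //; congr ((fine _)%:C *: _).
rewrite -measureU //; [|exact: measurableI|exact: measurableI|].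
  by rewrite -setIUr setUC setDKU.
by apply/seteqP; split => // t [[_ h] [_ [_ /(_ h)]]].
Qed.

(** The simple functions that approximate [g] on [[0, s]] and on [[0, t]] may differ,
    so the difference of the two integrals splits into an error over [[0, s]]
    and an integral over the rest. Off the null set [N] the norm of [g] is
    measurable. *)
Lemma bochner_increment (g : R -> V) (tau s t : R) (N : set R)
    (a : nat -> seq (set R * V)) (v w : V) :
  0 <= s -> s <= t -> t <= tau -> measurable N -> mu N = 0 ->
  (forall n, simple_list (a n)) ->
  (forall x, (`]0, tau[ `\` N) x -> simple_eval (a n) x @[n --> \oo] --> g x) ->
  bochner_integral `]0, s[ g v -> bochner_integral `]0, t[ g w ->
  ((rnorm (w - v))%:E <=
   \int[mu]_(x in (`]0%R, t[ `\` `]0%R, s[) `\` N) (rnorm (g x))%:E)%E.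
Proof.
move=> s0 st ttau mN N0 Ha ag [_ [c [Hc cg cv]]] [_ [b [Hb bg bw]]].
set Ds := [set` `]0, s[]; set Dt := [set` `]0, t[].
have mDs : measurable Ds by exact: measurable_itv.
have mDt : measurable Dt by exact: measurable_itv.
have Dst : Ds `<=` Dt.
  by move=> x; rewrite /Ds /Dt /= !in_itv /= => /andP[-> /lt_le_trans ->].
have finDt : (mu Dt < +oo)%E.
  by rewrite lebesgue_measure_itv /=; case: ifP => // _; rewrite ltry.
have finDs : (mu Ds < +oo)%E.
  by apply: le_lt_trans finDt; apply: le_measure; rewrite ?inE.
pose A := Dt `\` Ds.
have mA : measurable A by exact: measurableD.
have finA : (mu A < +oo)%E.
  by apply: le_lt_trans finDt; apply: le_measure; rewrite ?inE //; exact: subDsetl.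
have Dtau x : Dt x -> `]0, tau[%classic x.
  by rewrite /Dt /= !in_itv /= => /andP[-> /lt_le_trans ->].
have off x : (Dt `\` N) x -> simple_eval (a n) x @[n --> \oo] --> g x.
  by move=> [Dx Nx]; apply: ag; split => //; exact: Dtau.
have mDN D : measurable D -> measurable (D `\` N) by move=> mD; exact: measurableD.
have mg D : D `<=` Dt -> measurable_fun (D `\` N) (fun x => (rnorm (g x))%:E).
  move=> DD; apply/measurable_EFinP; apply: measurable_rnorm_lim Ha _ => x [Dx Nx].
  by apply: off; split => //; exact: DD.
have mgs D s' : simple_list s' -> D `<=` Dt ->
    measurable_fun (D `\` N) (fun x => (rnorm (g x - simple_eval s' x))%:E).
  move=> Hs' DD; apply/measurable_EFinP.
  apply: measurable_rnorm_simple_sub Ha Hs' _ => x [Dx Nx].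
  by apply: off; split => //; exact: DD.
have ADt : A `<=` Dt by exact: subDsetl.
apply/lee_addgt0Pr => e e0.
have e4 : 0 < e / 4 by rewrite divr_gt0.
have : \forall n \near \oo, rnorm (w - v -
    (simple_integral Dt (b n) - simple_integral Ds (c n))) < e / 4.
  have : simple_integral Dt (b n) - simple_integral Ds (c n) @[n --> \oo] --> w - v.
    exact: cvgB.
  by move=> /near_rnormP/(_ _ e4); apply: filterS => n; rewrite rnormB.
move=> near_w; have [n [cn bn wn]] : exists n,
    [/\ (\int[mu]_(x in Ds) (rnorm (g x - simple_eval (c n) x))%:E <= (e / 4)%:E)%E,
        (\int[mu]_(x in Dt) (rnorm (g x - simple_eval (b n) x))%:E <= (e / 4)%:E)%E &
        rnorm (w - v - (simple_integral Dt (b n) - simple_integral Ds (c n))) < e / 4].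
  apply: (filter_ex (F := \oo)).
  by apply: filterS3 (cvg0_near cg e4) (cvg0_near bg e4) near_w => n ? ? ?; split.
have SI : simple_integral Dt (b n) - simple_integral Ds (c n) =
    simple_integral Ds (b n ++ simple_opp (c n)) + simple_integral A (b n).
  rewrite simple_integral_cat simple_integral_opp (simple_integral_split _ mDt mDs) //.
  by rewrite addrAC.
have Hbc : simple_list (b n ++ simple_opp (c n)).
  by apply: simple_list_cat => //; exact: simple_list_opp.
have le1 : ((rnorm (simple_integral Ds (b n ++ simple_opp (c n))))%:E <=
    (e / 4)%:E + (e / 4)%:E)%E.
  have := rnorm_simple_integral_le 0 Hbc mDs finDs.
  rewrite scaler0 add0r => /le_trans; apply.
  rewrite (@ge0_negligible_integral _ _ R mu _ N) //; first last.
  - by move=> x _; rewrite lee_fin rnorm_ge0.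
  - by apply/measurable_EFinP; apply: measurable_funTS; exact: measurable_rnorm_simple.
  apply: (@le_trans _ _ (\int[mu]_(x in Ds `\` N)
      ((rnorm (g x - simple_eval (c n) x))%:E + (rnorm (g x - simple_eval (b n) x))%:E))%E).
    apply: integral_le_nonmeasurable => // x _; rewrite ?lee_fin ?rnorm_ge0 //.
      by rewrite addr_ge0 // rnorm_ge0.
    rewrite add0r simple_eval_cat simple_eval_opp [leRHS]addrC.
    by rewrite (rnormB (g x) (simple_eval (b n) x)) rnorm_tri.
  rewrite ge0_integralD //; first last.
  - exact: mgs.
  - by move=> x _; rewrite lee_fin rnorm_ge0.
  - exact: mgs.
  - by move=> x _; rewrite lee_fin rnorm_ge0.
  - exact: mDN.
  apply: leeD.
    apply: le_trans cn; apply: integral_le_nonmeasurable => // x; rewrite ?lee_fin ?rnorm_ge0 //.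
  apply: le_trans bn; apply: integral_le_nonmeasurable => // x; rewrite ?lee_fin ?rnorm_ge0 //.
  by case=> /Dst.
have le2 : ((rnorm (simple_integral A (b n)))%:E <=
    \int[mu]_(x in A `\` N) (rnorm (g x))%:E + (e / 4)%:E)%E.
  have := rnorm_simple_integral_le 0 (Hb n) mA finA.
  rewrite scaler0 add0r => /le_trans; apply.
  rewrite (@ge0_negligible_integral _ _ R mu _ N) //; first last.
  - by move=> x _; rewrite lee_fin rnorm_ge0.
  - by apply/measurable_EFinP; apply: measurable_funTS; exact: measurable_rnorm_simple.
  apply: (@le_trans _ _ (\int[mu]_(x in A `\` N)
      ((rnorm (g x))%:E + (rnorm (g x - simple_eval (b n) x))%:E))%E).
    apply: integral_le_nonmeasurable => // x _; rewrite ?lee_fin ?rnorm_ge0 //.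
      by rewrite addr_ge0 // rnorm_ge0.
    rewrite add0r -[simple_eval (b n) x](subKr (g x)).
    by rewrite (le_trans (rnormB_le _ _)) // subKr.
  rewrite ge0_integralD //; first last.
  - exact: mgs.
  - by move=> x _; rewrite lee_fin rnorm_ge0.
  - exact: mg.
  - by move=> x _; rewrite lee_fin rnorm_ge0.
  - exact: mDN.
  apply: leeD => //.
  apply: le_trans bn; apply: integral_le_nonmeasurable => // x; rewrite ?lee_fin ?rnorm_ge0 //.
  by case=> /ADt.
apply: (@le_trans _ _ ((e / 4)%:E + ((e / 4)%:E + (e / 4)%:E) +
   (\int[mu]_(x in A `\` N) (rnorm (g x))%:E + (e / 4)%:E))%E).
  apply: (@le_trans _ _ ((e / 4)%:E +
     (rnorm (simple_integral Ds (b n ++ simple_opp (c n))))%:E +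
     (rnorm (simple_integral A (b n)))%:E)%E); last first.
    by apply: leeD => //; exact: leeD.
  rewrite -!EFinD lee_fin.
  have := rnormD_le (simple_integral Ds (b n ++ simple_opp (c n))) (simple_integral A (b n)).
  rewrite -SI; have := rnorm_tri (simple_integral Dt (b n) - simple_integral Ds (c n)) (w - v) 0.
  rewrite !subr0; move: wn; lra.
rewrite -!EFinD addeCA -EFinD leeD2l // lee_fin; lra.
Qed.

(** All that the uniqueness argument retains from membership in [H1]: the
    increments of [f] are dominated by the integrals of a square integrable
    function, with no vector valued integral left. *)
Lemma H1_increment (tau : R) (f : R -> V) : 0 < tau -> H1 tau f ->
  exists k : R -> R, [/\ measurable_fun setT k, forall t, 0 <= k t,
    (\int[mu]_t (k t ^+ 2)%:E < +oo)%E &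
    forall s t : R, 0 <= s -> s <= t -> t <= tau ->
      ((rnorm (f t - f s))%:E <= \int[mu]_(x in `[s%R, t%R[) (k x)%:E)%E].
Proof.
move=> tau0 [g [gmeas gL2] gint].
have [N [a [mN N0 Ha ag]]] := strongly_measurable_off_null gmeas.
set D0 := [set` `]0, tau[] in gL2 ag gmeas.
have mD0 : measurable D0 by exact: measurable_itv.
pose D := D0 `\` N.
have mD : measurable D by exact: measurableD.
pose k := (fun t => rnorm (g t)) \_ D.
have kD t : D t -> k t = rnorm (g t) by move=> Dt; rewrite /k patchE mem_set.
have kN t : ~ D t -> k t = 0 by move=> Dt; rewrite /k patchE memNset.
have k0 t : 0 <= k t.
  by have [Dt|Dt] := pselect (D t); [rewrite kD // rnorm_ge0 | rewrite kN].
exists k; split => //.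
- have mg : measurable_fun D (fun t => rnorm (g t)) by exact: (measurable_rnorm_lim Ha ag).
  by have [h _] := measurable_restrictT (fun t => rnorm (g t)) mD; exact: h.
- rewrite (_ : (fun t => (k t ^+ 2)%:E) = (fun t => (rnorm (g t) ^+ 2)%:E) \_ D); last first.
    apply/funext => t; rewrite [RHS]patchE; case: ifPn => [/set_mem Dt|].
      by rewrite kD.
    by move=> /negP Dt; rewrite kN ?expr0n // => /mem_set.
  rewrite -integral_mkcond; apply: le_lt_trans gL2.
  apply: integral_le_nonmeasurable => // x; rewrite ?lee_fin ?sqr_ge0 //.
  by case.
- move=> s t s0 st ttau; have t0 := le_trans s0 st.
  have in_tau (r : R) : 0 <= r -> r <= tau -> r \in `[0, tau] by rewrite in_itv /= => -> ->.
  have := @bochner_increment g tau s t N a _ _ s0 st ttau mN N0 Ha ag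
    (gint s (in_tau _ s0 (le_trans st ttau))) (gint t (in_tau _ t0 ttau)).
  have -> : f t - f 0 - (f s - f 0) = f t - f s by rewrite opprB subrKA.
  move=> /le_trans; apply.
  apply: integral_le_nonmeasurable.
  + move=> x [[]]; rewrite /= !in_itv /= => /andP[x0 xt] /negP; rewrite x0 /= -leNgt.
    by rewrite xt andbT.
  + by move=> x _; rewrite lee_fin rnorm_ge0.
  + by move=> x _; rewrite lee_fin.
  + move=> x [[]]; rewrite /= !in_itv /= => /andP[x0 xt] _ Nx; rewrite kD //.
    by split => //; rewrite /D0 /= in_itv /= x0 (lt_le_trans xt).
Qed.

End BochnerIncrement.

(** * Uniqueness of strong solutions *)

Section SquareIntegrable.
Context {R : realType}.
Local Notation mu := (@lebesgue_measure R).

(** The inequality [k <= n k ^+ 2 + n^-1] is used instead of Cauchy-Schwarz. *)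
Lemma integral_le_sqr (k : R -> R) (A : set R) (n : R) :
  measurable_fun setT k -> (forall t, 0 <= k t) -> measurable A -> 0 < n ->
  (\int[mu]_(x in A) (k x)%:E <=
   n%:E * \int[mu]_x (k x ^+ 2)%:E + (n^-1)%:E * mu A)%E.
Proof.
move=> mk k0 mA n0.
have mk2 : measurable_fun setT (fun x => (k x ^+ 2)%:E).
  by apply/measurable_EFinP; exact: measurable_funX.
apply: (@le_trans _ _ (\int[mu]_(x in A) ((n * k x ^+ 2)%:E + (n^-1)%:E))%E).
  apply: integral_le_nonmeasurable => // x _; rewrite ?lee_fin //.
    by rewrite addr_ge0 ?mulr_ge0 ?sqr_ge0 ?invr_ge0 // ltW.
  have := sqr_ge0 (n * k x - 1); rewrite -(ler_pM2l n0).
  have -> : n * (n * k x ^+ 2 + n^-1) = (n * k x) ^+ 2 + 1.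
    by field; rewrite gt_eqF.
  have := k0 x; rewrite -(pmulr_rge0 _ n0); nra.
rewrite ge0_integralD //; first last.
- by move=> x _; rewrite lee_fin invr_ge0 ltW.
- by apply/measurable_EFinP; apply: measurable_funTS; apply: measurable_funM => //;
    exact: measurable_funX.
- by move=> x _; rewrite lee_fin mulr_ge0 ?sqr_ge0 // ltW.
rewrite integral_cst // leeD2r //.
under eq_integral do rewrite EFinM.
rewrite ge0_integralZl_EFin ?(ltW n0) //; last 2 first.
- by move=> x _; rewrite lee_fin sqr_ge0.
- exact: measurable_funTS.
rewrite lee_pmul2l ?lte_fin //.
by apply: integral_le_nonmeasurable => // x _; rewrite lee_fin sqr_ge0.
Qed.

(** Absolute continuity of the integral, by a suitable choice of [n]. *)
Lemma integral_small (k : R -> R) : measurable_fun setT k -> (forall t, 0 <= k t) ->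
  (\int[mu]_x (k x ^+ 2)%:E < +oo)%E -> forall e : R, 0 < e ->
  exists2 d : R, 0 < d & forall A, measurable A -> (mu A <= d%:E)%E ->
    (\int[mu]_(x in A) (k x)%:E <= e%:E)%E.
Proof.
move=> mk k0 fin e e0.
set Q := (\int[mu]_x (k x ^+ 2)%:E)%E in fin *.
have Q0 : (0 <= Q)%E by apply: integral_ge0 => x _; rewrite lee_fin sqr_ge0.
have QE : Q = (fine Q)%:E by rewrite fineK // ge0_fin_numE.
have q0 : 0 <= fine Q by rewrite fine_ge0.
pose n := e / (2 * (fine Q + 1)).
have q1 : 0 < fine Q + 1 by rewrite ltr_wpDl.
have n0 : 0 < n by rewrite divr_gt0 // mulr_gt0.
exists (n * e / 2); first by rewrite divr_gt0 // mulr_gt0.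
move=> A mA Ad; rewrite (le_trans (integral_le_sqr mk k0 mA n0)) //.
rewrite -/Q QE; apply: (@le_trans _ _ ((n * fine Q)%:E + (n^-1)%:E * (n * e / 2)%:E)%E).
  by rewrite -EFinM leeD2l // lee_pmul2l // lte_fin invr_gt0.
rewrite -EFinM -EFinD lee_fin.
have -> : n^-1 * (n * e / 2) = e / 2 by field; rewrite gt_eqF.
have -> : n * fine Q = e / 2 * (fine Q / (fine Q + 1)).
  by rewrite /n; field; rewrite gt_eqF.
have : fine Q / (fine Q + 1) <= 1 by rewrite ler_pdivrMr // mul1r lerDl.
nra.
Qed.

Lemma integral_itv_finite (k : R -> R) (a b : R) (A : set R) : measurable_fun setT k ->
  (forall t, 0 <= k t) -> (\int[mu]_x (k x ^+ 2)%:E < +oo)%E ->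
  A `<=` `[a, b[%classic -> (\int[mu]_(x in A) (k x)%:E)%E \is a fin_num.
Proof.
move=> mk k0 fin Aab.
rewrite ge0_fin_numE; last by apply: integral_ge0 => x _; rewrite lee_fin.
apply: (@le_lt_trans _ _ (\int[mu]_(x in `[a, b[%classic) (k x)%:E)%E).
  by apply: integral_le_nonmeasurable => // x _; rewrite lee_fin.
apply: (le_lt_trans (integral_le_sqr mk k0 _ ltr01)) => //.
rewrite mul1e invr1 mul1e lte_add_pinfty // lebesgue_measure_itv /=.
by case: ifP => // _; rewrite ltry.
Qed.

End SquareIntegrable.

(** Subtracting [P] reduces the claim to [dini_nonincreasing]; [P] absorbs the
    growth of [F] at the exceptional times of an almost everywhere statement. *)
Lemma dini_nonincreasing_up_to (R : realType) (F : R -> R) (tau : R) : 0 <= tau ->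
  (forall t, 0 < t -> t <= tau -> forall e, 0 < e ->
     \forall h \near 0^'+, F t <= F (t - h) + e) ->
  (forall r, 0 < r -> exists P : R -> R, [/\
     forall s t, 0 <= s -> s <= t -> t <= tau -> P s <= P t,
     P tau - P 0 <= r &
     forall t, 0 <= t -> t < tau -> forall e, 0 < e ->
       \forall h \near 0^'+, F (t + h) <= F t + e * h + (P (t + h) - P t)]) ->
  F tau <= F 0.
Proof.
move=> tau0 Fleft H; apply/ler_addgt0Pr => r r0.
have [P [Pmono Pr PF]] := H r r0.
suff: F tau - P tau <= F 0 - P 0 by lra.
apply: (@dini_nonincreasing R (fun t => F t - P t) 0 tau tau0).
- move=> t t0 ttau e e0.
  apply: filterS3 (nbhs_right_gt 0) (nbhs_right_lt t0) (Fleft t t0 ttau e e0) => h h0 ht Ft.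
  have := Pmono (t - h) t; rewrite subr_ge0 (ltW ht) gerBl (ltW h0).
  by move=> /(_ isT isT ttau); lra.
- move=> t t0 ttau e e0.
  by apply: filterS (PF t t0 ttau e e0) => h; lra.
Qed.

Lemma has_derivative_right (R : realType) (X : normedModType R[i]) (f : R -> X)
    (t : R) (w : X) : has_derivative f t w -> right_derivative f t w.
Proof.
move=> /near_rnormP H; apply/near_rnormP => e /H [d /= d0 Hd].
by exists d => //= h hd h0; apply: Hd => //; rewrite gt_eqF.
Qed.

Section StrongContraction.
Context {R : realType} {X : hilbertType R}.
Local Notation mu := (@lebesgue_measure R).

(** The derivative of [rnorm (x1 - x2) ^+ 2] is nonpositive off a null set [E];
    over an open neighbourhood of [E] of small measure the increments are small by
    absolute continuity. *)
Lemma strong_solution_contraction (G : X -> X -> Prop) (x1 x2 : R -> X) (tau : R) :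
  dissipative G -> strong_solution G x1 -> strong_solution G x2 -> 0 <= tau ->
  rnorm (x1 tau - x2 tau) <= rnorm (x1 0 - x2 0).
Proof.
move=> Gdiss [H1x1 _ D1] [H1x2 _ D2]; rewrite le_eqVlt => /orP[/eqP<-//|tau0].
have [k1 [mk1 k10 fin1 inc1]] := H1_increment tau0 (H1x1 tau tau0).
have [k2 [mk2 k20 fin2 inc2]] := H1_increment tau0 (H1x2 tau tau0).
have [E1 [mE1 E10 HE1]] := D1; have [E2 [mE2 E20 HE2]] := D2.
pose K t := k1 t + k2 t.
have mK : measurable_fun setT K by exact: measurable_funD.
have K0 t : 0 <= K t by rewrite addr_ge0.
have IK (A : set R) : measurable A -> (\int[mu]_(x in A) (K x)%:E =
    \int[mu]_(x in A) (k1 x)%:E + \int[mu]_(x in A) (k2 x)%:E)%E.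
  move=> mA; under eq_integral do rewrite EFinD.
  rewrite ge0_integralD //.
  - by move=> x _; rewrite lee_fin.
  - by apply/measurable_EFinP; exact: measurable_funTS.
  - by move=> x _; rewrite lee_fin.
  - by apply/measurable_EFinP; exact: measurable_funTS.
pose J (A : set R) := fine (\int[mu]_(x in A) (K x)%:E)%E.
have mJ (a b : R) : measurable (`[a, b[%classic : set R) by exact: measurable_itv.
have finK (A : set R) (a b : R) : measurable A -> A `<=` `[a, b[%classic ->
    (\int[mu]_(x in A) (K x)%:E)%E \is a fin_num.
  move=> mA Aab; rewrite IK // fin_numD.
  by rewrite (integral_itv_finite mk1 k10 fin1 Aab) (integral_itv_finite mk2 k20 fin2 Aab).
have J0 (A : set R) : 0 <= J A by apply: fine_ge0; apply: integral_ge0 => x _; rewrite lee_fin.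
have Jle (A B : set R) (a b : R) : measurable A -> measurable B -> A `<=` B -> B `<=` `[a, b[%classic ->
    J A <= J B.
  move=> mA mB AB Bab; apply: fine_le; [|exact: finK Bab|].
    by apply: finK mA _; exact: subset_trans AB Bab.
  by apply: integral_le_nonmeasurable => // x _; rewrite lee_fin.
have JU (A B : set R) (a b : R) : measurable A -> measurable B -> A `<=` `[a, b[%classic ->
    B `<=` `[a, b[%classic -> A `&` B = set0 -> J (A `|` B) = J A + J B.
  move=> mA mB Aab Bab AB0; rewrite /J ge0_integral_setU //.
  - by rewrite fineD //; [exact: finK Aab | exact: finK Bab].
  - by apply/measurable_EFinP; exact: measurable_funTS.
  - by move=> x _; rewrite lee_fin.
  - by rewrite disj_set2E AB0.
have Jsmall r : 0 < r -> exists2 d : R, 0 < d & forall (A : set R) (a b : R), measurable A ->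
    A `<=` `[a, b[%classic -> (mu A <= d%:E)%E -> J A <= r.
  move=> r0; have r20 : 0 < r / 2 by rewrite divr_gt0.
  have [d1 d10 Hd1] := integral_small mk1 k10 fin1 r20.
  have [d2 d20 Hd2] := integral_small mk2 k20 fin2 r20.
  exists (Num.min d1 d2); first by rewrite lt_min d10.
  move=> A a b mA Aab Ad.
  rewrite -lee_fin /J fineK; last exact: finK Aab.
  rewrite IK // (splitr r) EFinD; apply: leeD.
    by apply: Hd1 => //; apply: le_trans Ad _; rewrite lee_fin ge_min lexx.
  by apply: Hd2 => //; apply: le_trans Ad _; rewrite lee_fin ge_min lexx orbT.
pose e (t : R) := x1 t - x2 t.
have einc (s t : R) : 0 <= s -> s <= t -> t <= tau -> rnorm (e t - e s) <= J `[s, t[%classic.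
  move=> s0 st ttau; rewrite -lee_fin /J fineK; last first.
    exact: (finK _ s t (mJ s t)).
  rewrite IK //; apply: (@le_trans _ _ ((rnorm (x1 t - x1 s))%:E + (rnorm (x2 t - x2 s))%:E)%E).
    rewrite -EFinD lee_fin.
    have -> : e t - e s = (x1 t - x1 s) - (x2 t - x2 s).
      by apply: ip_ext => z; rewrite /e !ipE; ring.
    exact: rnormB_le.
  by apply: leeD; [exact: inc1 | exact: inc2].
pose B := rnorm (e 0) + J `[0, tau[%classic.
have B0 : 0 <= B by rewrite addr_ge0 ?rnorm_ge0.
have eB (t : R) : 0 <= t -> t <= tau -> rnorm (e t) <= B.
  move=> t0 ttau; have := einc 0 t (lexx _) t0 ttau.
  have := rnorm_tri (e 0) (e t) 0; rewrite !subr0 /B.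
  have : J `[0, t[%classic <= J `[0, tau[%classic.
    apply: (Jle _ _ 0 tau) => //.
    by move=> x /=; rewrite !in_itv /= => /andP[-> /lt_le_trans->].
  lra.
pose F t := rnorm (e t) ^+ 2.
have Finc (s t : R) : 0 <= s -> s <= t -> t <= tau -> F t <= F s + 2 * B * J `[s, t[%classic.
  move=> s0 st ttau; have H := einc s t s0 st ttau.
  have h1 := eB t (le_trans s0 st) ttau; have h2 := eB s s0 (le_trans st ttau).
  have h3 := rnorm_dist (e t) (e s); rewrite ler_norml in h3.
  have /andP[_ h4] := h3.
  have h5 := rnorm_ge0 (e t); have h6 := rnorm_ge0 (e s).
  have h7 := J0 `[s, t[%classic.
  rewrite /F -lerBlDl subr_sqr.
  have : rnorm (e t) - rnorm (e s) <= J `[s, t[%classic by lra.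
  nra.
rewrite -/(e tau) -/(e 0) -(@ler_sqr _) ?nnegrE ?rnorm_ge0 //.
rewrite -/(F tau) -/(F 0); apply: dini_nonincreasing_up_to; first exact: ltW.
- move=> t t0 ttau r r0.
  have r1 : 0 < r / (2 * B + 1) by rewrite divr_gt0 // ltr_wpDl // mulr_ge0.
  have [d d0 Hd] := Jsmall _ r1.
  apply: filterS3 (nbhs_right_gt 0) (nbhs_right_lt t0) (nbhs_right_lt d0) => h h0 ht hd.
  have th0 : 0 <= t - h by rewrite subr_ge0 ltW.
  have th : t - h <= t by rewrite gerBl ltW.
  rewrite (le_trans (Finc _ _ th0 th ttau)) // lerD2l.
  have : J `[t - h, t[%classic <= r / (2 * B + 1).
    apply: (Hd _ (t - h) t) => //.
    rewrite lebesgue_measure_itv /= lte_fin ltrBlDr ltrDl h0 -EFinB lee_fin subKr.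
    exact: ltW.
  rewrite ler_pdivlMr; last by rewrite ltr_wpDl // mulr_ge0.
  have := J0 `[t - h, t[%classic; lra.
- move=> r r0.
  have r1 : 0 < r / (2 * B + 1) by rewrite divr_gt0 // ltr_wpDl // mulr_ge0.
  have [d d0 Hd] := Jsmall _ r1.
  pose E := E1 `|` E2 `|` [set 0].
  have mE : measurable E by apply: measurableU => //; exact: measurableU.
  have E0 : mu E = 0.
    rewrite null_set_setU //; [exact: measurableU | exact: null_set_setU |].
    exact: lebesgue_measure_set1.
  have finE : (mu E < +oo)%E by rewrite E0 ltry.
  have [W [oW EW WE]] := lebesgue_regularity_outer mE finE d0.
  have mW : measurable W by exact: open_measurable.
  have Wd : (mu W <= d%:E)%E.
    have : (mu ((W `\` E) `|` E) <= mu (W `\` E) + mu E)%E.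
      by apply: measureU2 => //; exact: measurableD.
    by rewrite setDKU // => /le_trans; apply; rewrite E0 adde0 ltW.
  pose P t := 2 * B * J (W `&` `[0, t[%classic).
  have mWt t : measurable (W `&` `[0, t[%classic) by exact: measurableI.
  have PJ (s t : R) : 0 <= s -> s <= t ->
      P t = P s + 2 * B * J (W `&` `[s, t[%classic).
    move=> s0 st; rewrite /P -mulrDr -(JU _ _ 0 t) //.
    + congr (_ * J _); rewrite -setIUr; congr (_ `&` _).
      apply/seteqP; split => x /=; rewrite !in_itv /=.
        by move=> /andP[x0 xt]; case: (ltP x s) => xs; [left|right]; rewrite ?x0 ?xt.
      by move=> [/andP[-> /lt_le_trans ->//]|/andP[sx ->]]; rewrite (le_trans s0).
    + exact: measurableI.
    + by move=> x [_] /=; rewrite !in_itv /= => /andP[-> /lt_le_trans->].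
    + by move=> x [_] /=; rewrite !in_itv /= => /andP[sx ->]; rewrite (le_trans s0).
    + apply/seteqP; split => // x [[_] + [_]] /=; rewrite !in_itv /=.
      by move=> /andP[_ xs] /andP[sx _]; move: (le_lt_trans sx xs); rewrite ltxx.
  exists P; split.
  + move=> s t s0 st ttau; rewrite (PJ s t) // lerDl !mulr_ge0 //.
  + have -> : P 0 = 0.
      rewrite /P (_ : W `&` _ = set0) /J ?integral_set0 ?mulr0 //.
      apply/seteqP; split => // x [_] /=; rewrite in_itv /= => /andP[x0 x0'].
      by move: (le_lt_trans x0 x0'); rewrite ltxx.
    rewrite subr0 /P.
    have : J (W `&` `[0, tau[%classic) <= r / (2 * B + 1).
      apply: (Hd _ 0 tau) => //; apply: le_trans Wd.
      by apply: le_measure; [rewrite inE; exact: mWt | rewrite inE | exact: subIsetl].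
    rewrite ler_pdivlMr; last by rewrite ltr_wpDl // mulr_ge0.
    by have := J0 (W `&` `[0, tau[%classic); lra.
  + move=> t t0 ttau q q0.
    have [Et|nEt] := pselect (E t).
      have /nbhs_normP[s /= s0 Hs] : nbhs t W.
        by apply: open_nbhs_nbhs; split => //; exact: EW.
      have tt0 : 0 < tau - t by rewrite subr_gt0.
      apply: filterS3 (nbhs_right_gt 0) (nbhs_right_lt s0) (nbhs_right_lt tt0) => h h0 hs ht.
      have tht : t <= t + h by rewrite lerDl ltW.
      have htau : t + h <= tau by lra.
      rewrite (PJ t (t + h)) // [P t + _]addrC addrK.
      rewrite (le_trans (Finc t (t + h) t0 tht htau)) // (setIidr _); last first.
        move=> x /=; rewrite in_itv /= => /andP[tx xt]; apply: Hs => /=.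
        by rewrite ler0_norm ?subr_le0 // opprB; lra.
      by rewrite lerD2r lerDl mulr_ge0 ?ltW.
    have [nE1 [nE2 tn0]] : ~ E1 t /\ ~ E2 t /\ t <> 0.
      by split; [|split]; move=> h; apply: nEt; [left; left|left; right|right].
    have t_gt0 : 0 < t by rewrite lt_neqAle t0 andbT eq_sym; apply/eqP.
    have [w1 Gw1 d1] : exists2 w, G (x1 t) w & has_derivative x1 t w.
      by apply: contrapT => H; apply: nE1; apply: HE1 => /(_ t_gt0).
    have [w2 Gw2 d2] : exists2 w, G (x2 t) w & has_derivative x2 t w.
      by apply: contrapT => H; apply: nE2; apply: HE2 => /(_ t_gt0).
    have de := right_derivativeB (has_derivative_right d1) (has_derivative_right d2).
    have w0 : 2 * ip (w1 - w2) (x1 t - x2 t) <= 0.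
      by rewrite pmulr_rle0 //; exact: Gdiss.
    have tt0 : 0 < tau - t by rewrite subr_gt0.
    apply: filterS3 (nbhs_right_gt 0) (nbhs_right_lt tt0) (dini_sqr_rnorm de w0 q0).
    move=> h h0 ht; rewrite add0r => Fh.
    have tht : t <= t + h by rewrite lerDl ltW.
    rewrite (PJ t (t + h)) // [P t + _]addrC addrK (le_trans Fh) // lerDl.
    by rewrite !mulr_ge0.
Qed.

End StrongContraction.

(** * Trajectories are strong solutions *)

Section Grid.
Context {R : realType} {V : normedModType R[i]}.
Local Notation mu := (@lebesgue_measure R).

Definition grid (h : R) (m : nat) (v : nat -> V) : seq (set R * V) :=
  [seq ([set` `[(k%:R * h : R), (k.+1%:R * h : R)[], v k) | k <- iota 0 m].

Lemma simple_list_grid h m v : simple_list (grid h m v).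
Proof.
move=> p /mapP[k _ ->] /=; split; first exact: measurable_itv.
by rewrite lebesgue_measure_itv /=; case: ifP => // _; rewrite ltry.
Qed.

Lemma grid_eval h m v t : 0 < h -> 0 <= t -> t < m%:R * h ->
  simple_eval (grid h m v) t = v (Num.truncn (t / h)).
Proof.
move=> h0 t0 tm; have th0 : 0 <= t / h by rewrite divr_ge0 // ltW.
set k0 := Num.truncn (t / h).
have k0E k : (k == k0) = (t \in `[(k%:R * h), (k.+1%:R * h)[).
  by rewrite eq_sym truncn_eq // in_itv /= ler_pdivlMr // ltr_pdivrMr.
have k0m : k0 \in iota 0 m.
  rewrite mem_iota /= add0n /k0 truncn_lt_nat // ltr_pdivrMr //.
rewrite /simple_eval big_map (bigD1_seq k0) ?iota_uniq //= big1 ?addr0; last first.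
  move=> k kk0; rewrite indicE memNset ?scale0r //=.
  by rewrite -k0E; exact/negP.
by rewrite indicE mem_set ?scale1r //= -k0E.
Qed.

(** On each interval of the grid the value at the right endpoint is taken: the
    endpoints approach [t] strictly from the right. *)
Lemma right_continuous_simple (w : R -> V) :
  (forall t, 0 <= t -> w (t + h) @[h --> 0^'+] --> w t) ->
  exists2 a : nat -> seq (set R * V), forall n, simple_list (a n) &
    forall t, 0 <= t -> simple_eval (a n) t @[n --> \oo] --> w t.
Proof.
move=> wrc; pose q n : R := 2^-1 ^+ n.
exists (fun n => grid (q n) (n * 2 ^ n)%N (fun k => w (k.+1%:R * q n))).
  by move=> n; exact: simple_list_grid.
move=> t t0; apply/near_rnormP => e e0.
move: (wrc t t0) => /near_rnormP/(_ _ e0)/near_right0P[d d0 Hd].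
have half_cvg := @cvg_half_expn R.
have /cvgrPdist_lt/(_ _ d0)[N _ HN] := half_cvg.
exists (maxn N (Num.truncn t).+1) => // n /=; rewrite geq_max => /andP[Nn tn].
have := HN n Nn; rewrite sub0r normrN gtr0_norm ?exprn_gt0 // => qd.
have q0 : 0 < q n by rewrite exprn_gt0.
have nq : (n * 2 ^ n)%:R * q n = n%:R.
  by rewrite natrM natrX -mulrA -exprMn divff ?expr1n ?mulr1.
rewrite grid_eval ?nq //; last first.
  by rewrite (lt_le_trans (truncnS_gt t)) // ler_nat.
have /andP[k1 k2] := dyadic_index_itv n t0.
set k := Num.truncn _; rewrite -/(q n) -/k in k1 k2.
have -> : k.+1%:R * q n = t + (q n * k%:R + q n - t).
  by rewrite -[k.+1]addn1 natrD; ring.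
by apply: Hd; rewrite subr_gt0 k2 /=; rewrite -/(q n) in qd; lra.
Qed.

End Grid.

Section Quotient.
Context {R : realType} {X : hilbertType R}.

(** The intervals of a grid contain [t] in general position; the quotient over
    such an interval is a convex combination of the quotients from [t] to its
    two ends. *)
Lemma has_derivative_straddle (u : R -> X) (t : R) (w : X) (e : R) :
  has_derivative u t w -> 0 < e ->
  exists2 d : R, 0 < d & forall a b, a <= t -> t < b -> b - a < d ->
    rnorm (((b - a)^-1)%:C *: (u b - u a) - w) <= e.
Proof.
move=> /near_rnormP/[apply] [[d /= d0 Hd]].
have Hk k : `|k| < d -> rnorm (u (t + k) - u t - k%:C *: w) <= e * `|k|.
  move=> kd; have [->|k0] := eqVneq k 0.
    by rewrite addr0 subrr scale0r subrr rnorm0 normr0 mulr0.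
  have := Hd k; rewrite /= sub0r normrN => /(_ kd k0)/ltW.
  have -> : u (t + k) - u t - k%:C *: w = k%:C *: ((k^-1)%:C *: (u (t + k) - u t) - w).
    by apply: ip_ext => z; rewrite !ipE; field.
  by rewrite rnormZr mulrC ler_pM2r // normr_gt0.
exists d => // a b at_ tb bad.
have ba0 : 0 < b - a by rewrite subr_gt0 (le_lt_trans at_).
have -> : ((b - a)^-1)%:C *: (u b - u a) - w = ((b - a)^-1)%:C *:
   ((u (t + (b - t)) - u t - (b - t)%:C *: w) - (u (t + (a - t)) - u t - (a - t)%:C *: w)).
  have bE : t + (b - t) = b by rewrite addrC subrK.
  have aE : t + (a - t) = a by rewrite addrC subrK.
  by rewrite bE aE; apply: ip_ext => z; rewrite !ipE; field; rewrite gt_eqF.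
rewrite rnormZr gtr0_norm ?invr_gt0 // ler_pdivrMl // (le_trans (rnormB_le _ _)) //.
have hb : `|b - t| < d by rewrite gtr0_norm ?subr_gt0 //; lra.
have ha : `|a - t| < d by rewrite ler0_norm ?subr_le0 //; lra.
have := Hk _ hb; have := Hk _ ha.
rewrite (ler0_norm (_ : a - t <= 0)) ?subr_le0 // (gtr0_norm (_ : 0 < b - t)) ?subr_gt0 //.
lra.
Qed.

End Quotient.

Section TrajectoryIsStrong.
Context {R : realType} {X : hilbertType R}.
Local Notation mu := (@lebesgue_measure R).
Variables (u w : R -> X) (M : R).
Hypothesis M0 : 0 <= M.
Hypothesis wM : forall t, 0 <= t -> rnorm (w t) <= M.
Hypothesis uL : forall s t, 0 <= s -> s <= t -> rnorm (u t - u s) <= M * (t - s).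
Hypothesis wrc : forall t, 0 <= t -> w (t + h) @[h --> 0^'+] --> w t.
Hypothesis du : {ae mu, forall t : R, 0 < t -> has_derivative u t (w t)}.

Let quot (h : R) k : X := (h^-1)%:C *: (u (k.+1%:R * h) - u (k%:R * h)).

Let quot_le (h : R) k : 0 < h -> rnorm (quot h k) <= M.
Proof.
move=> h0; rewrite rnormZr gtr0_norm ?invr_gt0 // ler_pdivrMl // [leRHS]mulrC.
have -> : M * h = M * (k.+1%:R * h - k%:R * h).
  by rewrite -[k.+1]addn1 natrD; ring.
by apply: uL; rewrite ?mulr_ge0 ?ler_pM2r ?ler_nat // ltW.
Qed.

Let quot_integral (T : R) (n : nat) : 0 < T ->
  simple_integral `]0, T[ (grid (T / n.+1%:R) n.+1 (quot (T / n.+1%:R))) = u T - u 0.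
Proof.
move=> T0; set h := T / n.+1%:R.
have h0 : 0 < h by rewrite divr_gt0.
have hT : n.+1%:R * h = T by rewrite mulrC divfK.
rewrite /simple_integral big_map.
rewrite (eq_big_seq (fun k => u (k.+1%:R * h) - u (k%:R * h))); last first.
  move=> k; rewrite mem_iota add0n /= => kn.
  have kT : k.+1%:R * h <= T by rewrite -hT ler_pM2r // ler_nat.
  have hE : k.+1%:R * h - k%:R * h = h by rewrite -[k.+1]addn1 natrD; ring.
  suff -> : mu (`[(k%:R * h), (k.+1%:R * h)[%classic `&` `]0, T[%classic) = h%:E.
    by rewrite /= /quot scalerA -rmorphM /= divff ?gt_eqF // scale1r.
  have lt_k : k%:R * h < k.+1%:R * h by rewrite ltr_pM2r // ltr_nat.
  case: k kn kT hE lt_k => [|k] kn kT hE lt_k.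
    rewrite (_ : _ `&` _ = `]0, (1%:R * h)[%classic).
      by rewrite lebesgue_measure_itv /= lte_fin mul1r h0 oppr0 adde0.
    apply/seteqP; split => x /=; rewrite !in_itv /= mul0r.
      by move=> [/andP[_ ->] /andP[-> _]].
    by move=> /andP[x0 x1]; rewrite x1 x0 (ltW x0) (lt_le_trans x1).
  rewrite (_ : _ `&` _ = `[(k.+1%:R * h), (k.+2%:R * h)[%classic).
    by rewrite lebesgue_measure_itv /= lte_fin lt_k -EFinB hE.
  apply/seteqP; split => x /=; rewrite !in_itv /=; first by move=> [].
  move=> /andP[x0 x1]; rewrite x1 x0 (lt_le_trans x1) // (lt_le_trans _ x0) //.
  by rewrite mulr_gt0.
rewrite -[iota 0 n.+1]/(index_iota 0 n.+1).
by rewrite (telescope_sumr (fun k => u (k%:R * h))) // hT mul0r.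
Qed.

Let quot_cvg (T t : R) : 0 < t -> t < T -> has_derivative u t (w t) ->
  simple_eval (grid (T / n.+1%:R) n.+1 (quot (T / n.+1%:R))) t @[n --> \oo] --> w t.
Proof.
move=> t0 tT dt; have T0 : 0 < T by exact: lt_trans tT.
apply/near_rnormP => e e0; have e20 : 0 < e / 2 by rewrite divr_gt0.
have [d d0 Hd] := has_derivative_straddle dt e20.
exists (Num.truncn (T / d)) => // n /= dn.
set h := T / n.+1%:R; have h0 : 0 < h by rewrite divr_gt0.
have hT : n.+1%:R * h = T by rewrite mulrC divfK.
have hd : h < d.
  rewrite ltr_pdivrMr // mulrC -ltr_pdivrMr // (lt_le_trans (truncnS_gt _)) //.
  by rewrite ler_nat ltnS.
rewrite grid_eval ?hT ?(ltW t0) //; set k := Num.truncn _.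
have /truncn_itv/andP[k1 k2] : 0 <= t / h by rewrite divr_ge0 // ltW.
have hE : k.+1%:R * h - k%:R * h = h by rewrite -[k.+1]addn1 natrD; ring.
have := Hd (k%:R * h) (k.+1%:R * h); rewrite hE => H.
rewrite (@le_lt_trans _ _ (e / 2)) //; last by rewrite ltr_pdivrMr // ltr_pMr // ltr1n.
by apply: H; [rewrite -ler_pdivlMr | rewrite -ltr_pdivrMr |].
Qed.

Let w_strongly_measurable (T : R) : strongly_measurable `]0, T[ w.
Proof.
have [a Ha aw] := right_continuous_simple wrc.
exists a => //; apply: aeW => t; rewrite /= in_itv /= => /andP[t0 _].
exact/aw/ltW.
Qed.

(** The difference quotients on finer and finer grids telescope to the increment
    of [u] and converge to [w] boundedly, almost everywhere. *)
Let trajectory_bochner (T : R) : 0 <= T -> bochner_integral `]0, T[ w (u T - u 0).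
Proof.
rewrite le_eqVlt => /orP[/eqP<-|T0].
  rewrite set_itvoo0; split.
    by exists (fun=> [::]) => //; apply: aeW => t [].
  exists (fun=> [::]); split => //.
    by under eq_fun do rewrite integral_set0; exact: cvg_cst.
  rewrite subrr /simple_integral; under eq_fun do rewrite big_nil.
  exact: cvg_cst.
split; first exact: w_strongly_measurable.
exists (fun n => grid (T / n.+1%:R) n.+1 (quot (T / n.+1%:R))); split.
- by move=> n; exact: simple_list_grid.
- have [a Ha aw] := right_continuous_simple wrc.
  have mT : measurable (`]0, T[%classic : set R) by exact: measurable_itv.
  have := @dominated_convergence _ _ R mu `]0, T[%classic mT
    (fun n t => (rnorm (w t - simple_eval (grid (T / n.+1%:R) n.+1 (quot (T / n.+1%:R))) t))%:E)
    (cst 0%E) (cst (2 * M)%:E).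
  case.
  + move=> n; apply/measurable_EFinP.
    apply: (measurable_rnorm_simple_sub Ha (@simple_list_grid _ _ _ _ _)) => t.
    by rewrite /= in_itv /= => /andP[t0 _]; exact/aw/ltW.
  + exact: measurable_cst.
  + have [N [mN N0 HN]] := du; exists N; split => // t /= H; apply: HN => /= dt; apply: H.
    rewrite in_itv /= => /andP[t0 tT].
    apply/cvg_EFin; first by apply: nearW.
    have /cvg_rnormP := quot_cvg t0 tT (dt t0).
    by under eq_fun do rewrite rnormB.
  + apply/integrableP; split; first exact: measurable_cst.
    rewrite (eq_integral (cst (`|2 * M|)%:E)) // integral_cst //.
    have muT : mu (`]0, T[%classic : set R) = T%:E.
      by rewrite lebesgue_measure_itv /= lte_fin T0 -EFinB subr0.
    by rewrite [X in (_ * X < _)%E]muT -EFinM ltry.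
  + apply: aeW => t n; rewrite /= in_itv /= => /andP[t0 tT].
    rewrite lee_fin ger0_norm ?rnorm_ge0 // (le_trans (rnormB_le _ _)) //.
    rewrite mulr_natl mulr2n lerD //; first exact/wM/ltW.
    have h0 : 0 < T / n.+1%:R by rewrite divr_gt0.
    rewrite grid_eval ?(ltW t0) //; first exact: quot_le.
    by rewrite mulrC divfK.
  + by move=> _ _; rewrite integral0.
- by under eq_fun do rewrite quot_integral //; exact: cvg_cst.
Qed.

Lemma trajectory_H1loc : H1loc u.
Proof.
move=> tau tau0; exists w.
  split; first exact: w_strongly_measurable.
  apply: (@le_lt_trans _ _ (\int[mu]_(t in `]0%R, tau[) (M ^+ 2)%:E)%E).
    apply: integral_le_nonmeasurable => // t; rewrite ?lee_fin ?sqr_ge0 //= in_itv /=.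
    move=> /andP[t0 _]; rewrite ler_sqr ?nnegrE ?rnorm_ge0 //.
    exact/wM/ltW.
  rewrite integral_cst //= lebesgue_measure_itv /= lte_fin tau0 -EFinB -EFinM.
  by rewrite ltry.
by move=> t; rewrite in_itv /= => /andP[t0 _]; exact: trajectory_bochner.
Qed.

End TrajectoryIsStrong.

Lemma trajectory_strong_solution (R : realType) (X : hilbertType R)
    (G : X -> X -> Prop) (Y : R -> X -> X) (M : R) (u w : R -> X) :
  dissipative G -> is_yosida G Y -> single_valued G -> 0 <= M ->
  trajectory G M u w -> strong_solution G u.
Proof.
move=> Gdiss HY Gsv M0 traj; have [Gu wM uL _] := traj.
have du := trajectory_ae_derivative Gdiss HY Gsv traj.
split.
- apply: (trajectory_H1loc M0 wM uL _ du) => t t0.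
  exact: (trajectory_speed_right_continuous Gdiss HY Gsv traj t0).
- by move=> t t0; exists (w t); exact: Gu.
- have [N [mN N0 HN]] := du; exists N; split => // t /= H; apply: HN => /= dt; apply: H.
  by move=> t0; exists (w t); [exact/Gu/ltW | exact: dt].
Qed.

(** * System nodes at a fixed resolvent point *)

Section Node.
Context {R : realType} {U X : hilbertType R}.
Variables (S : system_node U X U).
Hypothesis S_passive : impedance_passive S.
Variable lam : R.
Hypothesis lam0 : 0 < lam.
Hypothesis lam_res : resolvent_set (main_graph S) lam%:C.

Local Notation emb := (ext_emb (snX1 S)).

Let emb_linear : linear emb. Proof. exact: ext_emb_linear. Qed.

Lemma snode0 : S (0, 0) = 0.
Proof.
have := lopP 1 (ldom0 S) (ldom0 S); rewrite scaler0 addr0 scale1r => h.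
by have := addrK (S 0) (S 0); rewrite -h subrr => /esym.
Qed.

Lemma main_graph0 w : main_graph S 0 w -> w = 0.
Proof. by case=> _ ->; rewrite snode0. Qed.

Lemma ext_emb_inj x y : emb x = emb y -> x = y.
Proof.
move=> xy; apply/eqP; rewrite -subr_eq0; apply/eqP.
have /eqP : `|emb (x - y)| = 0.
  by rewrite (linB emb_linear) xy subrr normr0.
rewrite ext_emb_norm normr_eq0 => /eqP h.
have [_ resP] := ext_resP (snX1 S).
have [w /main_graph0 -> <-] := (resP (x - y) 0).1 h.
by rewrite scaler0 subrr.
Qed.

(** The resolvent equation of the node, [lam x - A&B (x, u) = r]. As [lam] is in the
    resolvent set, [r] and [u] can be prescribed and determine [x] and [v], which
    turns the node into everywhere defined operators. *)
Definition node_at (r : X) (u : U) (x : X) (v : U) :=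
  ldom S (x, u) /\ S (x, u) = (lam%:C *: x - r, v).

Lemma node_atP r u x v : node_at r u x v <->
  snA S x + snB S u = emb (lam%:C *: x - r) /\ v = snCD S x u.
Proof.
split=> [[dom SE]|[AB vE]].
  have := snAB_extends dom; rewrite SE /= => ->; split => //.
  by rewrite /snCD SE.
have dom : ldom S (x, u) by apply/sn_dom; exists (lam%:C *: x - r).
split => //; have := snAB_extends dom; rewrite AB => /ext_emb_inj.
by move: vE; rewrite /snCD => ->; case: (snode S (x, u)) => a b /= ->.
Qed.

Lemma node_at_lin a r1 u1 x1 v1 r2 u2 x2 v2 :
  node_at r1 u1 x1 v1 -> node_at r2 u2 x2 v2 ->
  node_at (a *: r1 + r2) (a *: u1 + u2) (a *: x1 + x2) (a *: v1 + v2).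
Proof.
move=> [d1 S1] [d2 S2].
have E : (a *: x1 + x2, a *: u1 + u2) = a *: (x1, u1) + (x2, u2) by [].
split; first by rewrite E; exact: ldomP.
rewrite E lopP // S1 S2; congr (_, _) => /=.
rewrite scalerBr scalerDr !scalerA [_ * a]mulrC opprD.
by rewrite addrACA.
Qed.

Lemma node_atB r1 u1 x1 v1 r2 u2 x2 v2 :
  node_at r1 u1 x1 v1 -> node_at r2 u2 x2 v2 ->
  node_at (r1 - r2) (u1 - u2) (x1 - x2) (v1 - v2).
Proof.
move=> n1 n2; have := node_at_lin (-1) n2 n1.
by rewrite !scaleN1r ![- _ + _]addrC.
Qed.

Lemma node_at0 x v : node_at 0 0 x v -> x = 0 /\ v = 0.
Proof.
move=> [dom SE].
have [Rl [[Rlin _] RP]] := lam_res.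
have x0 : x = 0.
  rewrite -(lin0 Rlin); apply/esym/RP; exists (lam%:C *: x); last by rewrite subrr.
  by split => //; rewrite SE /= subr0.
by split => //; move: SE; rewrite x0 snode0 => -[].
Qed.

Lemma node_at_uniq r u x1 v1 x2 v2 :
  node_at r u x1 v1 -> node_at r u x2 v2 -> x1 = x2 /\ v1 = v2.
Proof.
move=> n1 n2; have := node_atB n1 n2; rewrite !subrr => /node_at0[/eqP + /eqP].
by rewrite !subr_eq0 => /eqP -> /eqP ->.
Qed.

(** [lam - A] maps [X] onto the extrapolation space: its inverse on the dense
    subspace [X] is bounded for the norm of that space. *)
Lemma extrapolation_surjective (z : snX1 S) :
  exists x, lam%:C *: emb x - snA S x = z.
Proof.
have [Rl [Rb RP]] := lam_res.
have [Rlin _] := Rb.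
have [K K0 HK] := bounded_operator_le Rb.
have [resb resP] := ext_resP (snX1 S).
have [Ke Ke0 HKe] := bounded_operator_le resb.
set mu := ext_lam (snX1 S) in resP.
pose res := ext_res (snX1 S).
have emb_norm x : rnorm (emb x) = rnorm (res x) by rewrite /rnorm ext_emb_norm.
have embl := emb_linear.
have embb : bounded_operator emb.
  by apply: (bounded_operatorI (K := Ke)) => // x; rewrite emb_norm.
have Rl_emb f : rnorm (Rl f) <= (rnorm ((mu - lam%:C) : R[i]^o) * K + 1) * rnorm (emb f).
  rewrite emb_norm; set p := res f.
  have [w Gpw fE] := (resP f p).1 erefl.
  have -> : Rl f = (mu - lam%:C) *: Rl p + p.
    rewrite -fE.
    have -> : mu *: p - w = (mu - lam%:C) *: p + (lam%:C *: p - w).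
      by rewrite scalerBl addrA subrK.
    rewrite Rlin; congr (_ + _); apply/RP.
    by exists w.
  rewrite (le_trans (rnormD_le _ _)) // rnormZ mulrDl mul1r lerD2r -mulrA.
  by rewrite ler_wpM2l // rnorm_ge0.
set C := (_ * K + 1) in Rl_emb.
have C0 : 0 < C by rewrite ltr_wpDl // mulr_ge0 ?rnorm_ge0 // ltW.
have approx n : exists f, rnorm (emb f - z) < 2^-1 ^+ n.
  have r0 : 0 < (2^-1 : R) ^+ n by rewrite exprn_gt0.
  have nz : nbhs z [set y | rnorm (y - z) < 2^-1 ^+ n].
    by apply/nbhs_rnormP; exists (2^-1 ^+ n).
  have [||y [/interior_subset yz [f _ fy]]] :=
      @ext_emb_dense _ _ _ (snX1 S) ([set y | rnorm (y - z) < 2^-1 ^+ n]^°).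
  - by exists z; exact: nz.
  - exact: open_interior.
  - by exists f; rewrite fy.
have [f Hf] := choice approx.
have fz : emb (f n) @[n --> \oo] --> z.
  apply/cvg_rnormP; apply: (squeeze_cvgr _ (cvg_cst 0) (@cvg_half_expn R)).
  by apply: nearW => n; rewrite rnorm_ge0 ltW.
have /cvg_ex[x fx] : cvgn (fun n => Rl (f n)).
  apply: cauchy_rnorm_cvg => e e0.
  have e2 : 0 < e / C / 2 by rewrite !divr_gt0.
  have /near_rnormP/(_ _ e2)[N _ HN] := fz.
  exists N => m n /HN /= hm /HN /= hn.
  rewrite -(linB Rlin) (le_trans (Rl_emb _)) // mulrC -ler_pdivlMr // (linB embl).
  have := rnorm_tri z (emb (f m)) (emb (f n)); rewrite (rnormB z); lra.
exists x; apply: (rnorm_cvg_unique _ fz).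
have cvg1 : lam%:C *: emb (Rl (f n)) - snA S (Rl (f n)) @[n --> \oo] -->
    lam%:C *: emb x - snA S x.
  apply: cvgB; last by apply: (cvg_comp _ _ fx); exact: (snA_bounded S).2.
  by apply: cvgZr; apply: (cvg_comp _ _ fx); exact: embb.2.
move: cvg1; under eq_fun => n.
  have [w Gw fE] := (RP (f n) (Rl (f n))).1 erefl.
  rewrite (snA_extends Gw) -(linZ embl) -(linB embl) fE.
  over.
by [].
Qed.

Lemma node_at_exists r u : exists x v, node_at r u x v.
Proof.
have [x xE] := extrapolation_surjective (emb r + snB S u).
exists x, (snCD S x u); apply/node_atP; split => //.
rewrite (linB emb_linear) (linZ emb_linear).
have -> : snB S u = lam%:C *: emb x - snA S x - emb r.
  by rewrite xE addrAC subrr add0r.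
by rewrite addrA [snA S x + _]addrC subrK.
Qed.

(** With [C] and [P] for [node_out^~ 0] and [node_out 0], this is [C r + P u]; [P] is
    the transfer function at [lam]. *)
Definition node_out (r : X) (u : U) : U :=
  xget 0 [set v | exists x, node_at r u x v].

Lemma node_outP r u : exists x, node_at r u x (node_out r u).
Proof.
rewrite /node_out; case: xgetP => // H.
by have [x [v n]] := node_at_exists r u; case: (H v); exists x.
Qed.

Lemma node_outE r u x v : node_at r u x v -> v = node_out r u.
Proof. by move=> n; have [x' n'] := node_outP r u; have [] := node_at_uniq n n'. Qed.

Lemma node_outD r u : node_out r u = node_out r 0 + node_out 0 u.
Proof.
have [x1 n1] := node_outP r 0; have [x2 n2] := node_outP 0 u.
have := node_at_lin 1 n1 n2; rewrite !scale1r addr0 add0r.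
by move/node_outE.
Qed.

Lemma node_out_state_linear : linear (node_out^~ 0).
Proof.
move=> a r1 r2; have [x1 n1] := node_outP r1 0; have [x2 n2] := node_outP r2 0.
by have := node_at_lin a n1 n2; rewrite scaler0 addr0 => /node_outE.
Qed.

Lemma node_out_input_linear : linear (node_out 0).
Proof.
move=> a u1 u2; have [x1 n1] := node_outP 0 u1; have [x2 n2] := node_outP 0 u2.
by have := node_at_lin a n1 n2; rewrite scaler0 addr0 => /node_outE.
Qed.

Lemma node_passive r u x v : node_at r u x v ->
  ip (lam%:C *: x - r) x <= ip v u.
Proof.
by case=> dom SE; have := S_passive dom; rewrite /snAB /snCD SE.
Qed.

(** Passivity gives an a priori bound of the state by the product of the input
    and the output. *)
Lemma node_state_le r u x v : node_at r u x v ->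
  lam * rnorm x ^+ 2 <= rnorm r * rnorm x + rnorm v * rnorm u.
Proof.
move=> /node_passive; rewrite !ipE ipxx.
have := ip_le r x; have := ip_le v u; lra.
Qed.

Lemma node_at_closed (rn : nat -> X) (un : nat -> U) (xn : nat -> X) (vn : nat -> U)
    r u x v :
  rn n @[n --> \oo] --> r -> un n @[n --> \oo] --> u ->
  xn n @[n --> \oo] --> x -> vn n @[n --> \oo] --> v ->
  (forall n, node_at (rn n) (un n) (xn n) (vn n)) -> node_at r u x v.
Proof.
move=> rc uc xc vc H.
have wc : lam%:C *: xn n - rn n @[n --> \oo] --> lam%:C *: x - r.
  by apply: cvgB => //; exact: cvgZr.
have pc : ((xn n, un n), (lam%:C *: xn n - rn n, vn n)) @[n --> \oo] -->
    ((x, u), (lam%:C *: x - r, v)).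
  exact: (cvg_pair (cvg_pair xc uc) (cvg_pair wc vc)).
have := closed_cvg _ (@sn_closed _ _ _ _ S) _ _ pc.
by case=> [|/= dom SE]; [apply: nearW => n /=; have [? ->] := H n | split].
Qed.

(** Passivity makes the states of a convergent sequence of inputs and outputs
    a Cauchy sequence. *)
Lemma node_at_cvg (rn : nat -> X) (un : nat -> U) (xn : nat -> X) (vn : nat -> U)
    r u v :
  rn n @[n --> \oo] --> r -> un n @[n --> \oo] --> u ->
  vn n @[n --> \oo] --> v ->
  (forall n, node_at (rn n) (un n) (xn n) (vn n)) -> exists x, node_at r u x v.
Proof.
move=> rc uc vc H.
suff /cvg_ex[x xc] : cvgn xn by exists x; exact: (node_at_closed rc uc xc vc H).
apply: cauchy_rnorm_cvg => e e0.
pose eta := Num.min e (lam * e) / 8.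
have eta0 : 0 < eta by rewrite divr_gt0 // lt_min e0 mulr_gt0.
have eta1 : eta <= e / 8 by rewrite ler_pM2r ?invr_gt0 // ge_min lexx.
have eta2 : eta <= lam * e / 8 by rewrite ler_pM2r ?invr_gt0 // ge_min lexx orbT.
have /near_rnormP/(_ _ eta0)[N1 _ H1] := rc.
have /near_rnormP/(_ _ eta0)[N2 _ H2] := uc.
have /near_rnormP/(_ _ eta0)[N3 _ H3] := vc.
pose N := maxn N1 (maxn N2 N3).
have N1N : (N1 <= N)%N by rewrite leq_max leqnn.
have N2N : (N2 <= N)%N by rewrite !leq_max leqnn orbT.
have N3N : (N3 <= N)%N by rewrite !leq_max leqnn !orbT.
exists N => m n mN nN.
have D1 : rnorm (rn m - rn n) <= 2 * eta.
  have := rnorm_tri r (rn m) (rn n); rewrite (rnormB r).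
  have /= := H1 _ (leq_trans N1N mN); have /= := H1 _ (leq_trans N1N nN); lra.
have D2 : rnorm (un m - un n) <= 2 * eta.
  have := rnorm_tri u (un m) (un n); rewrite (rnormB u).
  have /= := H2 _ (leq_trans N2N mN); have /= := H2 _ (leq_trans N2N nN); lra.
have D3 : rnorm (vn m - vn n) <= 2 * eta.
  have := rnorm_tri v (vn m) (vn n); rewrite (rnormB v).
  have /= := H3 _ (leq_trans N3N mN); have /= := H3 _ (leq_trans N3N nN); lra.
have := node_state_le (node_atB (H m) (H n)).
set a := rnorm (xn m - xn n); have a0 : 0 <= a := rnorm_ge0 _.
move=> aL; rewrite leNgt; apply/negP => ea.
have p1 : rnorm (rn m - rn n) * a <= 2 * eta * a by rewrite ler_wpM2r.
have p2 : rnorm (vn m - vn n) * rnorm (un m - un n) <= 2 * eta * (2 * eta).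
  by rewrite ler_pM ?rnorm_ge0 // (le_trans (rnorm_ge0 _) D3).
have p3 : eta * a <= lam * e / 8 * a by rewrite ler_wpM2r.
have p4 : eta * eta <= lam * e / 8 * (e / 8) by rewrite ler_pM // ltW.
have p5 : lam * e * e <= lam * e * a by rewrite ler_wpM2l ?mulr_ge0 ?ltW.
have p6 : lam * e * a <= lam * a * a by rewrite ler_wpM2r // ler_wpM2l ?(ltW lam0) ?(ltW ea).
have p7 : 0 < lam * e * e by rewrite !mulr_gt0.
nra.
Qed.

(** The closed graph theorem: the node is closed, and the states converge when
    the inputs and the outputs do. *)
Lemma node_out_bounded : exists K : R, 0 < K /\
  forall r u, rnorm (node_out r u) <= K * (rnorm r + rnorm u).
Proof.
have [K1 K10 H1] : exists2 K : R, 0 < K &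
    forall r, rnorm (node_out r 0) <= K * rnorm r.
  apply: closed_graph_bounded => [|rn r v rc vc]; first exact: node_out_state_linear.
  have [xn Hx] := choice (fun n => node_outP (rn n) 0).
  have [x /node_outE //] := node_at_cvg rc (@cvg_cst _ _ _ _ _) vc Hx.
have [K2 K20 H2] : exists2 K : R, 0 < K &
    forall u, rnorm (node_out 0 u) <= K * rnorm u.
  apply: closed_graph_bounded => [|un u v uc vc]; first exact: node_out_input_linear.
  have [xn Hx] := choice (fun n => node_outP 0 (un n)).
  have [x /node_outE //] := node_at_cvg (@cvg_cst _ _ _ _ _) uc vc Hx.
exists (K1 + K2); split=> [|r u]; first exact: addr_gt0.
rewrite node_outD (le_trans (rnormD_le _ _)) //.
have := H1 r; have := H2 u; have := rnorm_ge0 r; have := rnorm_ge0 u; nra.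
Qed.

Lemma transfer_node_out u : transfer S lam%:C u = node_out 0 u.
Proof.
rewrite /transfer; have [x n] := node_outP 0 u.
suff -> : resolventB S lam%:C u = x by have [_ /esym] := (node_atP _ _ _ _).1 n.
have node_eq y : lam%:C *: emb y - snA S y = snB S u ->
    node_at 0 u y (snCD S y u).
  move=> E; apply/node_atP; split => //.
  by rewrite subr0 (linZ emb_linear) -E addrC subrK.
rewrite /resolventB; case: xgetP => [y _ /= /node_eq n'|H].
  by have [] := node_at_uniq n' n.
case: (H x) => /=; have [+ _] := (node_atP _ _ _ _).1 n.
by rewrite subr0 (linZ emb_linear) => <-; rewrite addrC addKr.
Qed.

(** The operator and its adjoint have the same quadratic form up to
    conjugation. *)
Lemma node_out_re_ge c : re_ge (transfer S lam%:C) c ->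
  forall u, c * rnorm u ^+ 2 <= ip (node_out 0 u) u.
Proof.
move=> [T' [adj le_T]] u; rewrite -transfer_node_out; set T := transfer _ _ in adj le_T *.
have := le_T u; rewrite lecE => /andP[_].
have -> : complex.Re (hdot (c%:C *: u) u) = c * rnorm u ^+ 2.
  by rewrite -ipxx -[LHS]/(ip _ _) !ipE.
move=> /le_trans; apply.
rewrite -[complex.Re _]/(ip _ _).
have -> : 2%:R^-1 = (2^-1 : R)%:C by rewrite fmorphV rmorph_nat.
rewrite !ipE (_ : ip (T' u) u = ip (T u) u); first by lra.
by rewrite ipC /ip adj.
Qed.

End Node.

(** * The closed loop as a dissipative operator *)

Section RangeContinuation.
Context {R : realType} {X : hilbertType R}.
Variable G : X -> X -> Prop.
Hypothesis Gdiss : dissipative G.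

Let solvable (h : R) := forall f, exists x w, G x w /\ x - h%:C *: w = f.

Lemma dissipative_resolvent_le h x1 w1 x2 w2 : 0 < h -> G x1 w1 -> G x2 w2 ->
  rnorm (x1 - x2) <= rnorm ((x1 - h%:C *: w1) - (x2 - h%:C *: w2)).
Proof.
move=> h0 G1 G2; have := Gdiss G1 G2.
have -> : (x1 - h%:C *: w1) - (x2 - h%:C *: w2) =
    (x1 - x2) - h%:C *: (w1 - w2) by apply: ip_ext => e; rewrite !ipE; ring.
set a := x1 - x2; set b := w1 - w2; move=> ba.
rewrite -(@ler_pXn2r _ 2) ?nnegrE ?rnorm_ge0 // sqr_rnormBZ.
have := sqr_ge0 (h * rnorm b); rewrite exprMn.
have : h * ip b a <= 0 by rewrite mulr_ge0_le0 // ltW.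
lra.
Qed.

(** With [J] the resolvent at [h0], the equation [x - h w = f] reads
    [x = J ((h0 / h) f + (1 - h0 / h) x)], a contraction for [h > h0 / 2]. *)
Lemma range_continuation h0 h : 0 < h0 -> h0 / 2 < h -> solvable h0 -> solvable h.
Proof.
move=> h0p hh S0 f.
have hp : 0 < h by rewrite (lt_trans _ hh) // divr_gt0.
have [J HJ] := choice S0.
pose q := `|1 - h0 / h|.
have q1 : q < 1.
  rewrite ltr_norml; apply/andP; split.
    rewrite ltrBDr -ltrBDl opprK ltr_pdivrMr //; lra.
  by rewrite gtrBl divr_gt0.
pose T x := J ((h0 / h)%:C *: f + (1 - h0 / h)%:C *: x).
have JL g1 g2 : rnorm (J g1 - J g2) <= rnorm (g1 - g2).
  have [w1 [G1 E1]] := HJ g1; have [w2 [G2 E2]] := HJ g2.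
  by have := dissipative_resolvent_le h0p G1 G2; rewrite E1 E2.
have Tq x y : rnorm (T x - T y) <= q * rnorm (x - y).
  rewrite (le_trans (JL _ _)) // opprD addrACA subrr add0r -scalerBr.
  by rewrite rnormZr.
have q1' : 0 < 1 - q by rewrite subr_gt0.
have T0 : rnorm (T 0 - 0) <= (1 - q) * (rnorm (T 0 - 0) / (1 - q)).
  by rewrite mulrC divfK // gt_eqF.
have [x _ Tx] := banach_ball (divr_ge0 (rnorm_ge0 _) (ltW q1')) (normr_ge0 _) q1
  (fun x y _ _ => Tq x y) T0.
have [w [Gw E]] := HJ ((h0 / h)%:C *: f + (1 - h0 / h)%:C *: x).
exists x, w; split; first by rewrite -{1}Tx.
move: E; rewrite -/(T x) Tx => E.
have hh0 : (h0 / h)%:C != 0 :> R[i] by rewrite fmorph_eq0 mulf_neq0 ?invr_eq0 ?gt_eqF.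
apply: (scalerI hh0).
have -> : (h0 / h)%:C *: f = x - h0%:C *: w - (1 - h0 / h)%:C *: x by rewrite E addrK.
by apply: ip_ext => e; rewrite !ipE; field; rewrite gt_eqF.
Qed.

(** Finitely many steps by the factor [3 / 4] bring [h0] below [h]. *)
Lemma range_all h0 : 0 < h0 -> solvable h0 -> forall h, 0 < h -> solvable h.
Proof.
move=> h0p S0 h hp.
have pos n : 0 < h0 * (3 / 4) ^+ n by rewrite mulr_gt0 // exprn_gt0.
have Sn n : solvable (h0 * (3 / 4) ^+ n).
  elim: n => [|n IH]; first by rewrite mulr1.
  apply: range_continuation IH => //.
  have := pos n; rewrite exprS; lra.
have : h0 * (3 / 4) ^+ n @[n --> \oo] --> h0 * 0.
  by apply: cvgMr; apply: cvg_expr; rewrite ger0_norm; lra.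
rewrite mulr0 => /cvgrPdist_lt/(_ _ hp)[N _ /(_ N (leqnn N))] /=.
rewrite sub0r normrN gtr0_norm // => hN.
by apply: (range_continuation (pos N)) => //; have := pos N; lra.
Qed.

End RangeContinuation.

Section ClosedLoop.
Context {R : realType} {U X : hilbertType R}.
Variables (S : system_node U X U).
Hypothesis S_passive : impedance_passive S.
Variables lam c : R.
Hypothesis lam0 : 0 < lam.
Hypothesis c0 : 0 < c.
Hypothesis lam_res : resolvent_set (main_graph S) lam%:C.
Hypothesis transfer_ge : re_ge (transfer S lam%:C) c.
Variable phi : U -> U.
Hypothesis phi_mono : monotone_map phi.

Lemma monotone_mapP u1 u2 : 0 <= ip (phi u1 - phi u2) (u1 - u2).
Proof. exact: phi_mono. Qed.

Lemma feedback_node x v w :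
  feedback_at S phi x v w <-> node_at S lam (lam%:C *: x - w) (phi (- v)) x v.
Proof. by rewrite node_atP /feedback_at opprB [_ + (w - _)]addrC subrK. Qed.

(** The inequality of passivity for the difference of two states, where the
    supplied power is minus the one that the feedback absorbs. *)
Lemma feedback_passive x1 v1 w1 x2 v2 w2 :
  feedback_at S phi x1 v1 w1 -> feedback_at S phi x2 v2 w2 ->
  ip (w1 - w2) (x1 - x2) <= - ip (phi (- v1) - phi (- v2)) (- v1 - - v2).
Proof.
move=> /feedback_node n1 /feedback_node n2.
have := node_passive S_passive (node_atB n1 n2); rewrite !ipE.
rewrite (ipC (phi (- v1)) v1) (ipC (phi (- v1)) v2).
rewrite (ipC (phi (- v2)) v1) (ipC (phi (- v2)) v2); lra.
Qed.

Lemma feedback_dissipative : dissipative (feedback_graph S phi).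
Proof.
move=> x1 w1 x2 w2 [v1 f1] [v2 f2]; apply: le_trans (feedback_passive f1 f2) _.
by rewrite oppr_le0 monotone_mapP.
Qed.

(** The strict positivity of the transfer function determines the input and
    the output from [lam x - w], with a Lipschitz bound. *)
Lemma feedback_lipschitz : exists K : R, 0 < K /\
  forall x1 v1 w1 x2 v2 w2,
  feedback_at S phi x1 v1 w1 -> feedback_at S phi x2 v2 w2 ->
  rnorm (v1 - v2) + rnorm (phi (- v1) - phi (- v2)) <=
    K * rnorm (lam%:C *: (x1 - x2) - (w1 - w2)).
Proof.
have [K [K0 HK]] := node_out_bounded S_passive lam0 lam_res.
pose L := K / c; have L0 : 0 < L by rewrite divr_gt0.
exists (K * (1 + L) + L); split; first by rewrite addr_gt0 // mulr_gt0 // addr_gt0.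
move=> x1 v1 w1 x2 v2 w2 f1 f2.
have mono := monotone_mapP (- v1) (- v2).
have /feedback_node n1 := f1; have /feedback_node n2 := f2.
have n := node_atB n1 n2; set r := _ - _ - _ in n.
have -> : lam%:C *: (x1 - x2) - (w1 - w2) = r.
  by rewrite /r; apply: ip_ext => e; rewrite !ipE; ring.
set u := phi (- v1) - phi (- v2) in n mono *; set v := v1 - v2 in n *.
have vE := node_outE lam_res n.
have uv : ip v u <= 0.
  move: mono; have -> : - v1 - - v2 = - v by rewrite /v opprB opprK addrC.
  by rewrite ipNr oppr_ge0 ipC.
have uL : rnorm u <= L * rnorm r.
  rewrite /L mulrAC ler_pdivlMr //.
  have [->|u0] := eqVneq (rnorm u) 0; first by rewrite mul0r mulr_ge0 ?rnorm_ge0 // ltW.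
  have up : 0 < rnorm u by rewrite lt_def u0 rnorm_ge0.
  rewrite -(ler_pM2r up).
  have := node_out_re_ge lam_res transfer_ge u.
  move: uv; rewrite vE (node_outD lam_res) ipDl => uv.
  have := ip_le (- node_out S lam r 0) u; rewrite ipNl rnormN.
  have := ler_wpM2r (ltW up) (HK r 0); rewrite rnorm0 addr0; nra.
have := HK r u; rewrite -vE => vL.
have r0 := rnorm_ge0 r.
have : K * (rnorm r + rnorm u) <= K * (rnorm r + L * rnorm r).
  by rewrite ler_pM2l // lerD2l.
nra.
Qed.

Hypothesis phi_lip : locally_lipschitz phi.

(** With [z = - v] the equation for the output is [z + P (phi z) = - C f]. Strong
    monotonicity makes [P] invertible, and in the form [Q z + phi z = Q (- C f)],
    with [Q] the inverse of [P], the left-hand side is strongly monotone. *)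
Lemma feedback_range f :
  exists x w, feedback_graph S phi x w /\ lam%:C *: x - w = f.
Proof.
have [K [K0 HK]] := node_out_bounded S_passive lam0 lam_res.
pose P := node_out S lam 0.
have Plin : linear P := node_out_input_linear lam_res.
have PK u : rnorm (P u) <= K * rnorm u by have := HK 0 u; rewrite rnorm0 add0r.
have Pc : forall u, c * rnorm u ^+ 2 <= ip (P u) u :=
  node_out_re_ge lam_res transfer_ge.
have Pmono x y : c * rnorm (x - y) ^+ 2 <= ip (P x - P y) (x - y).
  by rewrite -(linB Plin).
have Plip : locally_rlipschitz P.
  move=> x; exists 1, K; split => // y z _ _; by rewrite -(linB Plin).
have /choice[Q PQ] := strongly_monotone_surj c0 Plip Pmono.
have QL x y : rnorm (Q x - Q y) <= c^-1 * rnorm (x - y).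
  by have := strongly_monotone_inj_le c0 Pmono (Q x) (Q y); rewrite !PQ.
pose m := c / K ^+ 2.
have m0 : 0 < m by rewrite divr_gt0 // exprn_gt0.
pose F z := Q z + phi z.
have Fmono x y : m * rnorm (x - y) ^+ 2 <= ip (F x - F y) (x - y).
  rewrite /F opprD addrACA ipDl.
  have := monotone_mapP x y.
  have := Pc (Q x - Q y); rewrite (linB Plin) !PQ ipC.
  have := PK (Q x - Q y); rewrite (linB Plin) !PQ.
  set a := rnorm (x - y); set b := rnorm _ => ab Pb M.
  have : a ^+ 2 <= K ^+ 2 * b ^+ 2.
    by rewrite -exprMn lerXn2r ?nnegrE ?rnorm_ge0 ?(le_trans (rnorm_ge0 (x - y)) ab).
  have : m * K ^+ 2 = c by rewrite /m divfK // expf_neq0 // gt_eqF.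
  nra.
have Flip : locally_rlipschitz F.
  move=> x; have [r [L [r0 L0 HL]]] := locally_lipschitz_r phi_lip x.
  exists r, (c^-1 + L); split => //; first by rewrite addr_gt0 ?invr_gt0.
  move=> y z yx zx; rewrite /F opprD addrACA (le_trans (rnormD_le _ _)) //.
  by rewrite mulrDl lerD ?HL.
have [z zE] := strongly_monotone_surj m0 Flip Fmono (Q (- node_out S lam f 0)).
have zE' : P (phi z) = - node_out S lam f 0 - z.
  have -> : phi z = Q (- node_out S lam f 0) - Q z by rewrite -zE /F addrC addKr.
  by rewrite (linB Plin) !PQ.
have [x n] := node_outP lam_res f (phi z).
have vE : node_out S lam f (phi z) = - z.
  rewrite (node_outD lam_res) -/(P _) zE'.
  by rewrite addrA subrr sub0r.
exists x, (lam%:C *: x - f); split; last by rewrite opprB addrC subrK.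
by exists (- z); apply/feedback_node; rewrite opprK opprB [_ + (f - _)]addrC subrK -vE.
Qed.

Lemma feedback_yosida : exists Y, is_yosida (feedback_graph S phi) Y.
Proof.
apply: yosida_exists => h f h0.
have lamC0 : lam%:C != 0 :> R[i] by rewrite fmorph_eq0 gt_eqF.
apply: (range_all feedback_dissipative (_ : 0 < lam^-1)) => //.
  by rewrite invr_gt0.
move=> g; have [x [w [Gxw E]]] := feedback_range (lam%:C *: g).
exists x, w; split => //; apply: (scalerI lamC0).
by rewrite -E scalerBr scalerA fmorphV mulfV // scale1r.
Qed.

End ClosedLoop.

(** * Linear semigroups *)

Section Semigroup.
Context {R : realType} {V : completeNormedModType R[i]}.
Variable T : R -> V -> V.
Hypothesis HT : c0_semigroup T.

(** Otherwise the operators would be unbounded along some sequence of times that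
    tends to [0], although they converge pointwise along it. *)
Lemma semigroup_locally_bounded : exists d M : R, [/\ 0 < d, 0 < M &
  forall s x, 0 <= s -> s <= d -> rnorm (T s x) <= M * rnorm x].
Proof.
have [Tb T0 _ Tc] := HT.
apply: contrapT => unbounded.
have /choice[p Hp] : forall n : nat, exists p : R * V,
    [/\ 0 <= p.1, p.1 <= n.+1%:R^-1 & n.+1%:R * rnorm p.2 < rnorm (T p.1 p.2)].
  move=> n; apply: contrapT => H; apply: unbounded.
  exists n.+1%:R^-1, n.+1%:R; split; rewrite ?invr_gt0 ?ltr0n // => s x s0 sn.
  by rewrite leNgt; apply/negP => lt; apply: H; exists (s, x).
have [|x|K K0 HK] := @uniform_boundedness R V V (fun n => T (p n).1).
- by move=> n; apply: Tb; have [] := Hp n.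
- have /near_rnormP/(_ _ ltr01)/near_right0P[d d0 Hd] := Tc x.
  pose N := (Num.truncn d^-1).+1.
  exists (rnorm x + 1 + \sum_(i < N) rnorm (T (p i).1 x)) => n.
  have sum0 : 0 <= \sum_(i < N) rnorm (T (p i).1 x).
    by apply: sumr_ge0 => i _; exact: rnorm_ge0.
  have [nN|Nn] := ltnP n N.
    rewrite (bigD1 (Ordinal nN)) //= addrCA ler_wpDr // addr_ge0 ?addr_ge0 ?rnorm_ge0 //.
    by apply: sumr_ge0 => i _; exact: rnorm_ge0.
  rewrite ler_wpDr //; have [p0 pn _] := Hp n.
  have [->|p_neq0] := eqVneq (p n).1 0; first by rewrite T0 ler_wpDr.
  have /Hd/= : 0 < (p n).1 < d.
    rewrite lt_def p_neq0 p0 (le_lt_trans pn) // invf_plt ?posrE ?ltr0n //.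
    by rewrite (lt_le_trans (truncnS_gt _)) // ler_nat leqW.
  by have := rnormD_le (T (p n).1 x - x) x; rewrite subrK; lra.
pose n := Num.truncn K.
have Kn : K < n.+1%:R by exact: truncnS_gt.
have [_ _] := Hp n; have := HK n (p n).2; have := rnorm_ge0 (p n).2; nra.
Qed.

(** [T (t - h) x - T t x] is the image of [x - T h x] by [T (t - h)], which factors
    through a fixed operator and one at a small time. *)
Lemma semigroup_left_continuous t x : 0 < t -> T (t - h) x @[h --> 0^'+] --> T t x.
Proof.
move=> t0; have [Tb T0 TD Tc] := HT.
have [d [M [d0 M0 HM]]] := semigroup_locally_bounded.
pose s := Num.min d t.
have s0 : 0 < s by rewrite lt_min d0.
have st : 0 <= t - s by rewrite subr_ge0 ge_min lexx orbT.
have sd : s <= d by rewrite ge_min lexx.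
have lin r : 0 <= r -> linear (T r) by move=> /Tb[].
have [K K0 HK] := bounded_operator_le (Tb _ st).
have xc : K * (M * rnorm (T h x - x)) @[h --> 0^'+] --> K * (M * (0 : R)).
  by apply: cvgMr; apply: cvgMr; apply/cvg_rnormP; exact: Tc.
rewrite !mulr0 in xc; apply/cvg_rnormP.
apply: (squeeze_cvgr _ (cvg_cst 0) xc).
near=> h; rewrite rnorm_ge0 /=.
have h0 : 0 < h by [].
have hs : h < s by [].
have sh : 0 <= s - h by rewrite subr_ge0 ltW.
have E1 : t - h = (t - s) + (s - h) by rewrite addrA subrK.
have E2 : T t x = T (t - s) (T (s - h) (T h x)).
  by rewrite -(TD _ _ x sh (ltW h0)) subrK -(TD _ _ x st (ltW s0)) subrK.
rewrite E1 TD // E2 -(linB (lin _ st)) -(linB (lin _ sh)) (rnormB (T h x)).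
by rewrite (le_trans (HK _)) // ler_pM2l // HM // (le_trans _ sd) // gerBl ltW.
Unshelve. all: by end_near. Qed.

Lemma semigroup_right_derivative x w t : generator T x w -> 0 <= t ->
  right_derivative (T^~ x) t (T t w).
Proof.
move=> Gxw t0; have [Tb T0 TD Tc] := HT; have [Tlin Tcont] := Tb t t0.
apply: (cvg_trans _ (cvg_comp _ _ Gxw (Tcont w))).
apply: near_eq_cvg; near=> h.
have h0 : 0 < h by [].
by rewrite /= (linZ Tlin) (linB Tlin) TD // ltW.
Unshelve. all: by end_near. Qed.

Lemma semigroup_generator x w t : generator T x w -> 0 <= t ->
  generator T (T t x) (T t w).
Proof.
move=> Gxw t0; have [Tb T0 TD Tc] := HT.
have := semigroup_right_derivative Gxw t0.
apply: cvg_trans; apply: near_eq_cvg; near=> h.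
have h0 : 0 < h by [].
by rewrite [t + h]addrC TD // ltW.
Unshelve. all: by end_near. Qed.

End Semigroup.

(** * Density of the domain *)

Section Density.
Context {R : realType} {X : hilbertType R}.
Variables (G : X -> X -> Prop) (Y : R -> X -> X).
Hypothesis Gdiss : dissipative G.
Hypothesis HY : is_yosida G Y.

(** The displacement [h Y h f] from [f] to its resolvent decreases in norm with [h],
    and the loss in norm controls the distance; hence the resolvents of [f]
    converge as [h] tends to [0]. *)
Lemma resolvent_dist h k f : 0 < k -> k < h ->
  rnorm (h%:C *: Y h f - k%:C *: Y k f) ^+ 2 <=
    rnorm (h%:C *: Y h f) ^+ 2 - rnorm (k%:C *: Y k f) ^+ 2.
Proof.
move=> k0 kh; have h0 : 0 < h by exact: lt_trans kh.
have := Gdiss (HY f h0) (HY f k0).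
have -> : f + h%:C *: Y h f - (f + k%:C *: Y k f) =
    h%:C *: Y h f - k%:C *: Y k f by apply: ip_ext => e; rewrite !ipE; ring.
set a := h%:C *: Y h f; set b := k%:C *: Y k f.
have -> : Y h f = (h^-1)%:C *: a.
  by apply: ip_ext => e; rewrite /a !ipE mulKf // gt_eqF.
have -> : Y k f = (k^-1)%:C *: b.
  by apply: ip_ext => e; rewrite /b !ipE mulKf // gt_eqF.
have hk : 0 < k^-1 - h^-1 by rewrite subr_gt0 ltf_pV2.
have hV : 0 < h^-1 by rewrite invr_gt0.
clearbody a b; rewrite !ipE !ipxx (ipC b a) sqr_rnormB => H.
have := mulr_ge0 (ltW hV) (sqr_ge0 (rnorm (a - b))); rewrite sqr_rnormB => H1.
suff : rnorm b ^+ 2 <= ip a b by lra.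
rewrite -(ler_pM2l hk); lra.
Qed.

(** Let [l] be the limit of the displacements [q Y q x] as [q] tends to [0]. By
    homogeneity [q (x + q Y q x)] has the value [q Y q x], and since the graph is
    closed [0] has the value [l]. So [l = 0], and the resolvents of [x], which
    belong to the domain, converge to [x]. *)
Lemma gdom_dense :
  (forall (r : R) x w, G x w -> G (r%:C *: x) (r%:C *: w)) ->
  (forall w, G 0 w -> w = 0) -> dense (gdom G).
Proof.
move=> GZ G0 O [x Ox] Oo.
have : nbhs x O by exact: open_nbhs_nbhs.
move=> /nbhs_rnormP[e e0 He].
pose q n : R := 2^-1 ^+ n.
have q0 n : 0 < q n by rewrite exprn_gt0.
pose a n := (q n)%:C *: Y (q n) x.
have dist m n : (m <= n)%N ->
    rnorm (a m - a n) ^+ 2 <= rnorm (a m) ^+ 2 - rnorm (a n) ^+ 2.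
  rewrite leq_eqVlt => /orP[/eqP <-|mn]; first by rewrite !subrr rnorm0 expr0n.
  by apply: resolvent_dist; rewrite // ltr_iXn2l // invf_lt1 // ltr1n.
have an_dec m n : (m <= n)%N -> rnorm (a n) ^+ 2 <= rnorm (a m) ^+ 2.
  by move=> /dist H; rewrite -subr_ge0 (le_trans _ H) // sqr_ge0.
have /cauchy_cvgP sq_cauchy : cvgn (fun n => rnorm (a n) ^+ 2).
  apply: nonincreasing_is_cvgn; first by move=> m n; exact: an_dec.
  by exists 0 => _ [n _ <-]; exact: sqr_ge0.
have /cvg_ex[l al] : cvgn a.
  apply: cauchy_rnorm_cvg => d d0.
  have d2 : 0 < d ^+ 2 by rewrite exprn_gt0.
  have [N HN] : exists N, forall m n, (N <= m)%N -> (m <= n)%N ->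
      rnorm (a m) ^+ 2 - rnorm (a n) ^+ 2 <= d ^+ 2.
    move: sq_cauchy => /cauchy_ballP/(_ _ d2)[[A B]] /= [[N1 _ H1] [N2 _ H2]] HAB.
    exists (maxn N1 N2) => m n; rewrite geq_max => /andP[mN1 mN2] mn.
    have := HAB (rnorm (a m) ^+ 2, rnorm (a n) ^+ 2).
    rewrite /= => /(_ (conj (H1 _ mN1) (H2 _ (leq_trans mN2 mn)))).
    by move=> /ltW; apply: le_trans; exact: ler_norm.
  exists N => m n mN nN.
  rewrite -(@ler_pXn2r _ 2) ?nnegrE ?rnorm_ge0 ?(ltW d0) //.
  have [mn|/ltnW nm] := leqP m n; first by rewrite (le_trans (dist _ _ mn)) ?HN.
  by rewrite rnormB (le_trans (dist _ _ nm)) ?HN.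
have qc : q n @[n --> \oo] --> (0 : R) by exact: cvg_half_expn.
have l0 : l = 0.
  apply: G0; apply: (dissipative_closed Gdiss HY (xn := fun n => (q n)%:C *: (x + a n))
    (wn := a)) => //; first by move=> n; apply: GZ; exact: HY.
  have yc : x + a n @[n --> \oo] --> x + l by apply: cvgD => //; exact: cvg_cst.
  apply/cvg_rnormP; under eq_fun => n do
    rewrite subr0 rnormZr gtr0_norm //.
  have := cvgM qc (cvg_rnorm yc); rewrite mul0r; exact.
have /near_rnormP/(_ _ e0)[N _ /(_ N (leqnn N)) /=] := al.
rewrite l0 subr0 => aN; exists (x + a N); split.
  by apply: He; rewrite addrC addKr.
by exists (Y (q N) x); exact: HY.
Qed.

End Density.

(** * The stabilising linear feedback *)

Section NegativeFeedback.
Context {R : realType} {U X : hilbertType R}.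
Variables (S : system_node U X U).
Hypothesis S_passive : impedance_passive S.
Variables lam c : R.
Hypothesis lam0 : 0 < lam.
Hypothesis c0 : 0 < c.
Hypothesis lam_res : resolvent_set (main_graph S) lam%:C.
Hypothesis transfer_ge : re_ge (transfer S lam%:C) c.

Lemma id_monotone : monotone_map (id : U -> U).
Proof. by move=> u1 u2; rewrite -[complex.Re _]/(ip _ _) ipxx sqr_ge0. Qed.

Lemma id_locally_lipschitz : locally_lipschitz (id : U -> U).
Proof.
move=> x; exists setT; first exact: filterT.
exists 1; split => // K K1 [y z] _ /=.
by rewrite ler_peMl // ltW.
Qed.

Lemma negative_feedbackZ (r : R) x w : negative_feedback_graph S x w ->
  negative_feedback_graph S (r%:C *: x) (r%:C *: w).
Proof.
case=> v /(feedback_node S lam id _ _ _) n0; exists (r%:C *: v); apply/(feedback_node S lam id _ _ _).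
have nz : node_at S lam 0 0 0 0.
  by split; [exact: ldom0|rewrite snode0 scaler0 subr0].
have := node_at_lin r%:C n0 nz; rewrite !addr0 scalerN.
by rewrite scalerBr !scalerA [r%:C * _]mulrC.
Qed.

(** A nonzero output would make the node supply power at zero energy. *)
Lemma negative_feedback0 w : negative_feedback_graph S 0 w -> w = 0.
Proof.
case=> v f.
have f0 : feedback_at S id 0 0 0.
  apply/(feedback_node S lam id _ _ _); rewrite /= !oppr0.
  by split; [exact: ldom0|rewrite snode0 !scaler0 ?addr0 ?subr0].
have := feedback_passive S_passive lam f f0.
rewrite !subr0 ip0r oppr0 subr0 ipxx oppr_ge0 => v2.
have v0 : v = 0.
  by apply: rnorm_eq0; apply/eqP; rewrite -sqrf_eq0 eq_le sqr_ge0 -rnormN v2.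
move/(feedback_node S lam id _ _ _): f; rewrite v0 /= oppr0 => -[_].
by rewrite snode0 scaler0 !sub0r opprK => -[<-].
Qed.

Lemma negative_feedback_dense : dense (gdom (negative_feedback_graph S)).
Proof.
have [Y HY] := feedback_yosida S_passive lam0 c0 lam_res transfer_ge id_monotone
  id_locally_lipschitz.
exact: (gdom_dense (feedback_dissipative S_passive lam id_monotone) HY
  negative_feedbackZ negative_feedback0).
Qed.

End NegativeFeedback.

(** * Dissipated energy *)

Section DissipatedEnergy.
Context {R : realType} {X : hilbertType R}.
Local Notation mu := (@lebesgue_measure R).
Variables (F D : R -> X) (g : R -> R) (B : R).
Hypothesis mg : measurable_fun (`[0, +oo[%classic : set R) g.
Hypothesis g0 : forall t, 0 <= t -> 0 <= g t.
Hypothesis gB : forall t, 0 <= t -> g t <= B.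
Hypothesis gc : forall t, 0 <= t -> g (t + h) @[h --> 0^'+] --> g t.
Hypothesis Fleft : forall t, 0 < t -> F (t - h) @[h --> 0^'+] --> F t.
Hypothesis Fright : forall t, 0 <= t -> right_derivative F t (D t).
Hypothesis FD : forall t, 0 <= t -> 2 * ip (D t) (F t) <= - g t.

Let I (a b : R) := (\int[mu]_(t in `[a, b[) (g t)%:E)%E.

Let itv_sub (a b : R) : 0 <= a -> `[a, b[%classic `<=` (`[0, +oo[%classic : set R).
Proof.
by move=> a0 t /=; rewrite !in_itv /= andbT => /andP[at_ _]; exact: le_trans at_.
Qed.

Let I0 a b : 0 <= a -> (0 <= I a b)%E.
Proof.
move=> a0; apply: integral_ge0 => t /(itv_sub a0) /=.
by rewrite in_itv /= andbT lee_fin; exact: g0.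
Qed.

Let I_le a b C : 0 <= a -> a <= b -> 0 <= C -> (forall t, a <= t -> t < b -> g t <= C) ->
  (I a b <= (C * (b - a))%:E)%E.
Proof.
move=> a0 ab C0 gC.
apply: (@le_trans _ _ (\int[mu]_(t in `[a, b[) C%:E)%E).
  apply: integral_le_nonmeasurable => // t; rewrite /= in_itv /= => /andP[at_ tb].
    by rewrite lee_fin g0 // (le_trans a0).
  by rewrite lee_fin gC.
have muab : mu `[a, b[%classic = (b - a)%:E.
  rewrite lebesgue_measure_itv /= lte_fin.
  by move: ab; rewrite le_eqVlt => /orP[/eqP->|->]; rewrite ?ltxx ?subrr ?EFinB.
rewrite integral_cst; last exact: measurable_itv.
by rewrite [X in (_ * X <= _)%E]muab EFinM.
Qed.

Let B0 : 0 <= B.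
Proof. exact: le_trans (g0 (lexx 0)) (gB (lexx 0)). Qed.

Let Ifin a b : 0 <= a -> a <= b -> I a b = (fine (I a b))%:E.
Proof.
move=> a0 ab; rewrite fineK // ge0_fin_numE ?I0 //.
apply: le_lt_trans (ltry (B * (b - a))); apply: I_le => // t at_ _.
by rewrite gB // (le_trans a0).
Qed.

Let I_cat a b : 0 <= a -> a <= b -> fine (I 0 b) = fine (I 0 a) + fine (I a b).
Proof.
move=> a0 ab; apply: EFin_inj; rewrite EFinD -!Ifin ?(le_trans a0 ab) //.
have E : (`[0, b[%classic : set R) = `[0, a[%classic `|` `[a, b[%classic.
  apply/seteqP; split => x /=; rewrite !in_itv /=.
    by move=> /andP[x0 xb]; case: (ltP x a) => xa; [left|right]; rewrite ?x0 ?xb.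
  by move=> [/andP[-> /lt_le_trans ->//]|/andP[ax ->]]; rewrite (le_trans a0).
rewrite /I E ge0_integral_setU //.
- apply/measurable_EFinP; apply: measurable_funS mg => //.
  by rewrite -E; exact: itv_sub.
- move=> x; rewrite -E => /(itv_sub (lexx 0)) /=.
  by rewrite in_itv /= andbT lee_fin; exact: g0.
- rewrite disj_set2E; apply/eqP/seteqP; split => // x [] /=; rewrite !in_itv /=.
  by move=> /andP[_ xa] /andP[ax _]; move: (le_lt_trans ax xa); rewrite ltxx.
Qed.

(** [rnorm F ^+ 2] plus the integral of [g] up to time [t] decreases, by its right
    Dini derivatives; continuity of [g] from the right suffices for this. *)
Lemma dissipated_energy_le (tau : R) : 0 <= tau ->
  (\int[mu]_(t in `[0%R, tau[) (g t)%:E <= (rnorm (F 0) ^+ 2)%:E)%E.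
Proof.
move=> tau0; rewrite -/(I 0 tau) Ifin // lee_fin.
have I00 : fine (I 0 0) = 0.
  by apply: EFin_inj; rewrite -Ifin // /I set_itvco0 integral_set0.
suff : rnorm (F tau) ^+ 2 + fine (I 0 tau) <= rnorm (F 0) ^+ 2 + fine (I 0 0).
  by rewrite I00 addr0; apply: le_trans; rewrite lerDr sqr_ge0.
apply: (@dini_nonincreasing R (fun t => rnorm (F t) ^+ 2 + fine (I 0 t)) 0 tau) => //.
- move=> t t0 ttau e e0.
  have sqc : rnorm (F (t - h)) ^+ 2 @[h --> 0^'+] --> rnorm (F t) ^+ 2.
    rewrite expr2; under eq_fun do rewrite expr2.
    by apply: cvgM; apply: cvg_rnorm; exact: Fleft.
  have e2 : 0 < e / 2 by rewrite divr_gt0.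
  have e3 : 0 < e / 2 / (B + 1) by rewrite !divr_gt0 // ltr_wpDl.
  move/cvgrPdist_lt/(_ _ e2) : sqc => sqc.
  apply: filterS3 (nbhs_right_gt 0) (filterI (nbhs_right_lt t0) (nbhs_right_lt e3)) sqc.
  move=> h h0 [/= ht he].
  have th0 : 0 <= t - h by rewrite subr_ge0 ltW.
  have th : t - h <= t by rewrite gerBl ltW.
  rewrite ltr_norml => /andP[_ H].
  rewrite (I_cat th0 th).
  have : fine (I (t - h) t) <= B * (t - (t - h)).
    rewrite -lee_fin -Ifin //; apply: I_le => // s ts _.
    by rewrite gB // (le_trans th0).
  rewrite subKr => HI.
  have hB : h * (B + 1) < e / 2.
    by rewrite -ltr_pdivlMr ?ltr_wpDl.
  nra.
- move=> t t0 ttau e e0.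
  have e2 : 0 < e / 2 by rewrite divr_gt0.
  have sqc := dini_sqr_rnorm (Fright t0) (FD t0) e2.
  have /cvgrPdist_lt/(_ _ e2)/near_right0P[d d0 Hd] := gc t0.
  apply: filterS3 (nbhs_right_gt 0) (nbhs_right_lt d0) sqc => h h0 hd Fh.
  have th : t <= t + h by rewrite lerDl ltW.
  have : fine (I t (t + h)) <= (g t + e / 2) * (t + h - t).
    rewrite -lee_fin -Ifin //; apply: I_le => //.
      by rewrite addr_ge0 ?g0 // ltW.
    move=> s; rewrite le_eqVlt => /orP[/eqP <- _|ts sth].
      by rewrite lerDl ltW.
    have := Hd (s - t); rewrite subr_gt0 ts [t + _]addrC subrK => H.
    have /H : true && (s - t < d) by rewrite /= ltrBlDl (lt_trans sth) // ltrD2l.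
    by rewrite ltr_norml => /andP[gst _]; lra.
  rewrite (I_cat t0 th) addrAC subrr add0r.
  nra.
Qed.

Lemma dissipated_energy :
  (\int[mu]_(t in `[0%R, +oo[) (g t)%:E <= (rnorm (F 0) ^+ 2)%:E)%E.
Proof.
pose E n : set R := `[0, n%:R[%classic.
have EU : \bigcup_n E n = `[0, +oo[%classic.
  apply/seteqP; split => [x [n _]|x]; rewrite /E /= !in_itv /= ?andbT.
    by move=> /andP[].
  move=> x0; exists (Num.truncn x).+1 => //=.
  by rewrite in_itv /= x0 truncnS_gt.
rewrite -EU.
have ndE : nondecreasing_seq E.
  move=> m n mn; rewrite subsetEset => x; rewrite /E /= !in_itv /= => /andP[-> xm].
  by rewrite (lt_le_trans xm) // ler_nat.
have mE n : measurable_fun (E n) (fun t => (g t)%:E).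
  by apply/measurable_EFinP; apply: measurable_funS mg => //; exact: itv_sub.
have E0 n t : E n t -> (0 <= (g t)%:E)%E.
  by rewrite /E /= in_itv /= lee_fin => /andP[t0 _]; exact: g0.
have := @ge0_nondecreasing_set_cvg_integral _ (measurableTypeR R) R E
  (fun t => (g t)%:E) lebesgue_measure ndE
  (fun n => measurable_itv _) mE E0.
apply: cvge_le; apply: nearW => n; exact: dissipated_energy_le.
Qed.

End DissipatedEnergy.

(** * Outputs of the closed loop *)

(** The energy of [F] pays for the square of [f]. *)
Lemma right_continuous_L2_Linfty (R : realType) (V : normedModType R[i])
    (X : hilbertType R) (f : R -> V) (F D : R -> X) (B k : R) : 0 < k ->
  (forall t, 0 <= t -> f (t + h) @[h --> 0^'+] --> f t) ->
  (forall t, 0 <= t -> rnorm (f t) <= B) ->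
  (forall t, 0 < t -> F (t - h) @[h --> 0^'+] --> F t) ->
  (forall t, 0 <= t -> right_derivative F t (D t)) ->
  (forall t, 0 <= t -> 2 * ip (D t) (F t) <= - (k * rnorm (f t) ^+ 2)) ->
  L2 `]0, +oo[%classic f /\ Linfty `]0, +oo[%classic f.
Proof.
move=> k0 frc fB Fl Fr FD.
have [s Hs fs] := right_continuous_simple frc.
have sm : strongly_measurable `]0, +oo[%classic f.
  exists s => //; apply: aeW => t /=; rewrite in_itv /= andbT => t0.
  exact/fs/ltW.
split; split => //; last first.
  by exists B; apply: aeW => t /=; rewrite in_itv /= andbT => t0; exact/fB/ltW.
have mf : measurable_fun (`[0, +oo[%classic : set R) (fun t => rnorm (f t)).
  apply: (measurable_rnorm_lim Hs) => t /=; rewrite in_itv /= andbT; exact: fs.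
have mf2 : measurable_fun (`[0, +oo[%classic : set R) (fun t => rnorm (f t) ^+ 2).
  exact: measurable_funX.
have sqc t : 0 <= t -> k * rnorm (f (t + h)) ^+ 2 @[h --> 0^'+] -->
    k * rnorm (f t) ^+ 2.
  move=> t0; rewrite expr2; under eq_fun do rewrite expr2.
  by apply: cvgMr; apply: cvgM; apply: cvg_rnorm; exact: frc.
have := @dissipated_energy R X F D (fun t => k * rnorm (f t) ^+ 2) (k * B ^+ 2)
  (measurable_funM (measurable_cst _) mf2) _ _ sqc Fl Fr FD.
under eq_integral do rewrite EFinM.
rewrite ge0_integralZl_EFin //; last 3 first.
- by move=> t _; rewrite lee_fin sqr_ge0.
- exact/measurable_EFinP.
- exact: ltW.
move=> H; have {}H := H (fun t _ => mulr_ge0 (ltW k0) (sqr_ge0 _)) _.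
apply: (@le_lt_trans _ _ (\int[lebesgue_measure]_(t in `[0%R, +oo[) (rnorm (f t) ^+ 2)%:E)%E).
  apply: integral_le_nonmeasurable => //.
  - by move=> t /=; rewrite !in_itv /= !andbT => /ltW.
  - by move=> t _; rewrite lee_fin sqr_ge0.
  - by move=> t _; rewrite lee_fin sqr_ge0.
have {}H : (k%:E * \int[lebesgue_measure]_(t in `[0%R, +oo[) (rnorm (f t) ^+ 2)%:E < +oo)%E.
  apply: le_lt_trans (ltry _); apply: H => t t0.
  by rewrite ler_pM2l // lerXn2r ?nnegrE ?rnorm_ge0 ?fB // (le_trans (rnorm_ge0 _) (fB t t0)).
move: H; apply: contraTT; rewrite -!leNgt !leye_eq => /eqP ->.
by rewrite gt0_muley ?lte_fin.
Qed.

(** On bounded sets the two coercivity conditions, and local Lipschitz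
    continuity at the origin, amount to a quadratic bound. *)
Lemma coercive_on_bounded (R : realType) (U : hilbertType R) (phi : U -> U)
    (B : R) : locally_lipschitz phi -> phi 0 = 0 ->
  (exists alpha beta delta : R,
      [/\ 0 < alpha, 0 < beta, 0 < delta,
          forall u : U, rnorm u < delta ->
            alpha * rnorm u ^+ 2 <= complex.Re (hdot (phi u) u) &
          forall u : U, delta <= rnorm u ->
            beta <= complex.Re (hdot (phi u) u)]) ->
  exists K : R, 0 < K /\ forall v, rnorm v <= B -> rnorm (phi v) <= B ->
    rnorm v ^+ 2 <= K * ip (phi v) v /\ rnorm (phi v) ^+ 2 <= K * ip (phi v) v.
Proof.
move=> phi_lip phi0 [a [b [d [a0 b0 d0 Ha Hb]]]].
have [r [L [r0 L0 HL]]] := locally_lipschitz_r phi_lip 0.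
pose m := Num.min b (a * r ^+ 2).
have m0 : 0 < m by rewrite lt_min b0 mulr_gt0 // exprn_gt0.
pose K := a^-1 + L ^+ 2 / a + B ^+ 2 / m.
have K1 : 0 < a^-1 by rewrite invr_gt0.
have K2 : 0 <= L ^+ 2 / a by rewrite divr_ge0 ?sqr_ge0 // ltW.
have K3 : 0 <= B ^+ 2 / m by rewrite divr_ge0 ?sqr_ge0 // ltW.
exists K; split; first by rewrite /K -addrA ltr_wpDr // addr_ge0.
move=> v vB pvB; rewrite -/(ip _ _) in Ha Hb.
have near0 : rnorm v < d -> rnorm v <= r ->
    rnorm v ^+ 2 <= K * ip (phi v) v /\ rnorm (phi v) ^+ 2 <= K * ip (phi v) v.
  move=> vd vr; have p := Ha v vd; rewrite -/(ip _ _) in p.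
  have v2 : rnorm v ^+ 2 <= a^-1 * ip (phi v) v by rewrite ler_pdivlMl.
  have p0 : 0 <= ip (phi v) v by rewrite (le_trans _ p) // mulr_ge0 ?sqr_ge0 // ltW.
  have pL : rnorm (phi v) ^+ 2 <= L ^+ 2 * rnorm v ^+ 2.
    rewrite -exprMn lerXn2r ?nnegrE ?rnorm_ge0 ?mulr_ge0 ?rnorm_ge0 ?(ltW L0) //.
    by have := HL v 0; rewrite phi0 !subr0 rnorm0; apply => //; exact: ltW.
  have q2 := mulr_ge0 K2 p0; have q3 := mulr_ge0 K3 p0.
  have q1 := mulr_ge0 (ltW K1) p0.
  have : L ^+ 2 * rnorm v ^+ 2 <= L ^+ 2 / a * ip (phi v) v.
    by rewrite -mulrA ler_wpM2l // sqr_ge0.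
  rewrite /K !mulrDl; split; lra.
have far : m <= ip (phi v) v ->
    rnorm v ^+ 2 <= K * ip (phi v) v /\ rnorm (phi v) ^+ 2 <= K * ip (phi v) v.
  move=> pm; have p0 : 0 <= ip (phi v) v by rewrite (le_trans _ pm) // ltW.
  have BK : B ^+ 2 <= K * ip (phi v) v.
    have : B ^+ 2 / m * m <= B ^+ 2 / m * ip (phi v) v by rewrite ler_wpM2l.
    rewrite divfK ?gt_eqF // /K !mulrDl.
    have q2 := mulr_ge0 K2 p0; have q1 := mulr_ge0 (ltW K1) p0; lra.
  by split; apply: le_trans BK; rewrite lerXn2r ?nnegrE ?rnorm_ge0 //
    (le_trans (rnorm_ge0 v)).
have [dv|vd] := leP d (rnorm v).
  by apply: far; rewrite (le_trans _ (Hb v dv)) // ge_min lexx.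
have [vr|rv] := leP (rnorm v) r; first exact: near0.
apply: far; apply: (le_trans _ (Ha v vd)); rewrite ge_min; apply/orP; right.
by rewrite ler_pM2l // lerXn2r ?nnegrE ?rnorm_ge0 ?ltW.
Qed.

Section Outputs.
Context {R : realType} {U X : hilbertType R}.
Variables (S : system_node U X U).
Hypothesis S_passive : impedance_passive S.
Variables lam c : R.
Hypothesis lam0 : 0 < lam.
Hypothesis c0 : 0 < c.
Hypothesis lam_res : resolvent_set (main_graph S) lam%:C.
Hypothesis transfer_ge : re_ge (transfer S lam%:C) c.
Variable phi : U -> U.
Hypothesis phi_mono : monotone_map phi.
Hypothesis phi_lip : locally_lipschitz phi.
Hypothesis phi0 : phi 0 = 0.
Hypothesis phi_coercive : exists alpha beta delta : R,
      [/\ 0 < alpha, 0 < beta, 0 < delta,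
          forall u : U, rnorm u < delta ->
            alpha * rnorm u ^+ 2 <= complex.Re (hdot (phi u) u) &
          forall u : U, delta <= rnorm u ->
            beta <= complex.Re (hdot (phi u) u)].
Hypothesis Gsv : single_valued (feedback_graph S phi).

Local Notation G := (feedback_graph S phi).

Lemma feedback_at0 : feedback_at S phi 0 0 0.
Proof.
apply/(feedback_node S lam phi); rewrite !oppr0 phi0.
by split; [exact: ldom0|rewrite snode0 !scaler0 ?addr0 ?subr0].
Qed.

Lemma feedback_dissipated x v w : feedback_at S phi x v w ->
  ip w x <= - ip (phi (- v)) (- v).
Proof.
move=> f; have := feedback_passive S_passive lam f feedback_at0.
by rewrite !oppr0 phi0 !oppr0 !addr0.
Qed.

(** The equilibrium, with which other trajectories are compared. *)
Lemma zero_trajectory : trajectory G 0 (fun=> 0) (fun=> 0).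
Proof.
split.
- by move=> t _; exists 0; exact: feedback_at0.
- by move=> t _; rewrite rnorm0.
- by move=> s t _ _; rewrite subrr rnorm0 mul0r.
- move=> t _; rewrite /right_derivative; under eq_fun do rewrite subrr scaler0.
  exact: cvg_cst.
Qed.

Variables (M : R) (u w : R -> X) (y : R -> U).
Hypothesis traj : trajectory G M u w.
Hypothesis Hy : forall t, 0 <= t -> feedback_at S phi (u t) (y t) (w t).

(** The output is a Lipschitz function of [lam u - w], which is continuous from
    the right. *)
Lemma output_right_continuous t : 0 <= t ->
  y (t + h) @[h --> 0^'+] --> y t /\ phi (- y (t + h)) @[h --> 0^'+] --> phi (- y t).
Proof.
move=> t0; have [K [K0 HK]] := feedback_lipschitz S_passive lam0 c0 lam_res
  transfer_ge phi_mono.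
have [Y HY] := feedback_yosida S_passive lam0 c0 lam_res transfer_ge phi_mono phi_lip.
have Gdiss := feedback_dissipative S_passive lam phi_mono.
have [Gu wM uL du] := traj.
have wc := trajectory_speed_right_continuous Gdiss HY Gsv traj t0.
have uc := lipschitz_right_continuous uL t0.
have rc : K * rnorm (lam%:C *: (u (t + h) - u t) - (w (t + h) - w t)) @[h --> 0^'+] -->
    K * rnorm (lam%:C *: (u t - u t) - (w t - w t)).
  apply: cvgMr; apply: cvg_rnorm; apply: cvgB.
    by apply: cvgZr; apply: cvgB => //; exact: cvg_cst.
  by apply: cvgB => //; exact: cvg_cst.
rewrite !subrr scaler0 subr0 rnorm0 mulr0 in rc.
have bound : \forall h \near 0^'+,
    rnorm (y (t + h) - y t) + rnorm (phi (- y (t + h)) - phi (- y t)) <=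
    K * rnorm (lam%:C *: (u (t + h) - u t) - (w (t + h) - w t)).
  near=> h; have h0 : 0 < h by [].
  by apply: HK; apply: Hy => //; rewrite addr_ge0 // ltW.
split; apply/cvg_rnormP; apply: (squeeze_cvgr _ (cvg_cst 0) rc).
  apply: filterS bound => h; rewrite rnorm_ge0 /=; apply: le_trans.
  by rewrite lerDl rnorm_ge0.
apply: filterS bound => h; rewrite rnorm_ge0 /=; apply: le_trans.
by rewrite lerDr rnorm_ge0.
Unshelve. all: by end_near. Qed.

Lemma output_bounded : exists B : R, forall t, 0 <= t ->
  rnorm (y t) <= B /\ rnorm (phi (- y t)) <= B.
Proof.
have [K [K0 HK]] := feedback_lipschitz S_passive lam0 c0 lam_res
  transfer_ge phi_mono.
have Gdiss := feedback_dissipative S_passive lam phi_mono.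
have [Gu wM uL du] := traj.
exists (K * (lam * rnorm (u 0) + M)) => t t0.
have u0 : rnorm (u t) <= rnorm (u 0).
  have := trajectory_contraction Gdiss traj zero_trajectory (lexx 0) t0.
  by rewrite !subr0.
have := HK _ _ _ _ _ _ (Hy t0) feedback_at0; rewrite !oppr0 phi0 !oppr0 !addr0.
have : rnorm (lam%:C *: u t - w t) <= lam * rnorm (u 0) + M.
  rewrite (le_trans (rnormB_le _ _)) // rnormZr gtr0_norm // lerD ?wM //.
  by rewrite ler_pM2l.
have := rnorm_ge0 (y t); have := rnorm_ge0 (phi (- y t)).
by split; nra.
Qed.

(** Outputs of a trajectory are bounded, which brings all of them into the range
    of [coercive_on_bounded]. *)
Lemma output_dissipated : exists K : R, 0 < K /\ forall t, 0 <= t ->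
  [/\ rnorm (y t) ^+ 2 <= - (K * ip (w t) (u t)),
      rnorm (phi (- y t)) ^+ 2 <= - (K * ip (w t) (u t)) &
      0 <= - ip (w t) (u t)].
Proof.
have [B HB] := output_bounded.
have [K [K0 HK]] := coercive_on_bounded B phi_lip phi0 phi_coercive.
exists K; split => // t t0; have [yB pB] := HB t t0.
rewrite -rnormN in yB; have [h1 h2] := HK _ yB pB.
have := feedback_dissipated (Hy t0).
rewrite rnormN in h1 => d; have := ler_wpM2l (ltW K0) d; rewrite mulrN.
have := monotone_mapP phi_mono (- y t) 0; rewrite phi0 !subr0.
by split; lra.
Qed.

Lemma output_L2_Linfty :
  [/\ L2 `]0, +oo[%classic y, Linfty `]0, +oo[%classic y,
      L2 `]0, +oo[%classic (fun t => phi (- y t)) &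
      Linfty `]0, +oo[%classic (fun t => phi (- y t))].
Proof.
have [B HB] := output_bounded.
have [K [K0 HK]] := output_dissipated.
have [Gu wM uL du] := traj.
have k0 : 0 < 2 / K by rewrite divr_gt0.
have uleft t : 0 < t -> u (t - h) @[h --> 0^'+] --> u t.
  exact: (lipschitz_left_continuous uL).
have E (a b : R) : a <= - (K * b) -> 2 * b <= - (2 / K * a).
  move=> H; rewrite mulrAC lerNr -ler_pdivlMr ?invr_gt0 // invrK; lra.
have [] := right_continuous_L2_Linfty k0 (fun t t0 => (output_right_continuous t0).1)
  (fun t t0 => (HB t t0).1) uleft du.
  by move=> t t0; have [h _ _] := HK t t0; exact: E.
have [] := right_continuous_L2_Linfty k0 (fun t t0 => (output_right_continuous t0).2)
  (fun t t0 => (HB t t0).2) uleft du.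
  by move=> t t0; have [_ h _] := HK t t0; exact: E.
by [].
Qed.

End Outputs.

(** * Asymptotic stability of the closed loop *)

Lemma dense_rnorm (R : realType) (V : normedModType R[i]) (A : set V) (x : V)
    (e : R) : dense A -> 0 < e -> exists2 y, A y & rnorm (y - x) < e.
Proof.
move=> Ad e0.
have nx : nbhs x [set y | rnorm (y - x) < e] by apply/nbhs_rnormP; exists e.
have [||y [/interior_subset yx Ay]] := Ad ([set y | rnorm (y - x) < e]^°).
- by exists x; exact: nx.
- exact: open_interior.
- by exists y.
Qed.

Section Stability.
Context {R : realType} {U X : hilbertType R}.
Variables (S : system_node U X U).
Hypothesis S_passive : impedance_passive S.
Variables lam c : R.
Hypothesis lam0 : 0 < lam.
Hypothesis c0 : 0 < c.
Hypothesis lam_res : resolvent_set (main_graph S) lam%:C.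
Hypothesis transfer_ge : re_ge (transfer S lam%:C) c.
Variable phi : U -> U.
Variable T : R -> X -> X.
Hypothesis HT : generates (negative_feedback_graph S) T.

(** The difference of the closed loop and of the linear closed loop is driven
    by [y + phi (- y)], whose square is dominated by the energy that the
    former dissipates. *)
Lemma linear_comparison (K M : R) (u w : R -> X) (y : R -> U) (z0 a0 : X) (t : R) :
  0 <= K -> trajectory (feedback_graph S phi) M u w ->
  (forall t, 0 <= t -> feedback_at S phi (u t) (y t) (w t)) ->
  (forall t, 0 <= t -> rnorm (y t) ^+ 2 <= - (K * ip (w t) (u t)) /\
     rnorm (phi (- y t)) ^+ 2 <= - (K * ip (w t) (u t))) ->
  negative_feedback_graph S z0 a0 -> 0 <= t ->
  rnorm (u t - T t z0) ^+ 2 + K * rnorm (u t) ^+ 2 <=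
  rnorm (u 0 - z0) ^+ 2 + K * rnorm (u 0) ^+ 2.
Proof.
move=> K0 traj Hy HK Gz0 t0; have [Gu wM uL du] := traj.
have [HTc HTg] := HT; have [_ T0 _ _] := HTc.
have gz := (HTg z0 a0).1 Gz0.
rewrite -{2}[z0]T0.
apply: (@energy_nonincreasing R X X (fun t => u t - T t z0)
  (fun t => w t - T t a0) u w K 0 t) => //.
- move=> s s0 _; apply: cvgB; first exact: (lipschitz_left_continuous uL).
  exact: semigroup_left_continuous.
- by move=> s s0 _; exact: (lipschitz_left_continuous uL).
- move=> s s0 _; apply: right_derivativeB; first exact: du.
  exact: semigroup_right_derivative.
- by move=> s s0 _; exact: du.
- move=> s s0 _; have [yK pK] := HK s s0.
  have [v /(feedback_node S lam id) nz] := (HTg _ _).2 (semigroup_generator HTc gz s0).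
  have /(feedback_node S lam phi) nu := Hy s s0.
  have := node_passive S_passive (node_atB nu nz).
  set a := y s - v; set d := y s + phi (- y s).
  have -> : phi (- y s) - - v = d - a.
    by rewrite /a /d; apply: ip_ext => e; rewrite !ipE; ring.
  have -> : lam%:C *: (u s - T s z0) -
      (lam%:C *: u s - w s - (lam%:C *: T s z0 - T s a0)) = w s - T s a0.
    by apply: ip_ext => e; rewrite !ipE; ring.
  have dK : rnorm d ^+ 2 <= 4 * - (K * ip (w s) (u s)).
    have := sqr_ge0 (rnorm (y s - phi (- y s))).
    rewrite /d sqr_rnormB sqr_rnormD; lra.
  have := sqr_ge0 (rnorm (d - 2%:C *: a)); rewrite sqr_rnormBZ.
  rewrite [ip a (d - a)]ipDr ipNr ipxx; lra.
Qed.

Hypothesis T_stable : strongly_stable T.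
Hypothesis phi_mono : monotone_map phi.
Hypothesis phi_lip : locally_lipschitz phi.
Hypothesis phi0 : phi 0 = 0.
Hypothesis phi_coercive : exists alpha beta delta : R,
      [/\ 0 < alpha, 0 < beta, 0 < delta,
          forall u : U, rnorm u < delta ->
            alpha * rnorm u ^+ 2 <= complex.Re (hdot (phi u) u) &
          forall u : U, delta <= rnorm u ->
            beta <= complex.Re (hdot (phi u) u)].
Hypothesis Gsv : single_valued (feedback_graph S phi).

Local Notation G := (feedback_graph S phi).

(** The energy [rnorm u ^+ 2] decreases to a limit. From a time [s] at which it
    nearly equals the limit, little energy remains to be dissipated, so that [u]
    stays close to the linear flow from a point of its domain near [u s], and
    this flow tends to [0]. *)
Lemma trajectory_stable (M : R) (u w : R -> X) : trajectory G M u w ->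
  rnorm (u t) @[t --> +oo] --> (0 : R).
Proof.
move=> traj; have [Gu wM uL du] := traj.
have Gdiss := feedback_dissipative S_passive lam phi_mono.
have [y Hy] : exists y, forall t, 0 <= t -> feedback_at S phi (u t) (y t) (w t).
  suff /choice[y Hy] : forall t, exists v, 0 <= t -> feedback_at S phi (u t) v (w t).
    by exists y.
  move=> t; have [t0|] := leP 0 t; last by exists 0.
  by have [v f] := Gu t t0; exists v.
have [K [K0 HK]] := output_dissipated S_passive lam0 c0 lam_res transfer_ge phi_mono
  phi_lip phi0 phi_coercive traj Hy.
apply/cvgrPdist_lt => e e0.
pose E := [set rnorm (u t) ^+ 2 | t in [set t : R | 0 <= t]].
have infE : has_inf E.
  split; first by exists (rnorm (u 0) ^+ 2); exists 0 => /=.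
  by exists 0 => _ [t _ <-]; exact: sqr_ge0.
have d0 : 0 < e ^+ 2 / 16 / K by rewrite !divr_gt0 // exprn_gt0.
have [_ [s s0 <-] Hs] := inf_adherent d0 infE.
have e4 : 0 < e / 4 by rewrite divr_gt0.
have [z0 [a0 Gz0] z0u] := dense_rnorm (u s)
  (negative_feedback_dense S_passive lam0 c0 lam_res transfer_ge) e4.
have /near_rnormP/(_ _ (divr_gt0 e0 (ltr0n _ 2))) := T_stable z0.
move=> -[r [rreal Hr]]; exists (Num.max r 0 + s); split; first exact: num_real.
move=> t rt; rewrite sub0r normrN ger0_norm ?rnorm_ge0 //.
have ts : 0 <= t - s.
  by rewrite subr_ge0 ltW // (le_lt_trans _ rt) // lerDr le_max lexx orbT.
have tr : r < t - s.
  by rewrite ltrBrDr (le_lt_trans _ rt) // lerD2r le_max lexx.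
have := linear_comparison (ltW K0) (trajectory_shift s0 traj)
  (fun t t0 => Hy _ (addr_ge0 t0 s0))
  (fun t t0 => let: And3 h1 h2 _ := HK _ (addr_ge0 t0 s0) in conj h1 h2) Gz0 ts.
rewrite /= subrK add0r => est.
have t0 : 0 <= t by rewrite -(subrK s t) addr_ge0.
have : inf E <= rnorm (u t) ^+ 2 by apply: inf_lbound => //; [case: infE|exists t].
move=> infu.
have KE : K * rnorm (u s) ^+ 2 - K * rnorm (u t) ^+ 2 <= e ^+ 2 / 16.
  rewrite -mulrBr mulrC -ler_pdivlMr //; lra.
have usz : rnorm (u s - z0) ^+ 2 <= (e / 4) ^+ 2.
  by rewrite rnormB lerXn2r ?nnegrE ?rnorm_ge0 ?ltW.
have utz : rnorm (u t - T (t - s) z0) < e / 2.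
  rewrite -(@ltr_pXn2r _ 2) ?nnegrE ?rnorm_ge0 ?divr_ge0 ?(ltW e0) //.
  have := exprn_gt0 2 e0; rewrite expr_div_n in usz; rewrite expr_div_n; lra.
have /= := Hr _ tr; rewrite subr0.
have := rnorm_tri (T (t - s) z0) (u t) 0; rewrite !subr0; lra.
Qed.

(** By contraction, the trajectory from the same initial state is the only strong
    solution. *)
Lemma strong_solution_trajectory (x : R -> X) : strong_solution G x ->
  exists M u w, trajectory G M u w /\ forall t, 0 <= t -> x t = u t.
Proof.
move=> sx; have Gdiss := feedback_dissipative S_passive lam phi_mono.
have [Y HY] := feedback_yosida S_passive lam0 c0 lam_res transfer_ge phi_mono phi_lip.
have [_ dom _] := sx; have [w0 Gw0] := dom 0 (lexx 0).
have [u [w [u0 traj]]] := trajectory_exists Gdiss HY Gsv Gw0.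
exists (rnorm w0), u, w; split => // t t0.
have su := trajectory_strong_solution Gdiss HY Gsv (rnorm_ge0 _) traj.
have := strong_solution_contraction Gdiss sx su t0.
rewrite u0 subrr rnorm0 => H; apply/eqP; rewrite -subr_eq0; apply/eqP.
by apply: rnorm_eq0; apply/eqP; rewrite eq_le H rnorm_ge0.
Qed.

Lemma strong_solution_stable (x : R -> X) : strong_solution G x ->
  rnorm (x t) @[t --> +oo] --> (0 : R).
Proof.
move=> /strong_solution_trajectory[M [u [w [traj xu]]]].
apply: cvg_trans (trajectory_stable traj); apply: near_eq_cvg.
by near=> t; rewrite xu.
Unshelve. all: by end_near. Qed.

Lemma generalised_solution_cvg (x : R -> X) : generalised_solution G x ->
  exists2 xk : nat -> R -> X, forall k, strong_solution G (xk k) &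
    forall t, 0 <= t -> xk k t @[k --> \oo] --> x t.
Proof.
move=> [_ [xk sxk xkx]]; exists xk => // t t0.
have t1 : 0 < t + 1 by rewrite ltr_wpDl.
apply/near_rnormP => e e0; have := xkx _ t1.
move=> /fine_cvgP[fin_sup /cvgrPdist_lt/(_ _ e0)].
apply: filterS2 fin_sup => k fk; rewrite sub0r normrN => ke.
rewrite -lte_fin (@le_lt_trans _ _ (fine (ereal_sup
  [set (rnorm (xk k t - x t))%:E | t in `[0%R, (t + 1)%R]]))%:E) //; last first.
  by rewrite lte_fin (le_lt_trans (ler_norm _) ke).
rewrite fineK //; apply: ereal_sup_ubound; exists t => //=.
by rewrite in_itv /= t0 lerDl ler01.
Qed.

Lemma generalised_solution_contraction (x x' : R -> X) t :
  generalised_solution G x -> generalised_solution G x' -> 0 <= t ->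
  rnorm (x t - x' t) <= rnorm (x 0 - x' 0).
Proof.
move=> /generalised_solution_cvg[xk sk kx] /generalised_solution_cvg[xk' sk' kx'] t0.
have lim s : 0 <= s -> rnorm (xk k s - xk' k s) @[k --> \oo] --> rnorm (x s - x' s).
  by move=> s0; apply: cvg_rnorm; apply: cvgB; [exact: kx|exact: kx'].
apply: ler_cvg_to (lim t t0) (lim 0 (lexx 0)) _; apply: nearW => k.
exact: (strong_solution_contraction (feedback_dissipative S_passive lam phi_mono)).
Qed.

(** The contraction property makes the convergence of the approximating strong
    solutions uniform over all times. *)
Lemma generalised_solution_stable (x : R -> X) : generalised_solution G x ->
  rnorm (x t) @[t --> +oo] --> (0 : R).
Proof.
move=> /generalised_solution_cvg[xk sk kx].
have dist k t : 0 <= t -> rnorm (x t - xk k t) <= rnorm (x 0 - xk k 0).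
  move=> t0.
  have lim s : 0 <= s -> rnorm (xk j s - xk k s) @[j --> \oo] --> rnorm (x s - xk k s).
    by move=> s0; apply: cvg_rnorm; apply: cvgB; [exact: kx|exact: cvg_cst].
  apply: ler_cvg_to (lim t t0) (lim 0 (lexx 0)) _; apply: nearW => j.
  exact: (strong_solution_contraction (feedback_dissipative S_passive lam phi_mono)).
apply/cvgrPdist_lt => e e0; have e2 : 0 < e / 2 by rewrite divr_gt0.
have /near_rnormP/(_ _ e2)[N _ /(_ N (leqnn N)) /= HN] := kx 0 (lexx 0).
have /cvgrPdist_lt/(_ _ e2) := strong_solution_stable (sk N).
apply: filterS2 (nbhs_pinfty_ge (num_real 0)) => t t0.
rewrite !sub0r !normrN !ger0_norm ?rnorm_ge0 // => xt.
have := rnorm_tri (xk N t) (x t) 0; rewrite !subr0.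
have := dist N t t0; rewrite (rnormB (x 0)); lra.
Qed.

(** Trajectories from initial states in the dense domain converge uniformly in
    time, by contraction. *)
Lemma generalised_solution_exists x0 : dense (gdom G) ->
  exists x, generalised_solution G x /\ x 0 = x0.
Proof.
move=> Gd; have Gdiss := feedback_dissipative S_passive lam phi_mono.
have [Y HY] := feedback_yosida S_passive lam0 c0 lam_res transfer_ge phi_mono phi_lip.
have /choice[p Hp] : forall k : nat, exists p : R * (R -> X) * (R -> X),
    [/\ 0 <= p.1.1, trajectory G p.1.1 p.1.2 p.2 & rnorm (p.1.2 0 - x0) < 2^-1 ^+ k].
  move=> k; have [|z [a Gz] zx] := dense_rnorm x0 Gd (_ : 0 < 2^-1 ^+ k).
    by rewrite exprn_gt0.
  have [u [w [u0 traj]]] := trajectory_exists Gdiss HY Gsv Gz.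
  by exists (rnorm a, u, w); rewrite /= u0; split => //; exact: rnorm_ge0.
pose u k := (p k).1.2.
have traj k : trajectory G (p k).1.1 (u k) (p k).2 by have [] := Hp k.
have M0 k : 0 <= (p k).1.1 by have [] := Hp k.
have q0 k : 0 < (2^-1 : R) ^+ k by rewrite exprn_gt0.
have u0 k : rnorm (u k 0 - x0) < 2^-1 ^+ k by have [] := Hp k.
have half_cvg := @cvg_half_expn R.
have u0c : u k 0 @[k --> \oo] --> x0.
  apply/cvg_rnormP; apply: (squeeze_cvgr _ (cvg_cst 0) half_cvg).
  by apply: nearW => k; rewrite rnorm_ge0 ltW.
have dist j k t : 0 <= t -> rnorm (u j t - u k t) <= rnorm (u j 0 - u k 0).
  exact: (trajectory_contraction Gdiss (traj j) (traj k) (lexx 0)).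
have /choice[X0 HX] : forall t : R, exists l : X, 0 <= t -> u k t @[k --> \oo] --> l.
  move=> t; have [t0|] := leP 0 t; last by exists 0.
  suff /cvg_ex[l ul] : cvgn (u^~ t) by exists l.
  apply: cauchy_rnorm_cvg => e e0; have e2 : 0 < e / 2 by rewrite divr_gt0.
  have /near_rnormP/(_ _ e2)[N _ HN] := u0c.
  exists N => m n mN nN; have /= h1 := HN m mN; have /= h2 := HN n nN.
  have := dist m n t t0; have := rnorm_tri x0 (u m 0) (u n 0).
  rewrite (rnormB x0); lra.
pose x t := X0 (Num.max t 0).
have max_ge0 (t : R) : 0 <= Num.max t 0 by rewrite le_max lexx orbT.
have xE t : 0 <= t -> x t = X0 t by move=> t0; rewrite /x max_l.
have x00 : x 0 = x0.
  by rewrite xE //; exact: (rnorm_cvg_unique (HX 0 (lexx 0)) u0c).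
have distx k t : 0 <= t -> rnorm (u k t - X0 t) <= 2^-1 ^+ k.
  move=> t0.
  have lim s : 0 <= s -> rnorm (u k s - u j s) @[j --> \oo] --> rnorm (u k s - X0 s).
    by move=> s0; apply: cvg_rnorm; apply: cvgB; [exact: cvg_cst|exact: HX].
  apply: (@le_trans _ _ (rnorm (u k 0 - X0 0))).
    by apply: ler_cvg_to (lim t t0) (lim 0 (lexx 0)) _; apply: nearW => j; exact: dist.
  by rewrite -(xE 0) // x00 ltW.
exists x; split => //; split.
- apply: continuous_subspaceT => t; apply/near_rnormP => e e0.
  have e4 : 0 < e / 4 by rewrite divr_gt0.
  have /cvgrPdist_lt/(_ _ e4)[N _ /(_ N (leqnn N)) /=] := half_cvg.
  rewrite sub0r normrN ger0_norm ?ltW // => Ne.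
  have [_ _ uL _] := traj N.
  have uL' (s r : R) : 0 <= s -> 0 <= r ->
      rnorm (u N s - u N r) <= (p N).1.1 * `|s - r|.
    move=> s0 r0; have [sr|rs] := leP s r.
      by rewrite rnormB ler0_norm ?subr_le0 // opprB; exact: uL.
    by rewrite gtr0_norm ?subr_gt0 //; apply: uL => //; exact: ltW.
  have m1 : 0 < e / 4 / ((p N).1.1 + 1) by rewrite !divr_gt0 // ltr_wpDl.
  apply/nbhs_normP; exists (e / 4 / ((p N).1.1 + 1)) => //= s ts.
  have maxL : `|Num.max s 0 - Num.max t 0| <= `|t - s|.
    have h1 := ler_norm (t - s); have h2 := ler_norm (s - t); rewrite distrC in h2.
    rewrite ler_norml; apply/andP.
    by case: (leP s 0) => s0; case: (leP t 0) => t0; split; lra.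
  have := uL' _ _ (max_ge0 s) (max_ge0 t).
  have := distx N _ (max_ge0 s); have := distx N _ (max_ge0 t).
  rewrite -/(x s) -/(x t).
  have := rnorm_tri (u N (Num.max s 0)) (x s) (x t).
  have := rnorm_tri (u N (Num.max t 0)) (u N (Num.max s 0)) (x t).
  rewrite (rnormB (x s) (u N _)).
  have : (p N).1.1 * `|Num.max s 0 - Num.max t 0| <= e / 4.
    apply: (@le_trans _ _ (((p N).1.1 + 1) * `|t - s|)).
      by rewrite ler_pM // lerDl.
    by rewrite mulrC -ler_pdivlMr ?ltr_wpDl // ltW.
  lra.
- exists u => [k|tau tau0].
    exact: (trajectory_strong_solution Gdiss HY Gsv (M0 k) (traj k)).
  apply: (@squeeze_cvge _ _ _ _ (cst 0%E) _ (fun k => ((2^-1 : R) ^+ k)%:E)).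
  + apply: nearW => k; apply/andP; split.
      apply: (@le_trans _ _ (rnorm (u k 0 - x 0))%:E); first by rewrite lee_fin rnorm_ge0.
      by apply: ereal_sup_ubound; exists 0 => //=; rewrite in_itv /= lexx ltW.
    apply: ge_ereal_sup => _ [t /= + <-]; rewrite in_itv /= => /andP[t0 _].
    by rewrite lee_fin xE // distx.
  + exact: cvg_cst.
  + by apply: cvg_EFin; [exact: nearW|exact: half_cvg].
Qed.

End Stability.

Theorem theorem4p3 (R : realType) (U X : hilbertType R)
    (S : system_node U X U) (S_passive : impedance_passive S)
    (S_transfer : exists lam c : R, [/\ 0 < lam, 0 < c,
      resolvent_set (main_graph S) lam%:C & re_ge (transfer S lam%:C) c])
    (phi : U -> U) (phi_continuous : continuous phi)
    (phi_monotone : monotone_map phi)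
    (phi_lipschitz : locally_lipschitz phi) (phi0 : phi 0 = 0)
    (phi_coercive : exists alpha beta delta : R,
      [/\ 0 < alpha, 0 < beta, 0 < delta,
          forall u : U, rnorm u < delta ->
            alpha * rnorm u ^+ 2 <= complex.Re (hdot (phi u) u) &
          forall u : U, delta <= rnorm u ->
            beta <= complex.Re (hdot (phi u) u)])
    (Aphi_single_valued : single_valued (feedback_graph S phi))
    (AK_stable : exists2 T : R -> X -> X,
      generates (negative_feedback_graph S) T & strongly_stable T) :
  [/\ forall x : R -> X, generalised_solution (feedback_graph S phi) x ->
        rnorm (x t) @[t --> +oo] --> (0 : R),
      forall (x : R -> X) (y : R -> U),
        strong_solution (feedback_graph S phi) x ->
        (forall t, 0 <= t -> feedback_output S phi (x t) (y t)) ->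
        [/\ L2 `]0, +oo[ y, Linfty `]0, +oo[ y,
            L2 `]0, +oo[ (fun t => phi (- y t)) &
            Linfty `]0, +oo[ (fun t => phi (- y t))] &
      dense (gdom (feedback_graph S phi)) ->
      forall x0 : X, exists x : R -> X,
        [/\ generalised_solution (feedback_graph S phi) x, x 0 = x0,
            forall x' : R -> X, generalised_solution (feedback_graph S phi) x' ->
              x' 0 = x0 -> forall t, 0 <= t -> x' t = x t &
            rnorm (x t) @[t --> +oo] --> (0 : R)]].
Proof.
have [lam [c [lam0 c0 lam_res transfer_ge]]] := S_transfer.
have [T HT Tst] := AK_stable.
have stable := generalised_solution_stable S_passive lam0 c0 lam_res transfer_ge HT Tst
  phi_monotone phi_lipschitz phi0 phi_coercive Aphi_single_valued.
split.
- exact: stable.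
- move=> x y sx Hy.
  have [M [u [w [traj xu]]]] := strong_solution_trajectory S_passive lam0 c0 lam_res
    transfer_ge phi_monotone phi_lipschitz Aphi_single_valued sx.
  have [Gu _ _ _] := traj.
  apply: (output_L2_Linfty S_passive lam0 c0 lam_res transfer_ge phi_monotone
    phi_lipschitz phi0 phi_coercive Aphi_single_valued traj) => t t0.
  have [w' f] := Hy t t0; rewrite xu // in f.
  suff -> : w t = w' by [].
  by apply: (Aphi_single_valued _ _ _ (Gu t t0)); exists (y t).
- move=> Gdense x0.
  have [x [gx xx0]] := generalised_solution_exists S_passive lam0 c0 lam_res
    transfer_ge phi_monotone phi_lipschitz Aphi_single_valued x0 Gdense.
  exists x; split => //; last exact: stable.
  move=> x' gx' x'0 t t0; apply/eqP; rewrite -subr_eq0; apply/eqP; apply: rnorm_eq0.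
  have := generalised_solution_contraction S_passive lam phi_monotone gx' gx t0.
  by rewrite x'0 xx0 subrr rnorm0 => H; apply/eqP; rewrite eq_le H rnorm_ge0.
Qed.
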